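(* Let $k$ be an algebraically closed field, let $w\leq 0$ be an integer and let $\mathsf{U}$ be a $k$-linear algebraic triangulated category which is idempotent complete and classically generated by a $w$-spherical object. The stability manifold of $\mathsf{U}$ is the empty set. The co-stability manifold $\operatorname{Costab}(\mathsf{U})$ is homeomorphic to $\mathbb{C}$.
   Context: An object $s$ of a $k$-linear triangulated category $\mathsf{U}$ with suspension $\Sigma$ is $w$-spherical if its graded endomorphism algebra $\bigoplus_{i\in\mathbb{Z}}\mathsf{U}(s,\Sigma^i s)$ is isomorphic to $k[X]/(X^2)$ with $X$ placed in degree $w$. ''Algebraic'' means equivalent to the stable category of a Frobenius category; ''classically generated by $s$'' means that $\mathsf{U}$ is the smallest triangulated subcategory of itself containing $s$ and closed under direct summands. Such a $\mathsf{U}$ is essentially small, Krull-Schmidt and has finitely generated $\operatorname{K}_0(\mathsf{U})$. Below $\mathsf{T}$ is an essentially small Krull-Schmidt triangulated category with finitely generated $\operatorname{K}_0(\mathsf{T})$ (Krull-Schmidt: split idempotents, every object a finite direct sum of indecomposables, indecomposables have local endomorphism rings), $\mathsf{T}(-,-)=\operatorname{Hom}_{\mathsf{T}}(-,-)$, $\operatorname{ind}$ denotes the class of indecomposable objects, subcategories are closed under isomorphism. Stability manifold (Bridgeland). A slicing $\mathscr{P}$ in $\mathsf{T}$ is a collection of full additive subcategories $\mathscr{P}(\varphi)$, $\varphi\in\mathbb{R}$, such that $\mathscr{P}(\varphi+1)=\Sigma\mathscr{P}(\varphi)$; $\varphi_1>\varphi_2$ implies $\mathsf{T}(\mathscr{P}(\varphi_1),\mathscr{P}(\varphi_2))=0$;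 and each $t\neq0$ has a finite filtration $0\cong t_0\to t_1\to\cdots\to t_n\cong t$ with distinguished triangles $t_{i-1}\to t_i\to p_i\to \Sigma t_{i-1}$, $p_i\in\mathscr{P}(\varphi_i)$, $\varphi_1>\cdots>\varphi_n$. A stability condition is a pair $(Z,\mathscr{P})$ with $Z:\operatorname{K}_0(\mathsf{T})\to\mathbb{C}$ a group homomorphism and $\mathscr{P}$ a slicing such that $Z(p)=m(p)\exp(i\pi\varphi)$ with $m(p)>0$ for $0\neq p\in\mathscr{P}(\varphi)$. It is locally-finite if there is $\eta>0$ such that for each $t\in\mathbb{R}$ the extension closure of $\bigcup_{\varphi\in]t-\eta,t+\eta[}\mathscr{P}(\varphi)$ is a quasi-abelian category of finite length (Artinian and Noetherian with respect to strict subobjects). The stability manifold is the set of locally-finite stability conditions on $\mathsf{T}$ (with Bridgeland's topology). Co-stability manifold. A co-slicing $\mathscr{Q}$ in $\mathsf{T}$ is a collection of full subcategories $\mathscr{Q}(\varphi)$, $\varphi\in\mathbb{R}$, each closed under (finite) direct sums and direct summands, such that: (i) $\mathscr{Q}(\varphi+1)=\Sigma\mathscr{Q}(\varphi)$; (ii) $\varphi_1<\varphi_2$ implies $\mathsf{T}(\mathscr{Q}(\varphi_1),\mathscr{Q}(\varphi_2))=0$; (iii) for each $t\neq0$ there are an integer $n\ge1$, morphisms $0\cong t_0\to t_1\to\cdots\to t_n\cong t$ and distinguished triangles $t_{i-1}\to t_i\to q_i\to\Sigma t_{i-1}$ with $q_i\in\mathscr{Q}(\varphi_i)$ and $\varphi_1<\cdots<\varphi_n$.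 It satisfies condition (S) if for each $\varphi$ and all $q_1,q_2\in\operatorname{ind}\mathscr{Q}(\varphi)$ with $q_1\not\cong q_2$ we have $\mathsf{T}(q_1,q_2)=0$. A co-stability condition on $\mathsf{T}$ is a pair $(Z,\mathscr{Q})$ with $Z:\operatorname{K}_0(\mathsf{T})\to\mathbb{C}$ a group homomorphism and $\mathscr{Q}$ a co-slicing such that $Z(q)=m(q)\exp(i\pi\varphi)$ with $m(q)>0$ for each $0\neq q\in\mathscr{Q}(\varphi)$. For $I\subseteq\mathbb{R}$, $\mathscr{Q}(I)$ is the smallest full subcategory containing $\bigcup_{\varphi\in I}\mathscr{Q}(\varphi)$ and closed under extensions and direct summands. The function $d(\mathscr{Q},\mathscr{R})=\inf\{\varepsilon>0\mid\mathscr{Q}(\varphi)\subseteq\mathscr{R}([\varphi-\varepsilon,\varphi+\varepsilon])\text{ for each }\varphi\in\mathbb{R}\}$ is a metric on the set of co-slicings; $\operatorname{Coslice}(\mathsf{T})$ is the set of co-slicings satisfying (S) with this metric topology. The co-stability manifold $\operatorname{Costab}(\mathsf{T})$ is the set of co-stability conditions $(Z,\mathscr{Q})$ with $\mathscr{Q}\in\operatorname{Coslice}(\mathsf{T})$, with the subspace topology from $\operatorname{Hom}_{\mathbb{Z}}(\operatorname{K}_0(\mathsf{T}),\mathbb{C})\times\operatorname{Coslice}(\mathsf{T})$, where the first factor is a finite dimensional complex vector space with its usual topology. *)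

(* Defs.v *)
From HB Require Import structures.
From mathcomp Require Import all_boot all_order all_algebra.
From mathcomp Require Import ring_quotient qpoly.
From mathcomp Require Import all_classical all_reals all_analysis.
From mathcomp Require Import complex freeg.

Set Implicit Arguments.
Unset Strict Implicit.
Unset Printing Implicit Defensive.

Import Order.TTheory GRing.Theory Num.Theory.
Import numFieldNormedType.Exports.

Local Open Scope classical_set_scope.
Local Open Scope quotient_scope.
Local Open Scope ring_scope.

Declare Scope cat_scope.
Delimit Scope cat_scope with cat.
Local Open Scope cat_scope.

Reserved Notation "g '\oc' f" (at level 40, left associativity).

(** * Linear categories *)

Record klin_category (k : fieldType) := KlinCategory {
  obj :> Type;
  Hom : obj -> obj -> lmodType k;
  idm : forall x, Hom x x;
  comp : forall x y z, Hom y z -> Hom x y -> Hom x z;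
  comp1m : forall x y (f : Hom x y), comp (idm y) f = f;
  compm1 : forall x y (f : Hom x y), comp f (idm x) = f;
  compmA : forall x y z t (h : Hom z t) (g : Hom y z) (f : Hom x y),
    comp h (comp g f) = comp (comp h g) f;
  comp_linearl : forall x y z (f : Hom x y) (a : k) (g g' : Hom y z),
    comp (a *: g + g') f = a *: comp g f + comp g' f;
  comp_linearr : forall x y z (g : Hom y z) (a : k) (f f' : Hom x y),
    comp g (a *: f + f') = a *: comp g f + comp g f'
}.

Arguments Hom {k _} _ _.
Arguments idm {k _} _.
Arguments comp {k _ _ _ _} _ _.
Notation "g '\oc' f" := (comp g f) : cat_scope.

Section CategoryNotions.
Variables (k : fieldType) (C : klin_category k).
Implicit Types x y z t : C.

Definition is_iso x y (f : Hom x y) : Prop :=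
  exists g : Hom y x, g \oc f = idm x /\ f \oc g = idm y.

Definition isomorphic x y : Prop := exists f : Hom x y, is_iso f.

Definition is_mono x y (f : Hom x y) : Prop :=
  forall t (g h : Hom t x), f \oc g = f \oc h -> g = h.

Definition is_epi x y (f : Hom x y) : Prop :=
  forall t (g h : Hom y t), g \oc f = h \oc f -> g = h.

Definition is_zero x : Prop :=
  forall y, (forall f : Hom x y, f = 0) /\ (forall f : Hom y x, f = 0).

Definition is_biproduct x y s : Prop :=
  exists (i1 : Hom x s) (i2 : Hom y s) (p1 : Hom s x) (p2 : Hom s y),
    [/\ p1 \oc i1 = idm x, p2 \oc i2 = idm y, p1 \oc i2 = 0, p2 \oc i1 = 0
      & i1 \oc p1 + i2 \oc p2 = idm s].

Definition is_summand x s : Prop := exists y, is_biproduct x y s.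

Definition is_additive : Prop :=
  (exists z, is_zero z) /\ (forall x y, exists s, is_biproduct x y s).

Definition indecomposable x : Prop :=
  ~ is_zero x /\ (forall y z, is_biproduct y z x -> is_zero y \/ is_zero z).

Definition idempotent_complete : Prop :=
  forall x (e : Hom x x), e \oc e = e ->
    exists y (r : Hom x y) (i : Hom y x), r \oc i = idm y /\ i \oc r = e.

Definition is_kernel x y z (f : Hom x y) (i : Hom z x) : Prop :=
  f \oc i = 0 /\
  forall t (h : Hom t x), f \oc h = 0 -> exists! u : Hom t z, i \oc u = h.

Definition is_cokernel x y z (f : Hom x y) (p : Hom y z) : Prop :=
  p \oc f = 0 /\
  forall t (h : Hom y t), h \oc f = 0 -> exists! u : Hom z t, u \oc p = h.

(* The square
     x -f-> y
     |a     |b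
     v      v
     z -g-> t
   is a pushout, respectively a pullback. *)
Definition is_pushout x y z t
    (f : Hom x y) (a : Hom x z) (b : Hom y t) (g : Hom z t) : Prop :=
  b \oc f = g \oc a /\
  forall s (h : Hom y s) (h' : Hom z s), h \oc f = h' \oc a ->
    exists! u : Hom t s, u \oc b = h /\ u \oc g = h'.

Definition is_pullback x y z t
    (f : Hom x y) (a : Hom x z) (b : Hom y t) (g : Hom z t) : Prop :=
  b \oc f = g \oc a /\
  forall s (h : Hom s y) (h' : Hom s z), b \oc h = g \oc h' ->
    exists! u : Hom s x, f \oc u = h /\ a \oc u = h'.

(* The canonical morphism from the coimage to the image is invertible. *)
Definition is_strict x y (f : Hom x y) : Prop :=
  exists (ke coim coke im : C) (i : Hom ke x) (q : Hom x coim)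
    (p : Hom y coke) (j : Hom im y) (u : Hom coim im),
    [/\ is_kernel f i /\ is_cokernel i q, is_cokernel f p /\ is_kernel p j,
        f = j \oc (u \oc q) & is_iso u].

Definition strict_mono x y (f : Hom x y) : Prop := is_strict f /\ is_mono f.
Definition strict_epi x y (f : Hom x y) : Prop := is_strict f /\ is_epi f.

Definition quasi_abelian : Prop :=
  [/\ is_additive,
      forall x y (f : Hom x y), exists z (i : Hom z x), is_kernel f i,
      forall x y (f : Hom x y), exists z (p : Hom y z), is_cokernel f p,
      forall x y z t (f : Hom x y) (a : Hom x z) (b : Hom y t) (g : Hom z t),
        is_pullback f a b g -> strict_epi g -> strict_epi f
    & forall x y z t (f : Hom x y) (a : Hom x z) (b : Hom y t) (g : Hom z t),
        is_pushout f a b g -> strict_mono f -> strict_mono g].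

Definition artinian : Prop :=
  forall x (a : nat -> C) (m : forall n, Hom (a n) x)
    (j : forall n, Hom (a n.+1) (a n)),
    (forall n, strict_mono (m n)) -> (forall n, m n.+1 = m n \oc j n) ->
    exists N : nat, forall n : nat, (N <= n)%N -> is_iso (j n).

Definition noetherian : Prop :=
  forall x (a : nat -> C) (m : forall n, Hom (a n) x)
    (j : forall n, Hom (a n) (a n.+1)),
    (forall n, strict_mono (m n)) -> (forall n, m n = m n.+1 \oc j n) ->
    exists N : nat, forall n : nat, (N <= n)%N -> is_iso (j n).

Definition finite_length : Prop := artinian /\ noetherian.

Lemma comp0m x y z (f : Hom x y) : (0 : Hom y z) \oc f = 0.
Proof.
have /eqP := comp_linearl f 1 (0 : Hom y z) 0.
by rewrite !scale1r addr0 -subr_eq0 opprD addrA subrr sub0r oppr_eq0 => /eqP.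
Qed.

Lemma compm0 x y z (g : Hom y z) : g \oc (0 : Hom x y) = 0.
Proof.
have /eqP := comp_linearr g 1 (0 : Hom x y) 0.
by rewrite !scale1r addr0 -subr_eq0 opprD addrA subrr sub0r oppr_eq0 => /eqP.
Qed.

Lemma compmDl x y z (f : Hom x y) (g g' : Hom y z) :
  (g + g') \oc f = g \oc f + g' \oc f.
Proof. by have := comp_linearl f 1 g g'; rewrite !scale1r. Qed.

Lemma compmDr x y z (g : Hom y z) (f f' : Hom x y) :
  g \oc (f + f') = g \oc f + g \oc f'.
Proof. by have := comp_linearr g 1 f f'; rewrite !scale1r. Qed.

Lemma compmZl x y z (f : Hom x y) a (g : Hom y z) :
  (a *: g) \oc f = a *: (g \oc f).
Proof. by have := comp_linearl f a g 0; rewrite !addr0 comp0m addr0. Qed.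

Lemma compmZr x y z (g : Hom y z) a (f : Hom x y) :
  g \oc (a *: f) = a *: (g \oc f).
Proof. by have := comp_linearr g a f 0; rewrite !addr0 compm0 addr0. Qed.

Lemma compmBl x y z (f : Hom x y) (g g' : Hom y z) :
  (g - g') \oc f = g \oc f - g' \oc f.
Proof. by rewrite compmDl -scaleN1r compmZl scaleN1r. Qed.

Lemma compmBr x y z (g : Hom y z) (f f' : Hom x y) :
  g \oc (f - f') = g \oc f - g \oc f'.
Proof. by rewrite compmDr -scaleN1r compmZr scaleN1r. Qed.

End CategoryNotions.

Section FullSubcategory.
Variables (k : fieldType) (C : klin_category k) (P : C -> Prop).

Definition full_sub : klin_category k :=
  @KlinCategory k {x : C | P x} (fun x y => Hom (sval x) (sval y))
    (fun x => idm (sval x)) (fun x y z g f => g \oc f)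
    (fun x y => @comp1m k C (sval x) (sval y))
    (fun x y => @compm1 k C (sval x) (sval y))
    (fun x y z t => @compmA k C (sval x) (sval y) (sval z) (sval t))
    (fun x y z => @comp_linearl k C (sval x) (sval y) (sval z))
    (fun x y z => @comp_linearr k C (sval x) (sval y) (sval z)).

End FullSubcategory.

(** * Linear functors *)

Record klin_functor (k : fieldType) (C D : klin_category k) := KlinFunctor {
  fobj :> C -> D;
  fmap : forall x y, Hom x y -> Hom (fobj x) (fobj y);
  fmap1 : forall x, fmap (idm x) = idm (fobj x);
  fmap_comp : forall x y z (g : Hom y z) (f : Hom x y),
    fmap (g \oc f) = fmap g \oc fmap f;
  fmap_linear : forall x y (a : k) (f g : Hom x y),
    fmap (a *: f + g) = a *: fmap f + fmap g
}.
Arguments fmap {k C D} _ {x y} _.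

Definition id_functor (k : fieldType) (C : klin_category k) :
    klin_functor C C :=
  @KlinFunctor k C C id (fun x y => id) (fun=> erefl)
    (fun _ _ _ _ _ => erefl) (fun _ _ _ _ _ => erefl).

Section FunctorComposition.
Variables (k : fieldType) (C D E : klin_category k).
Variables (G : klin_functor D E) (F : klin_functor C D).

Fact comp_functor1 x : fmap G (fmap F (idm x)) = idm (G (F x)).
Proof. by rewrite !fmap1. Qed.

Fact comp_functorM x y z (g : Hom y z) (f : Hom x y) :
  fmap G (fmap F (g \oc f)) = fmap G (fmap F g) \oc fmap G (fmap F f).
Proof. by rewrite !fmap_comp. Qed.

Fact comp_functor_linear x y (a : k) (f g : Hom x y) :
  fmap G (fmap F (a *: f + g)) = a *: fmap G (fmap F f) + fmap G (fmap F g).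
Proof. by rewrite !fmap_linear. Qed.

Definition comp_functor : klin_functor C E :=
  @KlinFunctor k C E (G \o F) (fun x y f => fmap G (fmap F f))
    comp_functor1 comp_functorM comp_functor_linear.

End FunctorComposition.

Fixpoint iter_functor (k : fieldType) (C : klin_category k)
    (F : klin_functor C C) (n : nat) : klin_functor C C :=
  if n is n'.+1 then comp_functor F (iter_functor F n') else id_functor C.

Definition natural (k : fieldType) (C D : klin_category k)
    (F G : klin_functor C D) (a : forall x, Hom (F x) (G x)) : Prop :=
  forall x y (f : Hom x y), a y \oc fmap F f = fmap G f \oc a x.

Definition natural_iso (k : fieldType) (C D : klin_category k)
    (F G : klin_functor C D) (a : forall x, Hom (F x) (G x)) : Prop :=
  natural a /\ forall x, is_iso (a x).

Definition is_equivalence (k : fieldType) (C D : klin_category k)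
    (F : klin_functor C D) : Prop :=
  (forall x y, bijective (@fmap k C D F x y)) /\
  (forall y, exists x, isomorphic (F x) y).

(** * Triangulated categories *)

(* A category with an endofunctor and a class of triangles, without axioms. *)
Record triangle_category (k : fieldType) := TriangleCategory {
  tri_cat :> klin_category k;
  susp : klin_functor tri_cat tri_cat;
  dist : forall x y z : tri_cat,
    Hom x y -> Hom y z -> Hom z (susp x) -> Prop
}.
Arguments susp {k _}.
Arguments dist {k _ x y z} _ _ _.

Record triangulated_axioms (k : fieldType) (T : triangle_category k) : Prop :=
  TriangulatedAxioms {
  tr_additive : is_additive T;
  tr1_iso : forall (x y z x' y' z' : T)
    (f : Hom x y) (g : Hom y z) (h : Hom z (susp x))
    (f' : Hom x' y') (g' : Hom y' z') (h' : Hom z' (susp x'))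
    (a : Hom x x') (b : Hom y y') (c : Hom z z'),
    is_iso a -> is_iso b -> is_iso c ->
    b \oc f = f' \oc a -> c \oc g = g' \oc b -> fmap susp a \oc h = h' \oc c ->
    dist f g h -> dist f' g' h';
  tr1_id : forall x z : T, is_zero z ->
    dist (idm x) (0 : Hom x z) (0 : Hom z (susp x));
  tr1_cone : forall (x y : T) (f : Hom x y),
    exists (z : T) (g : Hom y z) (h : Hom z (susp x)), dist f g h;
  tr2 : forall (x y z : T) (f : Hom x y) (g : Hom y z) (h : Hom z (susp x)),
    dist f g h <-> dist g h (- fmap susp f);
  tr3 : forall (x y z x' y' z' : T)
    (f : Hom x y) (g : Hom y z) (h : Hom z (susp x))
    (f' : Hom x' y') (g' : Hom y' z') (h' : Hom z' (susp x'))
    (a : Hom x x') (b : Hom y y'),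
    dist f g h -> dist f' g' h' -> b \oc f = f' \oc a ->
    exists c : Hom z z', c \oc g = g' \oc b /\ fmap susp a \oc h = h' \oc c;
  tr4 : forall (x y z u v w : T)
    (f : Hom x y) (f1 : Hom y u) (f2 : Hom u (susp x))
    (g : Hom y z) (g1 : Hom z v) (g2 : Hom v (susp y))
    (h1 : Hom z w) (h2 : Hom w (susp x)),
    dist f f1 f2 -> dist g g1 g2 -> dist (g \oc f) h1 h2 ->
    exists (a : Hom u w) (b : Hom w v),
      [/\ dist a b (fmap susp f1 \oc g2),
          a \oc f1 = h1 \oc g, h2 \oc a = f2,
          b \oc h1 = g1 & g2 \oc b = fmap susp f \oc h2]
}.

(* The suspension is an autoequivalence.  A quasi-inverse is part of the data,
   with [desuspK] and [suspK] the two mutually inverse adjunction morphisms;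
   [susp_coh] and [desusp_coh] are the triangle identities, written with the
   inverse of the unit in place of the unit. *)
Record triangulated_category (k : fieldType) := TriangulatedCategory {
  tr_cat :> triangle_category k;
  tr_axioms : triangulated_axioms tr_cat;
  desusp : klin_functor tr_cat tr_cat;
  desuspK : forall x : tr_cat, Hom (susp (desusp x)) x;
  suspK : forall x : tr_cat, Hom (desusp (susp x)) x;
  desuspK_iso : natural_iso (F := comp_functor susp desusp)
                            (G := id_functor tr_cat) desuspK;
  suspK_iso : natural_iso (F := comp_functor desusp susp)
                          (G := id_functor tr_cat) suspK;
  susp_coh : forall x, desuspK (susp x) = fmap susp (suspK x);
  desusp_coh : forall x, suspK (desusp x) = fmap desusp (desuspK x)
}.
Arguments desusp {k _}.

Definition triangle_equivalent (k : fieldType) (C D : triangle_category k) :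
    Prop :=
  exists (F : klin_functor C D) (a : forall x, Hom (F (susp x)) (susp (F x))),
    [/\ is_equivalence F,
        natural_iso (F := comp_functor F susp) (G := comp_functor susp F) a
      & forall (x y z : C) (f : Hom x y) (g : Hom y z) (h : Hom z (susp x)),
          dist f g h -> dist (fmap F f) (fmap F g) (a x \oc fmap F h)].

(** * Powers of the suspension and spherical objects *)

Section SuspensionPowers.
Variables (k : fieldType) (T : triangulated_category k).
Implicit Types (i j : int) (m n : nat) (x : T).

Definition spow i : klin_functor T T :=
  match i with
  | Posz n => iter_functor susp n
  | Negz n => iter_functor desusp n.+1
  end.

Definition spow_cast i j (e : i = j) x : Hom (spow i x) (spow j x) :=
  match e in _ = j' return Hom (spow i x) (spow j' x) with
  | erefl => idm (spow i x)
  end.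

Fact addNegz0_1 : (0 : int) = Negz 0 + 1. Proof. by []. Qed.
Fact addPosz1 n : Posz n.+1 = Posz n + 1. Proof. by rewrite -addn1. Qed.
Fact addNegz1 n : Negz n = Negz n.+1 + 1.
Proof. by rewrite !NegzE -(addn1 n.+1) PoszD opprD addrNK. Qed.
Fact sub0z1 : Negz 0 = (0 : int) - 1. Proof. by []. Qed.
Fact subPosz1 n : Posz n = Posz n.+1 - 1.
Proof. by rewrite (addPosz1 n) addrK. Qed.
Fact subNegz1 n : Negz n.+1 = Negz n - 1.
Proof. by rewrite (addNegz1 n) addrK. Qed.
Fact spow_posS_subproof m j : m%:Z + j + 1 = m.+1%:Z + j.
Proof. by rewrite (addPosz1 m) addrAC. Qed.
Fact spow_negS_subproof m j : - m%:Z + j - 1 = - m.+1%:Z + j.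
Proof. by rewrite (addPosz1 m) opprD addrAC. Qed.
Fact spow_neg_subproof j : j = - 0%:Z + j.
Proof. by rewrite oppr0 add0r. Qed.

Definition susp_spow j x : Hom (susp (spow j x)) (spow (j + 1) x) :=
  match j return Hom (susp (spow j x)) (spow (j + 1) x) with
  | Posz n => spow_cast (addPosz1 n) x
  | Negz 0 => spow_cast addNegz0_1 x \oc desuspK x
  | Negz n.+1 => spow_cast (addNegz1 n) x \oc desuspK (spow (Negz n) x)
  end.

Definition desusp_spow j x : Hom (desusp (spow j x)) (spow (j - 1) x) :=
  match j return Hom (desusp (spow j x)) (spow (j - 1) x) with
  | Posz 0 => spow_cast sub0z1 x
  | Posz n.+1 => spow_cast (subPosz1 n) x \oc suspK (spow (Posz n) x)
  | Negz n => spow_cast (subNegz1 n) x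
  end.

Fixpoint spow_pos m j x :
    Hom (iter_functor susp m (spow j x)) (spow (m%:Z + j) x) :=
  match m return Hom (iter_functor susp m (spow j x)) (spow (m%:Z + j) x) with
  | 0 => spow_cast (esym (add0r j)) x
  | m'.+1 => spow_cast (spow_posS_subproof m' j) x \oc
             (susp_spow (m'%:Z + j) x \oc fmap susp (spow_pos m' j x))
  end.

Fixpoint spow_neg m j x :
    Hom (iter_functor desusp m (spow j x)) (spow (- m%:Z + j) x) :=
  match m return Hom (iter_functor desusp m (spow j x))
                     (spow (- m%:Z + j) x) with
  | 0 => spow_cast (spow_neg_subproof j) x
  | m'.+1 => spow_cast (spow_negS_subproof m' j) x \oc
             (desusp_spow (- m'%:Z + j) x \oc fmap desusp (spow_neg m' j x))
  end.

(* The canonical isomorphism from S^i S^j x to S^(i+j) x. *)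
Definition spowD i j x : Hom (spow i (spow j x)) (spow (i + j) x) :=
  match i return Hom (spow i (spow j x)) (spow (i + j) x) with
  | Posz m => spow_pos m j x
  | Negz m => spow_neg m.+1 j x
  end.

(* The product of g (degree j) and f (degree i) in the graded endomorphism
   algebra of s. *)
Definition graded_mul (s : T) i j (g : Hom s (spow j s)) (f : Hom s (spow i s)) :
    Hom s (spow (i + j) s) :=
  spowD i j s \oc (fmap (spow i) g \oc f).

End SuspensionPowers.

Notation dual_numbers k := {poly %/ ('X^2 : {poly k})}.

(* The component of degree i of k[X]/(X^2) when X has degree w. *)
Definition dual_numbers_deg (k : fieldType) (w i : int) : set (dual_numbers k) :=
  [set a : dual_numbers k |
    forall n : nat, (a : {poly k})`_n != 0 -> n%:Z * w = i].

(* An isomorphism of graded algebras, given degree by degree. *)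
Definition spherical (k : fieldType) (T : triangulated_category k) (w : int)
    (s : T) : Prop :=
  exists phi : forall i : int, {linear Hom s (spow T i s) -> dual_numbers k},
    [/\ forall i, injective (phi i),
        forall i, range (phi i) = @dual_numbers_deg k w i,
        phi 0 (idm s) = 1
      & forall (i j : int) (g : Hom s (spow T j s)) (f : Hom s (spow T i s)),
          phi (i + j) (graded_mul g f) = phi j g * phi i f].

Section ThickSubcategories.
Variables (k : fieldType) (T : triangulated_category k).

Definition iso_closed (P : set T) : Prop :=
  forall x y, isomorphic x y -> P x -> P y.

Definition sum_closed (P : set T) : Prop :=
  (forall x, is_zero x -> P x) /\
  (forall x y s, is_biproduct x y s -> P x -> P y -> P s).

Definition summand_closed (P : set T) : Prop :=
  forall x s, is_summand x s -> P s -> P x.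

Definition extension_closed (P : set T) : Prop :=
  forall (x y z : T) (f : Hom x y) (g : Hom y z) (h : Hom z (susp x)),
    dist f g h -> P x -> P z -> P y.

Definition triangulated_subcategory (P : set T) : Prop :=
  [/\ iso_closed P, sum_closed P, extension_closed P,
      forall x, P x -> P (susp x) & forall x, P x -> P (desusp x)].

Definition classically_generated (s : T) : Prop :=
  forall P : set T, triangulated_subcategory P -> summand_closed P ->
    P s -> P = setT.

Definition extension_closure (X : set T) : set T :=
  [set x | forall P : set T, X `<=` P -> iso_closed P -> extension_closed P ->
    P x].

Definition extension_summand_closure (X : set T) : set T :=
  [set x | forall P : set T, X `<=` P -> iso_closed P -> extension_closed P ->
    summand_closed P -> P x].

End ThickSubcategories.

(** * Frobenius categories and algebraic triangulated categories *)

(* A class of kernel-cokernel pairs x -i-> y -p-> z. *)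
Definition pair_class (k : fieldType) (C : klin_category k) :=
  forall x y z : C, Hom x y -> Hom y z -> Prop.

Section ExactCategories.
Variables (k : fieldType) (C : klin_category k) (confl : pair_class C).

Definition inflation (x y : C) (i : Hom x y) : Prop :=
  exists (z : C) (p : Hom y z), confl i p.

Definition deflation (y z : C) (p : Hom y z) : Prop :=
  exists (x : C) (i : Hom x y), confl i p.

Record exact_axioms : Prop := ExactAxioms {
  ex_additive : is_additive C;
  ex_kercoker : forall (x y z : C) (i : Hom x y) (p : Hom y z),
    confl i p -> is_kernel p i /\ is_cokernel i p;
  ex_iso : forall (x y z x' y' z' : C) (i : Hom x y) (p : Hom y z)
    (i' : Hom x' y') (p' : Hom y' z')
    (a : Hom x x') (b : Hom y y') (c : Hom z z'),
    is_iso a -> is_iso b -> is_iso c ->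
    b \oc i = i' \oc a -> c \oc p = p' \oc b -> confl i p -> confl i' p';
  ex_infl1 : forall x : C, inflation (idm x);
  ex_defl1 : forall x : C, deflation (idm x);
  ex_inflM : forall (x y z : C) (i : Hom x y) (j : Hom y z),
    inflation i -> inflation j -> inflation (j \oc i);
  ex_deflM : forall (x y z : C) (p : Hom x y) (q : Hom y z),
    deflation p -> deflation q -> deflation (q \oc p);
  ex_pushout : forall (x y z : C) (i : Hom x y) (a : Hom x z), inflation i ->
    exists (t : C) (b : Hom y t) (j : Hom z t),
      is_pushout i a b j /\ inflation j;
  ex_pullback : forall (y z t : C) (b : Hom y t) (q : Hom z t), deflation q ->
    exists (x : C) (p : Hom x y) (a : Hom x z),
      is_pullback p a b q /\ deflation p
}.

Definition is_injective (e : C) : Prop :=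
  forall (x y : C) (i : Hom x y), inflation i ->
    forall f : Hom x e, exists g : Hom y e, g \oc i = f.

Definition is_projective (e : C) : Prop :=
  forall (y z : C) (p : Hom y z), deflation p ->
    forall f : Hom e z, exists g : Hom e y, p \oc g = f.

Record frobenius_axioms : Prop := FrobeniusAxioms {
  fr_exact : exact_axioms;
  fr_enough_inj : forall x : C, exists (e : C) (i : Hom x e),
    is_injective e /\ inflation i;
  fr_enough_proj : forall x : C, exists (e : C) (p : Hom e x),
    is_projective e /\ deflation p;
  fr_proj_inj : forall e : C, is_projective e <-> is_injective e
}.

End ExactCategories.

Record frobenius_category (k : fieldType) := FrobeniusCategory {
  fr_cat :> klin_category k;
  conflation : pair_class fr_cat;
  fr_axioms : frobenius_axioms conflation
}.
Arguments conflation {k _ x y z} _ _.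

Section StableCategory.
Variables (k : fieldType) (E : frobenius_category k).
Implicit Types x y z : E.

Local Notation injective_obj := (is_injective (@conflation k E)).

Let Eexact : exact_axioms (@conflation k E) := fr_exact (fr_axioms E).

Definition factors_inj x y (f : Hom x y) : Prop :=
  exists (e : E) (a : Hom x e) (b : Hom e y), injective_obj e /\ f = b \oc a.

Definition stable_null x y : {pred Hom x y} := fun f => `[< factors_inj f >].

Lemma injective_biproduct (e e' s : E) : is_biproduct e e' s ->
  injective_obj e -> injective_obj e' -> injective_obj s.
Proof.
move=> [i1 [i2 [p1 [p2 [_ _ _ _ sE]]]]] ie ie' x y i infl f.
have [g1 g1E] := ie _ _ _ infl (p1 \oc f).
have [g2 g2E] := ie' _ _ _ infl (p2 \oc f).
exists (i1 \oc g1 + i2 \oc g2).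
by rewrite compmDl -!compmA g1E g2E !compmA -compmDl sE comp1m.
Qed.

Lemma factors_injD x y (f g : Hom x y) :
  factors_inj f -> factors_inj g -> factors_inj (f + g).
Proof.
move=> [e [a [b [ie ->]]]] [e' [a' [b' [ie' ->]]]].
have [_ /(_ e e')[s bs]] := ex_additive Eexact.
have [i1 [i2 [p1 [p2 [p1i1 p2i2 p1i2 p2i1 _]]]]] := bs.
exists s, (i1 \oc a + i2 \oc a'), (b \oc p1 + b' \oc p2).
split; first exact: injective_biproduct bs ie ie'.
rewrite compmDl !compmDr -!compmA !(compmA p1) !(compmA p2).
by rewrite p1i1 p2i2 p1i2 p2i1 !comp1m !comp0m !compm0 addr0 add0r.
Qed.

Lemma factors_injZ x y c (f : Hom x y) : factors_inj f -> factors_inj (c *: f).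
Proof.
by move=> [e [a [b [ie ->]]]]; exists e, a, (c *: b); rewrite compmZl.
Qed.

Lemma factors_inj0 x y : factors_inj (0 : Hom x y).
Proof.
have [e [i [ie _]]] := fr_enough_inj (fr_axioms E) x.
by exists e, i, 0; rewrite comp0m.
Qed.

Lemma factors_inj_compl x y z (g : Hom y z) (f : Hom x y) :
  factors_inj f -> factors_inj (g \oc f).
Proof. by move=> [e [a [b [ie ->]]]]; exists e, a, (g \oc b); rewrite compmA. Qed.

Lemma factors_inj_compr x y z (g : Hom y z) (f : Hom x y) :
  factors_inj g -> factors_inj (g \oc f).
Proof.
by move=> [e [a [b [ie ->]]]]; exists e, (a \oc f), b; rewrite -compmA.
Qed.

Fact stable_null_zmod_closed x y : zmod_closed (@stable_null x y).
Proof.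
split=> [|f g]; first by apply/asboolP; exact: factors_inj0.
move=> /asboolP fP /asboolP gP; apply/asboolP; apply: factors_injD => //.
by rewrite -scaleN1r; exact: factors_injZ.
Qed.

HB.instance Definition _ x y := GRing.isZmodClosed.Build (Hom x y)
  (@stable_null x y) (@stable_null_zmod_closed x y).

Definition stable_hom x y : Type :=
  {ideal_quot (@stable_null x y : zmodClosed (Hom x y))}.

HB.instance Definition _ x y := GRing.Zmodule.on (stable_hom x y).

Definition stable_class x y (f : Hom x y) : stable_hom x y :=
  \pi_({ideal_quot (@stable_null x y : zmodClosed (Hom x y))}) f.

Definition stable_repr x y (u : stable_hom x y) : Hom x y :=
  repr (u : {ideal_quot (@stable_null x y : zmodClosed (Hom x y))}).

Lemma stable_reprK x y : cancel (@stable_repr x y) (@stable_class x y).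
Proof. exact: reprK. Qed.

Lemma stable_classP x y (f g : Hom x y) :
  stable_class f = stable_class g <-> factors_inj (f - g).
Proof.
split=> [fg|fg].
  apply/asboolP; have := Quotient.idealrBE (@stable_null x y) f g.
  by rewrite -[_ \in _]/(`[< factors_inj (f - g) >]) => ->; apply/eqP.
by apply/eqP; rewrite -Quotient.idealrBE; apply/asboolP.
Qed.

Lemma stable_classD x y (f g : Hom x y) :
  stable_class (f + g) = stable_class f + stable_class g.
Proof. exact: Quotient.pi_add. Qed.

Definition stable_scale x y (a : k) (u : stable_hom x y) : stable_hom x y :=
  stable_class (a *: stable_repr u).

Lemma stable_scaleE x y (a : k) (f : Hom x y) :
  stable_scale a (stable_class f) = stable_class (a *: f).
Proof.
apply/stable_classP; rewrite -scalerBr; apply: factors_injZ.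
by apply/stable_classP; rewrite stable_reprK.
Qed.

Lemma stable_ind x y (P : stable_hom x y -> Prop) :
  (forall f, P (stable_class f)) -> forall u, P u.
Proof. by move=> Pf u; rewrite -[u]stable_reprK. Qed.

Fact stable_scaleA x y (a b : k) (u : stable_hom x y) :
  stable_scale a (stable_scale b u) = stable_scale (a * b) u.
Proof.
by elim/stable_ind: u => f; rewrite !stable_scaleE scalerA.
Qed.

Fact stable_scale1 x y : left_id 1 (@stable_scale x y).
Proof.
by elim/stable_ind => f; rewrite stable_scaleE scale1r.
Qed.

Fact stable_scaleDr x y : right_distributive (@stable_scale x y) +%R.
Proof.
move=> a; elim/stable_ind => f; elim/stable_ind => g.
by rewrite !stable_scaleE -!stable_classD stable_scaleE scalerDr.
Qed.

Fact stable_scaleDl x y (u : stable_hom x y) :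
  {morph (@stable_scale x y)^~ u : a b / a + b}.
Proof.
move=> a b; elim/stable_ind: u => f.
by rewrite !stable_scaleE -stable_classD scalerDl.
Qed.

HB.instance Definition _ x y := GRing.Zmodule_isLmodule.Build k
  (stable_hom x y) (@stable_scaleA x y) (@stable_scale1 x y)
  (@stable_scaleDr x y) (@stable_scaleDl x y).

Lemma stable_classZ x y (a : k) (f : Hom x y) :
  stable_class (a *: f) = a *: stable_class f.
Proof. by rewrite -stable_scaleE. Qed.

Definition stable_comp x y z (v : stable_hom y z) (u : stable_hom x y) :
  stable_hom x z := stable_class (stable_repr v \oc stable_repr u).

Lemma stable_compE x y z (g : Hom y z) (f : Hom x y) :
  stable_comp (stable_class g) (stable_class f) = stable_class (g \oc f).
Proof.
apply/stable_classP; set g' := stable_repr _; set f' := stable_repr _.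
have -> : g' \oc f' - g \oc f = g' \oc (f' - f) + (g' - g) \oc f.
  by rewrite compmBr compmBl addrA subrK.
by apply: factors_injD; [apply: factors_inj_compl|apply: factors_inj_compr];
  apply/stable_classP; rewrite stable_reprK.
Qed.

Fact stable_comp1m x y (u : stable_hom x y) :
  stable_comp (stable_class (idm y)) u = u.
Proof. by elim/stable_ind: u => f; rewrite stable_compE comp1m. Qed.

Fact stable_compm1 x y (u : stable_hom x y) :
  stable_comp u (stable_class (idm x)) = u.
Proof. by elim/stable_ind: u => f; rewrite stable_compE compm1. Qed.

Fact stable_compmA x y z t (w : stable_hom z t) (v : stable_hom y z)
    (u : stable_hom x y) :
  stable_comp w (stable_comp v u) = stable_comp (stable_comp w v) u.
Proof.
elim/stable_ind: u => f; elim/stable_ind: v => g; elim/stable_ind: w => h.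
by rewrite !stable_compE compmA.
Qed.

Fact stable_comp_linearl x y z (u : stable_hom x y) (a : k)
    (v v' : stable_hom y z) :
  stable_comp (a *: v + v') u = a *: stable_comp v u + stable_comp v' u.
Proof.
elim/stable_ind: u => f; elim/stable_ind: v => g; elim/stable_ind: v' => g'.
by rewrite -stable_classZ -stable_classD !stable_compE comp_linearl
  stable_classD stable_classZ.
Qed.

Fact stable_comp_linearr x y z (v : stable_hom y z) (a : k)
    (u u' : stable_hom x y) :
  stable_comp v (a *: u + u') = a *: stable_comp v u + stable_comp v u'.
Proof.
elim/stable_ind: u => f; elim/stable_ind: v => g; elim/stable_ind: u' => f'.
by rewrite -stable_classZ -stable_classD !stable_compE comp_linearr
  stable_classD stable_classZ.
Qed.

Definition stable_klin : klin_category k :=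
  @KlinCategory k E (fun x y => stable_hom x y : lmodType k)
    (fun x => stable_class (idm x)) stable_comp stable_comp1m stable_compm1
    stable_compmA stable_comp_linearl stable_comp_linearr.

(* A conflation x -> I(x) -> S(x) with I(x) injective, chosen for each x. *)
Record injective_hull_data x := InjectiveHullData {
  hull : E;
  cosyzygy : E;
  hull_in : Hom x hull;
  hull_out : Hom hull cosyzygy;
  hull_injective : injective_obj hull;
  hull_conflation : conflation hull_in hull_out
}.

Fact injective_hull_subproof x : inhabited (injective_hull_data x).
Proof.
have [e [i [ie [y [p ip]]]]] := fr_enough_inj (fr_axioms E) x.
by split; exact: (InjectiveHullData ie ip).
Qed.

Definition injective_hull x : injective_hull_data x :=
  inhabited_witness (injective_hull_subproof x).

Local Notation I_ x := (hull (injective_hull x)).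
Local Notation S_ x := (cosyzygy (injective_hull x)).
Local Notation i_ x := (hull_in (injective_hull x)).
Local Notation p_ x := (hull_out (injective_hull x)).

(* h is obtained from f by a morphism of conflations
     x -> I(x) -> S(x)
     |f    |g      |h
     v     v       v
     y -> I(y) -> S(y) *)
Definition cosyzygy_lift x y (f : Hom x y) (h : Hom (S_ x) (S_ y)) : Prop :=
  exists g : Hom (I_ x) (I_ y), g \oc i_ x = i_ y \oc f /\ h \oc p_ x = p_ y \oc g.

Lemma hull_kercoker x : is_kernel (p_ x) (i_ x) /\ is_cokernel (i_ x) (p_ x).
Proof. exact: (ex_kercoker Eexact (hull_conflation (injective_hull x))). Qed.

Lemma hull_outi x : p_ x \oc i_ x = 0.
Proof. by have [[]] := hull_kercoker x. Qed.

Lemma hull_out_epi x : is_epi (p_ x).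
Proof.
move=> t g h gh; have [_ [_ /(_ t (h \oc p_ x))]] := hull_kercoker x.
rewrite -compmA hull_outi compm0 => /(_ erefl)[u [_ uniq]].
by rewrite -(uniq g gh) -(uniq h erefl).
Qed.

Lemma hull_in_inflation x : inflation (@conflation k E) (i_ x).
Proof. by exists (S_ x), (p_ x); exact: hull_conflation. Qed.

Lemma cosyzygy_lift_exists x y (f : Hom x y) :
  exists h : Hom (S_ x) (S_ y), cosyzygy_lift f h.
Proof.
have [g gE] := @hull_injective y (injective_hull y) _ _ _
  (hull_in_inflation x) (i_ y \oc f).
have [_ [_ /(_ _ (p_ y \oc g))]] := hull_kercoker x.
rewrite -compmA gE compmA hull_outi comp0m => /(_ erefl)[h [hE _]].
by exists h, g.
Qed.

Lemma cosyzygy_liftB x y (f f' : Hom x y) h h' :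
  cosyzygy_lift f h -> cosyzygy_lift f' h' ->
  cosyzygy_lift (f - f') (h - h').
Proof.
move=> [g [gE hE]] [g' [g'E h'E]]; exists (g - g').
by rewrite !compmBl !compmBr gE g'E hE h'E.
Qed.

Lemma cosyzygy_lift_null x y (f : Hom x y) h :
  cosyzygy_lift f h -> factors_inj f -> factors_inj h.
Proof.
move=> [g [gE hE]] [e [a [b [ie fE]]]].
have [a' a'E] := ie _ _ _ (hull_in_inflation x) a.
have [_ [_ /(_ _ (g - i_ y \oc (b \oc a')))]] := hull_kercoker x.
rewrite compmBl gE -!compmA a'E -fE subrr => /(_ erefl)[c [cE _]].
exists (I_ y), c, (p_ y); split; first exact: hull_injective.
apply: hull_out_epi; rewrite hE -compmA cE compmBr.
by rewrite (compmA (p_ y)) hull_outi comp0m subr0.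
Qed.

Lemma cosyzygy_lift_uniq x y (f f' : Hom x y) h h' :
  cosyzygy_lift f h -> cosyzygy_lift f' h' ->
  stable_class f = stable_class f' -> stable_class h = stable_class h'.
Proof.
move=> fh fh' /stable_classP ff'; apply/stable_classP.
exact: cosyzygy_lift_null (cosyzygy_liftB fh fh') ff'.
Qed.

Definition cosyzygy_map x y (f : Hom x y) : Hom (S_ x) (S_ y) :=
  sval (cid (cosyzygy_lift_exists f)).

Lemma cosyzygy_mapP x y (f : Hom x y) : cosyzygy_lift f (cosyzygy_map f).
Proof. exact: (svalP (cid (cosyzygy_lift_exists f))). Qed.

Definition stable_susp_map (x y : stable_klin) (u : Hom x y) :
    @Hom k stable_klin (S_ x) (S_ y) :=
  stable_class (cosyzygy_map (stable_repr u)).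

Lemma stable_susp_mapE x y (f : Hom x y) h : cosyzygy_lift f h ->
  @stable_susp_map x y (stable_class f) = stable_class h.
Proof.
move=> fh; apply: cosyzygy_lift_uniq (cosyzygy_mapP _) fh _.
exact: stable_reprK.
Qed.

Fact stable_susp_map1 (x : stable_klin) :
  stable_susp_map (idm x) = @idm k stable_klin (S_ x).
Proof.
by apply: stable_susp_mapE; exists (idm _); rewrite !comp1m !compm1.
Qed.

Fact stable_susp_mapM (x y z : stable_klin) (v : Hom y z) (u : Hom x y) :
  stable_susp_map (v \oc u) = stable_susp_map v \oc stable_susp_map u.
Proof.
elim/stable_ind: u => f; elim/stable_ind: v => g.
have [g1 [g1E h1E]] := cosyzygy_mapP f.
have [g2 [g2E h2E]] := cosyzygy_mapP g.
have -> : (stable_class g : @Hom k stable_klin y z) \oc stable_class f =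
  stable_class (g \oc f) by exact: stable_compE.
rewrite (stable_susp_mapE (cosyzygy_mapP f)).
rewrite (stable_susp_mapE (cosyzygy_mapP g)).
rewrite [RHS]stable_compE.
apply: stable_susp_mapE; exists (g2 \oc g1).
split; first by rewrite -compmA g1E compmA g2E -compmA.
by rewrite -compmA h1E compmA h2E -compmA.
Qed.

Fact stable_susp_map_linear (x y : stable_klin) (a : k) (u v : Hom x y) :
  stable_susp_map (a *: u + v) = a *: stable_susp_map u + stable_susp_map v.
Proof.
elim/stable_ind: u => f; elim/stable_ind: v => f'.
have classE (x' y' : E) (g g' : @Hom k E x' y') :
    (a *: (stable_class g : @Hom k stable_klin x' y') + stable_class g') =
    stable_class (a *: g + g').
  by rewrite stable_classD stable_classZ.
have [g1 [g1E h1E]] := cosyzygy_mapP f.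
have [g2 [g2E h2E]] := cosyzygy_mapP f'.
rewrite classE (stable_susp_mapE (cosyzygy_mapP f)).
rewrite (stable_susp_mapE (cosyzygy_mapP f')) classE.
apply: stable_susp_mapE; exists (a *: g1 + g2).
by rewrite !comp_linearl !comp_linearr g1E g2E h1E h2E.
Qed.

Definition stable_susp : klin_functor stable_klin stable_klin :=
  @KlinFunctor k stable_klin stable_klin (fun x => S_ x) stable_susp_map
    stable_susp_map1 stable_susp_mapM stable_susp_map_linear.

(* A standard triangle x -f-> y -g-> c -h-> S(x): c is the pushout of f along
   x -> I(x), and h vanishes on y and restricts to I(x) -> S(x). *)
Definition standard_triangle x y c
    (f : Hom x y) (g : Hom y c) (h : Hom c (S_ x)) : Prop :=
  exists e : Hom (I_ x) c,
    [/\ is_pushout f (i_ x) g e, h \oc g = 0 & h \oc e = p_ x].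

Definition stable_dist (x y z : stable_klin)
    (u : Hom x y) (v : Hom y z) (w : Hom z (stable_susp x)) : Prop :=
  exists (x' y' z' : E) (f : @Hom k E x' y') (g : @Hom k E y' z')
    (h : @Hom k E z' (S_ x'))
    (a : @Hom k stable_klin x' x) (b : @Hom k stable_klin y' y)
    (c : @Hom k stable_klin z' z),
    [/\ standard_triangle f g h, [/\ is_iso a, is_iso b & is_iso c],
        b \oc (stable_class f : @Hom k stable_klin x' y') = u \oc a,
        c \oc (stable_class g : @Hom k stable_klin y' z') = v \oc b
      & fmap stable_susp a \oc
          (stable_class h : @Hom k stable_klin z' (stable_susp x')) = w \oc c].

Definition stable_category : triangle_category k :=
  @TriangleCategory k stable_klin stable_susp stable_dist.

End StableCategory.

Definition algebraic (k : fieldType) (T : triangulated_category k) : Prop :=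
  exists E : frobenius_category k, triangle_equivalent (stable_category E) T.

(** * The Grothendieck group *)

Section GrothendieckGroup.
Variables (k : fieldType) (T : triangulated_category k).

Local Notation free_group := {freeg {classic T} / int}.

Definition generator (x : T) : free_group := << (x : {classic T}) >>.

Definition subgroup (H : set free_group) : Prop :=
  H 0 /\ forall u v, H u -> H v -> H (u - v).

Definition triangle_relations : {pred free_group} := fun u =>
  `[< forall H : set free_group, subgroup H ->
      (forall (x y z : T) (f : Hom x y) (g : Hom y z) (h : Hom z (susp x)),
        dist f g h -> H (generator y - generator x - generator z)) ->
      H u >].

Fact triangle_relations_zmod_closed : zmod_closed triangle_relations.
Proof.
split=> [|u v /asboolP uR /asboolP vR]; apply/asboolP => H sH HH.
  by case: sH.
by case: (sH) => _; apply; [exact: uR|exact: vR].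
Qed.

HB.instance Definition _ := GRing.isZmodClosed.Build free_group
  triangle_relations triangle_relations_zmod_closed.

Definition K0 : Type :=
  {ideal_quot (triangle_relations : zmodClosed free_group)}.

HB.instance Definition _ := GRing.Zmodule.on K0.

Definition K0_class (x : T) : K0 :=
  \pi_({ideal_quot (triangle_relations : zmodClosed free_group)}) (generator x).

End GrothendieckGroup.

(** * Stability and co-stability conditions *)

(* On the complex numbers, the topology given by the modulus. *)
HB.instance Definition _ (R : realType) := PseudoPointedMetric.copy R[i] R[i]^o.

Section Stability.
Variables (R : realType) (k : fieldType) (T : triangulated_category k).
Implicit Types (P Q : R -> set T) (Z : {additive K0 T -> R[i]}).

Definition exp_ipi (r : R) : R[i] := Complex (cos (pi * r)) (sin (pi * r)).

(* A filtration 0 = c_0 -> c_1 -> ... -> c_n = t with factors q_i in Q(ph_i);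
   only the terms of c, a, q, ph of index at most n are meaningful. *)
Definition filtered (r : rel R) Q (t : T) : Prop :=
  exists (n : nat) (c : nat -> T) (a : forall i, Hom (c i) (c i.+1))
    (q : nat -> T) (ph : nat -> R),
    [/\ (0 < n)%N, is_zero (c 0), isomorphic (c n) t,
        forall i, (i < n)%N -> Q (ph i) (q i) /\
          exists (b : Hom (c i.+1) (q i)) (d : Hom (q i) (susp (c i))),
            dist (a i) b d
      & forall i j, (i < j < n)%N -> r (ph i) (ph j)].

Definition susp_compatible Q : Prop :=
  forall (r : R) (x : T),
    Q (r + 1) x <-> exists y, Q r y /\ isomorphic (susp y) x.

Definition slicing P : Prop :=
  [/\ forall r, iso_closed (P r) /\ sum_closed (P r),
      susp_compatible P,
      forall (r1 r2 : R) (x y : T), r1 > r2 -> P r1 x -> P r2 y ->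
        forall f : Hom x y, f = 0
    & forall t, ~ is_zero t -> filtered (fun a b => a > b) P t].

Definition coslicing Q : Prop :=
  [/\ forall r, [/\ iso_closed (Q r), sum_closed (Q r) & summand_closed (Q r)],
      susp_compatible Q,
      forall (r1 r2 : R) (x y : T), r1 < r2 -> Q r1 x -> Q r2 y ->
        forall f : Hom x y, f = 0
    & forall t, ~ is_zero t -> filtered (fun a b => a < b) Q t].

Definition condition_S Q : Prop :=
  forall (r : R) (q1 q2 : T), Q r q1 -> Q r q2 ->
    indecomposable q1 -> indecomposable q2 -> ~ isomorphic q1 q2 ->
    forall f : Hom q1 q2, f = 0.

Definition charge_compatible Z Q : Prop :=
  forall (r : R) (x : T), Q r x -> ~ is_zero x ->
    exists m : R, 0 < m /\ Z (K0_class x) = m%:C%C * exp_ipi r.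

Record stability_condition := StabilityCondition {
  stab_charge : {additive K0 T -> R[i]};
  stab_slices : R -> set T;
  stab_slicing : slicing stab_slices;
  stab_compatible : charge_compatible stab_charge stab_slices
}.

Definition locally_finite (s : stability_condition) : Prop :=
  exists2 eta : R, 0 < eta & forall t : R,
    let A := full_sub (extension_closure
      (\bigcup_(r in `]t - eta, t + eta[) stab_slices s r)) in
    quasi_abelian A /\ finite_length A.

Definition stability_manifold : set stability_condition :=
  [set s | locally_finite s].

Definition coslice_interval Q (I : set R) : set T :=
  extension_summand_closure (\bigcup_(r in I) Q r).

Definition coslicing_dist Q Q' : \bar R :=
  ereal_inf (EFin @` [set e : R | 0 < e /\
    forall r, Q r `<=` coslice_interval Q' `[r - e, r + e]]).

Record Coslice := MkCoslice {
  coslice_parts :> R -> set T;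
  coslice_coslicing : coslicing coslice_parts;
  coslice_S : condition_S coslice_parts
}.

HB.instance Definition _ := gen_eqMixin Coslice.
HB.instance Definition _ := gen_choiceMixin Coslice.

Definition coslice_open : set_system Coslice :=
  [set U | forall Q : Coslice, U Q ->
    exists2 e : R, 0 < e &
      forall Q' : Coslice, (coslicing_dist Q Q' < e%:E)%E -> U Q'].

Fact coslice_openT : coslice_open setT.
Proof. by move=> Q _; exists 1. Qed.

Fact coslice_openI : setI_closed coslice_open.
Proof.
move=> U V oU oV Q [/oU[e e0 eU] /oV[e' e'0 e'V]].
exists (Num.min e e'); first by rewrite lt_min e0.
move=> Q'; rewrite EFin_min lt_min => /andP[dU dV].
by split; [exact: eU|exact: e'V].
Qed.

Fact coslice_open_bigU (I : Type) (f : I -> set Coslice) :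
  (forall i, coslice_open (f i)) -> coslice_open (\bigcup_i f i).
Proof.
move=> of_ Q [i _ fiQ]; have [e e0 eU] := of_ i Q fiQ.
by exists e => // Q' dQ; exists i => //; exact: eU.
Qed.

HB.instance Definition _ := isOpenTopological.Build Coslice
  coslice_openT coslice_openI coslice_open_bigU.

Record Costab := MkCostab {
  costab_charge : {additive K0 T -> R[i]};
  costab_coslice : Coslice;
  costab_compatible : charge_compatible costab_charge costab_coslice
}.

HB.instance Definition _ := gen_eqMixin Costab.
HB.instance Definition _ := gen_choiceMixin Costab.

(* When K_0(T) is finitely generated, the usual topology of the finite
   dimensional complex vector space Hom(K_0(T), C) is the topology of pointwise
   convergence: evaluation at a finite generating family identifies this space
   with a linear subspace of some C^n. *)
Definition costab_incl (s : Costab) : {ptws K0 T -> R[i]} * Coslice :=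
  (costab_charge s : {ptws K0 T -> R[i]}, costab_coslice s).

HB.instance Definition _ :=
  Topological.copy Costab (initial_topology costab_incl).

End Stability.

Arguments stability_manifold R {k} T.
Arguments Costab R {k} T.
Arguments Coslice R {k} T.

Definition homeomorphic (X Y : topologicalType) : Prop :=
  exists (f : X -> Y) (g : Y -> X),
    [/\ cancel f g, cancel g f, continuous f & continuous g].

(* Main.v *)
(** The category U is the thick closure of s, whose shifts S i satisfy
Hom (S i, S j) = 0 unless j = i or j = i + w; as w <= 0, Hom (S i, S j) = 0 for
j > i.  The shifts of s therefore generate a bounded weight structure on U: every
object is a finite extension of copies of the S i, in increasing order of i.

A slicing would truncate the long strings S (-n(1-w)), ..., S (w-1), S 0, each
term being attached to the previous one by the socle map X, after finitely many
steps.  The truncation has bounded weights but maps compatibly to all longer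
strings, and comparing it with a string that is longer than its weights forces
the top map to S 0 to vanish.

In a co-slicing all semistable objects q satisfy Hom (q, q[i]) = 0 for i > 0.
An object with distinct lowest and highest weights a < b has a nonzero map to
q[b-a], from its top to its bottom, so q lives in one weight.  Hence s is
semistable, the co-slicing is determined by the phase of s, and the charge by
its value at s.  That value is arbitrary: the Euler characteristic of Hom into a
long string, taken in a window of degrees, is an additive function on objects
with value +-1 at s.  The homeomorphism sends (Z, Q) to ln |Z(s)| + i phase(s). *)
From HB Require Import structures.
From Pilot Require Import Defs.
From mathcomp Require Import qpoly polydiv ring_quotient freeg.
From mathcomp Require Import all_boot all_order all_algebra.
From mathcomp Require Import all_classical all_reals all_analysis.
From mathcomp Require Import complex.
From mathcomp Require Import zify lra ring.
Import Pilot.Defs.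

Set Implicit Arguments.
Unset Strict Implicit.
Unset Printing Implicit Defensive.

Import Order.TTheory GRing.Theory Num.Theory.
Import numFieldNormedType.Exports.

Local Open Scope classical_set_scope.
Local Open Scope quotient_scope.
Local Open Scope ring_scope.
Local Open Scope cat_scope.

(** * Triangles *)

Section LinearCategories.
Variables (k : fieldType) (C : klin_category k).
Implicit Types x y z : C.

(** Two choices shape the proof. For w = 0 the class X is an endomorphism of [S i], for w < 0 it
    changes the shift. Both cases are treated at once by speaking of non-isomorphisms between
    shifts, any two of which compose to zero. Layers of an object are cut off by minimal
    approximations, because minimality is what makes the comparison maps between successive layers
    non-isomorphisms. Vanishing then often follows by writing a map through a non-isomorphism twice,
    as in Nakayama's lemma.

    The Euler characteristic of Hom into s itself does not normalise a charge: its value at s is 1 +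
    (-1)^w, hence 0 or 2. The simple module of k[X]/(X^2) would contribute a single class, but the
    strings reach it only in the limit. Truncation adds classes in low degrees, and longer strings
    push these below any given window. *)

Lemma compNm x y z (g : Hom y z) (f : Hom x y) : (- g) \oc f = - (g \oc f).
Proof. by rewrite -sub0r compmBl comp0m sub0r. Qed.

Lemma compmN x y z (g : Hom y z) (f : Hom x y) : g \oc (- f) = - (g \oc f).
Proof. by rewrite -sub0r compmBr compm0 sub0r. Qed.

Lemma comp_suml x y z I (r : seq I) (g : I -> Hom y z) (f : Hom x y) :
  (\sum_(i <- r) g i) \oc f = \sum_(i <- r) (g i \oc f).
Proof.
elim: r => [|i r IH]; first by rewrite !big_nil comp0m.
by rewrite !big_cons compmDl IH.
Qed.

Lemma comp_sumr x y z I (r : seq I) (g : Hom y z) (f : I -> Hom x y) :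
  g \oc (\sum_(i <- r) f i) = \sum_(i <- r) (g \oc f i).
Proof.
elim: r => [|i r IH]; first by rewrite !big_nil compm0.
by rewrite !big_cons compmDr IH.
Qed.

Lemma zero_idm x : is_zero x <-> idm x = 0.
Proof.
split=> [/(_ x)[h _]|e y]; first exact: h.
split=> f; first by rewrite -[f]compm1 e compm0.
by rewrite -[f]comp1m e comp0m.
Qed.

Lemma iso_idm x : is_iso (idm x).
Proof. by exists (idm x); rewrite comp1m. Qed.

Lemma iso_comp x y z (g : Hom y z) (f : Hom x y) :
  is_iso g -> is_iso f -> is_iso (g \oc f).
Proof.
move=> [g' [g'g gg']] [f' [f'f ff']]; exists (f' \oc g').
split; first by rewrite compmA -(compmA f') g'g compm1.
by rewrite compmA -(compmA g) ff' compm1.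
Qed.

Lemma isomorphic_refl x : isomorphic x x.
Proof. by exists (idm x); exact: iso_idm. Qed.

Lemma isomorphic_sym x y : isomorphic x y -> isomorphic y x.
Proof. by move=> [f [g [gf fg]]]; exists g, f. Qed.

Lemma isomorphic_trans x y z : isomorphic x y -> isomorphic y z -> isomorphic x z.
Proof. by move=> [f fi] [g gi]; exists (g \oc f); exact: iso_comp. Qed.

Lemma zero_iso x y : isomorphic x y -> is_zero x -> is_zero y.
Proof.
move=> [f [g [gf fg]]] /zero_idm e; apply/zero_idm.
by rewrite -fg -[f]compm1 e compm0 comp0m.
Qed.

Lemma zero_isomorphic x y : is_zero x -> is_zero y -> isomorphic x y.
Proof.
move=> /zero_idm ex /zero_idm ey; exists 0, 0.
by rewrite compm0 ex ey compm0.
Qed.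

Lemma summand_retract x s : is_summand x s ->
  exists (i : Hom x s) (p : Hom s x), p \oc i = idm x.
Proof. by move=> [y [i1 [_ [p1 [_ [h _ _ _ _]]]]]]; exists i1, p1. Qed.

Lemma retract_summand : idempotent_complete C ->
  forall x s (i : Hom x s) (p : Hom s x), p \oc i = idm x ->
  exists y, is_biproduct x y s.
Proof.
move=> IC x s i p pi.
pose e := idm s - i \oc p.
have ipip : (i \oc p) \oc (i \oc p) = i \oc p.
  by rewrite compmA -(compmA i) pi compm1.
have ee : e \oc e = e.
  by rewrite /e compmBl comp1m compmBr compm1 ipip subrr subr0.
have [y [r [j [rj jr]]]] := IC _ _ ee.
have pe : p \oc e = 0 by rewrite /e compmBr compm1 compmA pi comp1m subrr.
have ei : e \oc i = 0 by rewrite /e compmBl comp1m -compmA pi compm1 subrr.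
exists y, i, j, p, r; split=> //.
- have -> : j = e \oc j by rewrite -jr -compmA rj compm1.
  by rewrite compmA pe comp0m.
- have -> : r = r \oc e by rewrite -jr compmA rj comp1m.
  by rewrite -compmA ei compm0.
- by rewrite jr /e addrC subrK.
Qed.

End LinearCategories.

Section LinearFunctors.
Variables (k : fieldType) (C D : klin_category k) (F : klin_functor C D).

Lemma fmapD (x y : C) (f g : Hom x y) : fmap F (f + g) = fmap F f + fmap F g.
Proof. by rewrite -[f in LHS]scale1r fmap_linear scale1r. Qed.

Lemma fmap0 (x y : C) : fmap F (0 : Hom x y) = 0.
Proof. by apply: (addrI (fmap F (0 : Hom x y))); rewrite -fmapD !addr0. Qed.

Lemma fmapZ (x y : C) a (f : Hom x y) : fmap F (a *: f) = a *: fmap F f.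
Proof. by rewrite -[_ *: f]addr0 fmap_linear fmap0 addr0. Qed.

Lemma fmap_zero (x : C) : is_zero x -> is_zero (F x).
Proof. by move=> /zero_idm e; apply/zero_idm; rewrite -fmap1 e fmap0. Qed.

End LinearFunctors.

Section Triangulated.
Variables (k : fieldType) (T : triangulated_category k).
Implicit Types x y z t : T.

Let ax := tr_axioms T.

Lemma zero_exists : exists z : T, is_zero z.
Proof. by case: (tr_additive ax). Qed.

Lemma biproduct_exists x y : exists s : T, is_biproduct x y s.
Proof. by case: (tr_additive ax) => _; exact. Qed.

Lemma desuspK_is_iso x : is_iso (desuspK x).
Proof. by case: (desuspK_iso T) => _; exact. Qed.

Lemma suspK_is_iso x : is_iso (suspK x).
Proof. by case: (suspK_iso T) => _; exact. Qed.

Lemma desuspK_isomorphic x : isomorphic (susp (desusp x)) x.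
Proof. by exists (desuspK x); exact: desuspK_is_iso. Qed.

Lemma susp_inj x y (f g : Hom x y) : fmap susp f = fmap susp g -> f = g.
Proof.
move=> fg; have [nat _] := suspK_iso T.
have [s [_ sK]] := suspK_is_iso x.
rewrite -[f]compm1 -[g]compm1 -sK !compmA.
by rewrite -[f \oc _](nat _ _ f) -[g \oc _](nat _ _ g) /= fg.
Qed.

Lemma desusp_inj x y (f g : Hom x y) :
  fmap desusp f = fmap desusp g -> f = g.
Proof.
move=> fg; have [nat _] := desuspK_iso T.
have [s [_ sK]] := desuspK_is_iso x.
rewrite -[f]compm1 -[g]compm1 -sK !compmA.
by rewrite -[f \oc _](nat _ _ f) -[g \oc _](nat _ _ g) /= fg.
Qed.

(** The preimage is [desusp] of [u], transported along [suspK]. Since [desusp] is faithful, it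
    suffices to compare the images under [desusp], where naturality of [suspK] applies. *)
Lemma susp_surj x y (u : Hom (susp x) (susp y)) : exists f : Hom x y, fmap susp f = u.
Proof.
have [nat _] := suspK_iso T.
have [sx [sKx Ksx]] := suspK_is_iso x; have [sy [sKy Ksy]] := suspK_is_iso y.
pose f := (suspK y \oc fmap desusp u) \oc sx.
exists f; apply: desusp_inj.
have e : suspK y \oc fmap desusp (fmap susp f) = f \oc suspK x := nat _ _ f.
rewrite -[LHS]comp1m -sKy -compmA e /f -(compmA _ sx) sKx compm1.
by rewrite compmA sKy comp1m.
Qed.

Lemma susp_iso_reflect x y (f : Hom x y) : is_iso (fmap susp f) -> is_iso f.
Proof.
move=> [u [uf fu]]; have [g ge] := susp_surj u; exists g.
by split; apply: susp_inj; rewrite fmap_comp fmap1 ge.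
Qed.

Lemma dist_comp0 x y z (f : Hom x y) (g : Hom y z) (h : Hom z (susp x)) :
  dist f g h -> g \oc f = 0.
Proof.
move=> d; have [z0 z0P] := zero_exists.
have e : f \oc idm x = f \oc idm x by [].
have [c [<- _]] := tr3 ax (tr1_id ax x z0P) d e.
by rewrite compm0.
Qed.

Lemma dist_rot x y z (f : Hom x y) (g : Hom y z) (h : Hom z (susp x)) :
  dist f g h -> dist g h (- fmap susp f).
Proof. by move/(tr2 ax). Qed.

(** Axiom [tr3] completes morphisms on the third vertex only, so both triangles are rotated first
    and the completion, a map between suspensions, is desuspended. *)
Lemma dist_lift x y z (f : Hom x y) (g : Hom y z) (h : Hom z (susp x))
    t (u : Hom t y) :
  dist f g h -> g \oc u = 0 -> exists v : Hom t x, u = f \oc v.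
Proof.
move=> d gu; have [z0 z0P] := zero_exists.
have d1 := dist_rot (tr1_id ax t z0P).
have d2 := dist_rot d.
have e : (0 : Hom z0 z) \oc (0 : Hom t z0) = g \oc u by rewrite gu compm0.
have [c [_]] := tr3 ax d1 d2 e.
have [v <-] := susp_surj c.
rewrite compmN compNm fmap1 compm1 => /oppr_inj; rewrite -fmap_comp => /susp_inj ->.
by exists v.
Qed.

Lemma dist_extend x y z (f : Hom x y) (g : Hom y z) (h : Hom z (susp x))
    t (u : Hom y t) :
  dist f g h -> u \oc f = 0 -> exists v : Hom z t, u = v \oc g.
Proof.
move=> d uf; have [z0 z0P] := zero_exists.
have sz0P : is_zero (susp z0) by exact: fmap_zero.
have d1 : dist (0 : Hom z0 t) (idm t) (0 : Hom t (susp z0)).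
  apply/(tr2 ax); rewrite fmap0 oppr0.
  exact: tr1_id.
have e : u \oc f = (0 : Hom z0 t) \oc (0 : Hom x z0) by rewrite uf compm0.
have [v []] := tr3 ax d d1 e.
by rewrite comp1m => <- _; exists v.
Qed.

Lemma dist_comp0' x y z (f : Hom x y) (g : Hom y z) (h : Hom z (susp x)) :
  dist f g h -> h \oc g = 0.
Proof. by move/dist_rot/dist_comp0. Qed.

Lemma dist_comp0'' x y z (f : Hom x y) (g : Hom y z) (h : Hom z (susp x)) :
  dist f g h -> fmap susp f \oc h = 0.
Proof. by move/dist_rot/dist_rot/dist_comp0/eqP; rewrite compNm oppr_eq0 => /eqP. Qed.

Lemma dist_lift' x y z (f : Hom x y) (g : Hom y z) (h : Hom z (susp x))
    t (u : Hom t z) :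
  dist f g h -> h \oc u = 0 -> exists v : Hom t y, u = g \oc v.
Proof. by move/dist_rot/dist_lift; exact. Qed.

Lemma dist_extend' x y z (f : Hom x y) (g : Hom y z) (h : Hom z (susp x))
    t (u : Hom z t) :
  dist f g h -> u \oc g = 0 -> exists v : Hom (susp x) t, u = v \oc h.
Proof. by move/dist_rot/dist_extend; exact. Qed.

Lemma dist_extend'' x y z (f : Hom x y) (g : Hom y z) (h : Hom z (susp x))
    t (u : Hom x t) :
  dist f g h -> fmap susp u \oc h = 0 -> exists v : Hom y t, u = v \oc f.
Proof.
move/dist_rot/dist_rot/dist_extend => d /d[v ve].
have [v' v'e] := susp_surj (- v); exists v'; apply: susp_inj.
by rewrite fmap_comp v'e ve compNm compmN.
Qed.

Lemma cone_exists x y (f : Hom x y) :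
  exists z (g : Hom y z) (h : Hom z (susp x)), dist f g h.
Proof. exact: tr1_cone. Qed.

Lemma fiber_exists y z (g : Hom y z) :
  exists x (f : Hom x y) (h : Hom z (susp x)), dist f g h.
Proof.
have [c [u [v d]]] := cone_exists g.
have [a aK] := desuspK_is_iso c.
have [f fe] := susp_surj (- (v \oc desuspK c)).
exists (desusp c), f, (a \oc u); apply/(tr2 ax).
rewrite fe opprK; apply: (tr1_iso ax (iso_idm _) (iso_idm _) (c := a) _ _ _ _ d).
- by exists (desuspK c); case: aK.
- by rewrite comp1m compm1.
- by rewrite compm1.
- by case: aK => _ aK; rewrite fmap1 comp1m -compmA aK compm1.
Qed.

(** In the cone of the split monomorphism [i1] the connecting map vanishes, and this makes the
    comparison of the cone with [y] invertible. *)
Lemma biproduct_dist x y s (i1 : Hom x s) (i2 : Hom y s) (p1 : Hom s x)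
    (p2 : Hom s y) : p1 \oc i1 = idm x -> p2 \oc i2 = idm y -> p2 \oc i1 = 0 ->
  i1 \oc p1 + i2 \oc p2 = idm s -> dist i1 p2 (0 : Hom y (susp x)).
Proof.
move=> p1i1 p2i2 p2i1 e.
have [c [g [h d]]] := cone_exists i1.
have h0 : h = 0.
  rewrite -[h]comp1m -fmap1 -p1i1 fmap_comp -compmA.
  by rewrite (dist_comp0'' d) compm0.
have [u ue] := dist_extend d p2i1.
pose v := g \oc i2.
have uv : u \oc v = idm y by rewrite /v compmA -ue.
have vug : v \oc u \oc g = g.
  rewrite -compmA -ue /v -compmA.
  have -> : i2 \oc p2 = idm s - i1 \oc p1 by rewrite -e addrC addKr.
  by rewrite compmBr compm1 compmA (dist_comp0 d) comp0m subr0.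
have vu : v \oc u = idm c.
  have : (v \oc u - idm c) \oc g = 0 by rewrite compmBl vug comp1m subrr.
  by move=> /(dist_extend' d)[q]; rewrite h0 compm0 => /eqP; rewrite subr_eq0 => /eqP.
apply: (tr1_iso ax (iso_idm x) (iso_idm s) (c := u) _ _ _ _ d).
- by exists v.
- by rewrite comp1m compm1.
- by rewrite compm1.
- by rewrite h0 compm0 comp0m.
Qed.

Lemma dist_iso1 x y z (f : Hom x y) (g : Hom y z) (h : Hom z (susp x)) x' :
  dist f g h -> isomorphic x' x ->
  exists (f' : Hom x' y) (h' : Hom z (susp x')), dist f' g h'.
Proof.
move=> d [a [b [ba ab]]]; exists (f \oc a), (fmap susp b \oc h).
apply: (tr1_iso ax (a := b) _ (iso_idm y) (iso_idm z) _ _ _ d).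
- by exists a.
- by rewrite comp1m -compmA ab compm1.
- by rewrite comp1m compm1.
- by rewrite compm1.
Qed.

Lemma dist_iso2 x y z (f : Hom x y) (g : Hom y z) (h : Hom z (susp x)) y' :
  dist f g h -> isomorphic y y' ->
  exists (f' : Hom x y') (g' : Hom y' z), dist f' g' h.
Proof.
move=> d [a [b [ba ab]]]; exists (a \oc f), (g \oc b).
apply: (tr1_iso ax (iso_idm x) (b := a) _ (iso_idm z) _ _ _ d).
- by exists b.
- by rewrite compm1.
- by rewrite comp1m -compmA ba compm1.
- by rewrite fmap1 comp1m compm1.
Qed.

End Triangulated.

(** * Dimensions *)

Section Dimension.
Variable k : fieldType.
Implicit Types U V W : lmodType k.

Definition has_dim V (n : nat) : Prop :=
  exists f : {linear 'rV[k]_n -> V}, bijective f.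

Definition spanned V (n : nat) : Prop :=
  exists b : 'I_n -> V, forall v, exists c : 'I_n -> k, v = \sum_i c i *: b i.

Definition fin_dim V : Prop := exists n, has_dim V n.

Lemma has_dim_le V n m : has_dim V n -> has_dim V m -> (n <= m)%N.
Proof.
move=> [f [f' ff' f'f]] [g [g' gg' g'g]].
pose A : 'M[k]_(n, m) := \matrix_i g' (f (delta_mx 0 i)).
have fA u : f u = g (u *m A).
  rewrite {1}(row_sum_delta u) mulmx_sum_row !linear_sum /=.
  by apply: eq_bigr => i _; rewrite !linearZ /= rowK g'g.
have : row_free A.
  apply/inj_row_free => u uA; apply: (can_inj ff').
  by rewrite fA uA !linear0.
by rewrite /row_free => /eqP <-; exact: rank_leq_col.
Qed.

Lemma has_dim_uniq V n m : has_dim V n -> has_dim V m -> n = m.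
Proof.
by move=> hn hm; apply/eqP; rewrite eqn_leq !(has_dim_le hn, has_dim_le hm).
Qed.

Lemma has_dim0 V : (forall v : V, v = 0) -> has_dim V 0.
Proof.
move=> V0; exists (\0 : {linear 'rV[k]_0 -> V}); exists (fun=> 0).
  by move=> u; apply/rowP => -[].
by move=> v; exact: esym (V0 v).
Qed.

Lemma has_dim_iso U V n (f : {linear U -> V}) :
  bijective f -> has_dim U n -> has_dim V n.
Proof. by move=> fb [g gb]; exists (f \o g); exact: bij_comp. Qed.

Lemma has_dim1 V (x : V) : x != 0 -> (forall y, exists c, y = c *: x) -> has_dim V 1.
Proof.
move=> x0 xP.
pose f (u : 'rV[k]_1) := u 0 0 *: x.
have fl : linear f by move=> a u v; rewrite /f !mxE scalerDl scalerA.
pose F := GRing.isLinear.Build _ _ _ _ f fl.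
pose FL : {linear 'rV[k]_1 -> V} := HB.pack f F.
exists FL; pose g y := const_mx (sval (cid (xP y))) : 'rV[k]_1.
have gK : cancel g f.
  by move=> y; rewrite /f /g mxE; case: cid.
exists g => // u; apply/rowP => i; rewrite ord1.
have := gK (f u); rewrite /f => /eqP; rewrite -subr_eq0 -scalerBl.
by rewrite scaler_eq0 (negPf x0) orbF subr_eq0 => /eqP.
Qed.

Lemma spanned_drop V m (b : 'I_m -> V) (u : 'I_m -> k) i :
  (forall v, exists c : 'I_m -> k, v = \sum_j c j *: b j) ->
  u i != 0 -> \sum_j u j *: b j = 0 -> spanned V m.-1.
Proof.
case: m b u i => [|m] b u i; first by case: i.
move=> bP ui fu0; exists (fun j => b (lift i j)) => v; have [c ->] := bP v.
exists (fun j => c (lift i j) - c i / u i * u (lift i j)).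
have bi : b i = - (u i)^-1 *: \sum_(j < m) u (lift i j) *: b (lift i j).
  move: fu0; rewrite (bigD1_ord i) //= => /eqP.
  rewrite addr_eq0 => /eqP /(congr1 (fun y => (u i)^-1 *: y)).
  by rewrite scalerA mulVf // scale1r => ->; rewrite scalerN scaleNr.
rewrite (bigD1_ord i) //= {1}bi scalerA scaler_sumr -big_split.
apply: eq_bigr => j _ /=.
by rewrite scalerBl scalerA mulrN mulNr addrC scaleNr.
Qed.

Lemma spanned_fin_dim V n : spanned V n -> fin_dim V.
Proof.
move=> sn; have exn : exists m, `[< spanned V m >] by exists n; apply/asboolP.
case: (ex_minnP exn) => [m /asboolP [b bP] mmin].
exists m; pose f (u : 'rV[k]_m) := \sum_i u 0 i *: b i.
have fl : linear f.
  move=> a u v; rewrite /f scaler_sumr -big_split; apply: eq_bigr => i _.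
  by rewrite !mxE scalerDl scalerA.
pose F := GRing.isLinear.Build _ _ _ _ f fl.
pose FL : {linear 'rV[k]_m -> V} := HB.pack f F.
have finj u : f u = 0 -> u = 0.
  move=> fu0; apply/rowP => i; rewrite mxE; apply/eqP/negP => /negP ui.
  have m0 : (0 < m)%N := leq_ltn_trans (leq0n i) (ltn_ord i).
  have := mmin _ (asboolT (spanned_drop bP ui fu0)).
  by rewrite leqNgt prednK // leqnn.
exists FL; pose g v : 'rV[k]_m := \row_i sval (cid (bP v)) i.
have gK : cancel g f.
  move=> v; rewrite /f /g; case: cid => c /= e; rewrite [RHS]e.
  by apply: eq_bigr => i _; rewrite mxE.
exists g => // u; apply/eqP; rewrite -subr_eq0; apply/eqP/finj.
by rewrite -[f]/(FL : _ -> _) linearB /= gK subrr.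
Qed.

Lemma fin_dim_spanned V : fin_dim V -> exists n, spanned V n.
Proof.
move=> [n [f [f' ff' f'f]]]; exists n, (fun i => f (delta_mx 0 i)) => v.
exists (fun i => f' v 0 i); rewrite -[LHS]f'f {1}(row_sum_delta (f' v)) linear_sum.
by apply: eq_bigr => i _; rewrite linearZ.
Qed.

Lemma fin_dim_surj U V (f : {linear U -> V}) :
  (forall v, exists u, v = f u) -> fin_dim U -> fin_dim V.
Proof.
move=> fs /fin_dim_spanned[n [b bP]]; apply: (@spanned_fin_dim _ n).
exists (f \o b) => v; have [u ->] := fs v; have [c ->] := bP u.
by exists c; rewrite linear_sum; apply: eq_bigr => i _; rewrite linearZ.
Qed.

Lemma fin_dim_exact U V W (f : {linear U -> V}) (g : {linear V -> W}) :
  (forall v, g v = 0 -> exists u, v = f u) -> fin_dim U -> fin_dim W -> fin_dim V.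
Proof.
move=> ex /fin_dim_spanned[n [b bP]] [m [h [h' hh' h'h]]].
pose P (A : 'M[k]_m) := forall u : 'rV_m, (u <= A)%MS -> exists v, h u = g v.
have P0 : P 0.
  by move=> u; rewrite submx0 => /eqP ->; exists 0; rewrite !linear0.
(* The image of [g] in k^m is found as a row space of maximal rank among those made of values of
   [g]: a value outside it could be added to raise the rank. *)
have [A PA Amax] : exists2 A, P A & forall B, P B -> (\rank B <= \rank A)%N.
  pose Q r := `[< exists2 A, P A & \rank A = r >].
  have exQ : exists r, Q r by exists 0%N; apply/asboolP; exists 0; rewrite ?mxrank0.
  have Qb r : Q r -> (r <= m)%N by move=> /asboolP[A _ <-]; exact: rank_leq_row.
  case: (ex_maxnP exQ Qb) => r /asboolP[A PA <-] rmax; exists A => // B PB.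
  by apply: rmax; apply/asboolP; exists B.
have inA v : (h' (g v) <= A)%MS.
  have PB : P (A + h' (g v))%MS.
    move=> u /sub_addsmxP[[c d] /= ->].
    have [v1 v1e] := PA (c *m A) (submxMl _ _).
    exists (v1 + d 0 0 *: v).
    rewrite !linearD /= v1e linearZ /=; congr (_ + _).
    by rewrite (mx11_scalar d) mul_scalar_mx linearZ /= h'h mxE eqxx mulr1n.
  have := Amax _ PB; have sA : (A <= A + h' (g v))%MS by exact: addsmxSl.
  rewrite (geq_leqif (mxrank_leqif_sup sA)) => sB.
  by apply: submx_trans sB; exact: addsmxSr.
have /choice[y yP] : forall i, exists z, h (row i A) = g z.
  by move=> i; apply: PA; exact: row_sub.
apply: (@spanned_fin_dim _ (m + n)).
exists (fun i => match fintype.split i with inl j => y j | inr j => f (b j) end) => v.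
have /submxP[D De] := inA v.
have [u ue] : exists u, v - \sum_i D 0 i *: y i = f u.
  apply: ex; rewrite linearB linear_sum /= -[g v]h'h De mulmx_sum_row.
  rewrite linear_sum -sumrB big1 // => i _.
  by rewrite (linearZ_LR h) (linearZ_LR g) yP subrr.
have [c ce] := bP u.
exists (fun i => match fintype.split i with inl j => D 0 j | inr j => c j end).
rewrite big_split_ord /=.
under eq_bigr => i _ do rewrite (unsplitK (inl i)).
under [X in _ + X]eq_bigr => i _ do rewrite (unsplitK (inr i)).
rewrite -[LHS](subrK (\sum_i D 0 i *: y i)) ue ce addrC linear_sum.
by congr (_ + _); apply: eq_bigr => i _; rewrite linearZ.
Qed.

(** A chosen basis. A space that is not finite-dimensional receives the map from k^0, so that [dimk]
    is total. *)
Definition frame V : {n & {linear 'rV[k]_n -> V}} :=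
  if pselect (exists x : {n & {linear 'rV[k]_n -> V}}, bijective (projT2 x))
    is left h then sval (cid h) else
    existT (fun n => {linear 'rV[k]_n -> V}) 0%N (\0 : {linear 'rV[k]_0 -> V}).

Definition dimk V : nat := projT1 (frame V).

Lemma frame_bij V : fin_dim V -> bijective (projT2 (frame V)).
Proof.
move=> [n [f fb]]; rewrite /frame; case: pselect => [h|[]]; first by case: cid.
by exists (existT (fun n => {linear 'rV[k]_n -> V}) n f).
Qed.

Lemma dimkE V n : has_dim V n -> dimk V = n.
Proof.
move=> h; apply: has_dim_uniq (h); exists (projT2 (frame V)).
by apply: frame_bij; exists n.
Qed.

Definition rankk U V (f : U -> V) : nat :=
  xget 0%N [set r | exists M : 'M[k]_(dimk U, dimk V),
    (forall u, f (projT2 (frame U) u) = projT2 (frame V) (u *m M)) /\ r = \rank M].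

Lemma rankkP U V (f : {linear U -> V}) : fin_dim U -> fin_dim V ->
  exists M : 'M[k]_(dimk U, dimk V),
    (forall u, f (projT2 (frame U) u) = projT2 (frame V) (u *m M)) /\
    rankk f = \rank M.
Proof.
move=> /frame_bij [a aK Ka] /frame_bij[b bK Kb].
rewrite /rankk; case: xgetP => [r _ //|/=].
pose M : 'M[k]_(dimk U, dimk V) := \matrix_i b (f (projT2 (frame U) (delta_mx 0 i))).
move=> /(_ (\rank M))[]; exists M; split=> // u.
rewrite {1}(row_sum_delta u) mulmx_sum_row !linear_sum /=.
by apply: eq_bigr => i _; rewrite !linearZ /= rowK Kb.
Qed.

Lemma rankk_triv U V (f : {linear U -> V}) : fin_dim U -> fin_dim V ->
  dimk U = 0%N \/ dimk V = 0%N -> rankk f = 0%N.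
Proof.
move=> fU fV d; have [M [_ ->]] := rankkP f fU fV.
apply/eqP; rewrite -leqn0.
case: d => <-; [exact: rank_leq_row|exact: rank_leq_col].
Qed.

Lemma dimk_exact U V W (f : {linear U -> V}) (g : {linear V -> W}) :
  fin_dim U -> fin_dim V -> fin_dim W ->
  (forall u, g (f u) = 0) -> (forall v, g v = 0 -> exists u, v = f u) ->
  dimk V = (rankk f + rankk g)%N.
Proof.
move=> fU fV fW gf ex.
have [M [ME ->]] := rankkP f fU fV; have [N [NE ->]] := rankkP g fV fW.
have [a aK Ka] := frame_bij fU; have [b bK Kb] := frame_bij fV.
have [c cK Kc] := frame_bij fW.
have MN : M *m N = 0.
  apply/row_matrixP => i; rewrite row_mul row0 rowE; apply: (can_inj cK).
  by rewrite -NE -ME gf linear0.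
have -> : \rank M = \rank (kermx N).
  apply/eqP; rewrite eqn_leq; apply/andP; split; apply: mxrankS.
    exact/sub_kermxP.
  apply/row_subP => i; set u := row i _.
  have uN : u *m N = 0 by rewrite /u -row_mul mulmx_ker row0.
  have [x xe] : exists x, projT2 (frame V) u = f x.
    by apply: ex; rewrite NE uN linear0.
  have -> : u = a x *m M by apply: (can_inj bK); rewrite xe -ME Ka.
  exact: submxMl.
by rewrite mxrank_ker subnK // rank_leq_row.
Qed.

End Dimension.

Section HomDimension.
Variables (k : fieldType) (C : klin_category k).
Implicit Types x y z t : C.

Definition precomp x y (f : Hom x y) t (u : Hom y t) : Hom x t := u \oc f.

Fact precomp_is_linear x y (f : Hom x y) t : linear (@precomp x y f t).
Proof. by move=> a u v; rewrite /precomp comp_linearl. Qed.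

HB.instance Definition _ x y (f : Hom x y) t :=
  GRing.isLinear.Build k (Hom y t) (Hom x t) *:%R (@precomp x y f t)
    (@precomp_is_linear x y f t).

Definition postcomp y z (g : Hom y z) x (u : Hom x y) : Hom x z := g \oc u.

Fact postcomp_is_linear y z (g : Hom y z) x : linear (@postcomp y z g x).
Proof. by move=> a u v; rewrite /postcomp comp_linearr. Qed.

HB.instance Definition _ y z (g : Hom y z) x :=
  GRing.isLinear.Build k (Hom x y) (Hom x z) *:%R (@postcomp y z g x)
    (@postcomp_is_linear y z g x).

Lemma precomp_bij x y (f : Hom x y) t : is_iso f -> bijective (@precomp x y f t).
Proof.
move=> [g [gf fg]]; exists (@precomp y x g t) => u; rewrite /precomp -compmA.
  by rewrite fg compm1.
by rewrite gf compm1.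
Qed.

Lemma postcomp_bij y z (g : Hom y z) x : is_iso g -> bijective (@postcomp y z g x).
Proof.
move=> [h [hg gh]]; exists (@postcomp z y h x) => u; rewrite /postcomp compmA.
  by rewrite hg comp1m.
by rewrite gh comp1m.
Qed.

Definition fmap_fun (D : klin_category k) (F : klin_functor C D) x y
  (f : Hom x y) : Hom (F x) (F y) := fmap F f.

Fact fmap_fun_is_linear (D : klin_category k) (F : klin_functor C D) x y :
  linear (@fmap_fun D F x y).
Proof. by move=> a u v; rewrite /fmap_fun fmap_linear. Qed.

HB.instance Definition _ (D : klin_category k) (F : klin_functor C D) x y :=
  GRing.isLinear.Build k (Hom x y) (Hom (F x) (F y)) *:%R (@fmap_fun D F x y)
    (@fmap_fun_is_linear D F x y).

Lemma fin_dim_Hom_isol x x' t : isomorphic x x' -> fin_dim (Hom x t) ->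
  fin_dim (Hom x' t).
Proof.
move=> [f [g [gf fg]]] [n h]; exists n.
by apply: has_dim_iso (@precomp_bij x' x g t _) h; exists f.
Qed.

End HomDimension.

Lemma rankk_eq0 (k : fieldType) (U V : lmodType k) (f : {linear U -> V}) :
  fin_dim U -> fin_dim V -> rankk f = 0%N -> forall u, f u = 0.
Proof.
move=> fU fV r0 u; have [M [ME rE]] := rankkP f fU fV.
have [a aK Ka] := frame_bij fU.
move: r0; rewrite rE => /eqP; rewrite mxrank_eq0 => /eqP M0.
by rewrite -[u]Ka ME M0 mulmx0 linear0.
Qed.

Lemma dimk_eq0 (k : fieldType) (V : lmodType k) : (forall v : V, v = 0) -> dimk V = 0%N.
Proof. by move=> V0; apply: dimkE; exact: has_dim0. Qed.

Lemma fin_dim0 (k : fieldType) (V : lmodType k) : (forall v : V, v = 0) -> fin_dim V.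
Proof. by move=> V0; exists 0%N; exact: has_dim0. Qed.

Lemma fin_dim_inj (k : fieldType) (V W : lmodType k) (g : {linear V -> W}) :
  (forall v, g v = 0 -> v = 0) -> fin_dim W -> fin_dim V.
Proof.
move=> gi; apply: (@fin_dim_exact _ 'rV[k]_0 _ _ \0).
  by move=> v /gi ->; exists 0.
by apply: fin_dim0 => v; exact: thinmx0.
Qed.

(** Applying [dimk_exact] to 0 -> U -> V and to U -> V -> W shows that the dimensions differ by the
    rank of [g]. This gives the decreasing measure when copies of a shift are split off. *)
Lemma dimk_lt (k : fieldType) (U V W : lmodType k) (f : {linear U -> V})
    (g : {linear V -> W}) v : fin_dim V -> fin_dim W ->
  (forall u, f u = 0 -> u = 0) -> (forall u, g (f u) = 0) ->
  (forall v, g v = 0 -> exists u, v = f u) -> g v != 0 -> (dimk U < dimk V)%N.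
Proof.
move=> fV fW fi gf ex gv.
have fU : fin_dim U := fin_dim_inj fi fV.
have f0 : fin_dim 'rV[k]_0 by apply: fin_dim0 => u; exact: thinmx0.
rewrite (dimk_exact fU fV fW gf ex).
rewrite (@dimk_exact _ _ _ _ (\0 : {linear 'rV[k]_0 -> U}) f f0 fU fV).
- rewrite (rankk_triv _ f0 fU) ?add0n; last first.
    by left; apply: dimk_eq0 => u; exact: thinmx0.
  rewrite -[X in (X < _)%N]addn0 ltn_add2l lt0n; apply/negP => /eqP r0.
  by rewrite (rankk_eq0 fV fW r0) eqxx in gv.
- by move=> u; rewrite linear0.
- by move=> u /fi ->; exists 0; rewrite linear0.
Qed.

(** * Weights *)

Section Orthogonality.
Variables (k : fieldType) (T : triangulated_category k).
Implicit Types x y z t : T.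

Definition orth x y : Prop := forall f : Hom x y, f = 0.

Lemma orth_isol x x' y : isomorphic x x' -> orth x y -> orth x' y.
Proof.
move=> [a [b [_ ab]]] o f.
by rewrite -[f]compm1 -ab compmA (o (f \oc a)) comp0m.
Qed.

Lemma orth_isor x y y' : isomorphic y y' -> orth x y -> orth x y'.
Proof.
move=> [a [b [_ ab]]] o f.
by rewrite -[f]comp1m -ab -compmA (o (b \oc f)) compm0.
Qed.

Lemma orth_susp x y : orth x y -> orth (susp x) (susp y).
Proof. by move=> o f; have [g <-] := susp_surj f; rewrite (o g) fmap0. Qed.

Lemma susp_orth x y : orth (susp x) (susp y) -> orth x y.
Proof. by move=> o f; apply: susp_inj; rewrite fmap0; exact: o. Qed.

Lemma orth_retractl x s y (i : Hom x s) (p : Hom s x) :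
  p \oc i = idm x -> orth s y -> orth x y.
Proof. by move=> pi o f; rewrite -[f]compm1 -pi compmA (o (f \oc p)) comp0m. Qed.

Lemma orth_retractr x y s (i : Hom y s) (p : Hom s y) :
  p \oc i = idm y -> orth x s -> orth x y.
Proof. by move=> pi o f; rewrite -[f]comp1m -pi -compmA (o (i \oc f)) compm0. Qed.

Lemma orth_zerol x y : is_zero x -> orth x y.
Proof. by move=> /(_ y)[]. Qed.

Lemma orth_zeror x y : is_zero y -> orth x y.
Proof. by move=> /(_ x)[]. Qed.

Lemma orth_extl x y z (f : Hom x y) (g : Hom y z) (h : Hom z (susp x)) t :
  dist f g h -> orth x t -> orth z t -> orth y t.
Proof.
move=> d ox oz u; have [v ->] := dist_extend d (ox (u \oc f)).
by rewrite (oz v) comp0m.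
Qed.

Lemma orth_extr x y z (f : Hom x y) (g : Hom y z) (h : Hom z (susp x)) t :
  dist f g h -> orth t x -> orth t z -> orth t y.
Proof.
move=> d ox oz u; have [v ->] := dist_lift d (oz (g \oc u)).
by rewrite (ox v) compm0.
Qed.

Lemma sum_of_extension (P : T -> Prop) : extension_closed P ->
  forall x y s, is_biproduct x y s -> P x -> P y -> P s.
Proof.
move=> ext x y s [i1 [i2 [p1 [p2 [h1 h2 _ h4 h5]]]]] Px Py.
exact: ext (biproduct_dist h1 h2 h4 h5) Px Py.
Qed.

(** Classical generation as an induction principle: closure under direct sums is derived from
    extensions, and closure under summands is asked for in the handier form of retracts. *)
Lemma thick_induction (s : T) (P : T -> Prop) : classically_generated s ->
  iso_closed P -> (forall x, is_zero x -> P x) -> extension_closed P ->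
  (forall x, P x -> P (susp x)) -> (forall x, P x -> P (desusp x)) ->
  (forall x y (i : Hom x y) (p : Hom y x), p \oc i = idm x -> P y -> P x) ->
  P s -> forall x, P x.
Proof.
move=> gen isoP zeroP extP sP dP retP Ps x.
suff -> : P = setT by [].
apply: gen => //; last first.
  by move=> y t /summand_retract[i [p]]; exact: retP.
by split=> //; split=> //; exact: sum_of_extension.
Qed.

End Orthogonality.

(** * Finite powers of an object *)

Section Powers.
Variables (k : fieldType) (T : triangulated_category k) (y : T).

Definition is_power n (p : T) (i : 'I_n -> Hom y p) (q : 'I_n -> Hom p y) : Prop :=
  [/\ forall j, q j \oc i j = idm y, forall j l, j != l -> q j \oc i l = 0
    & \sum_j i j \oc q j = idm p].

Lemma power_exists n : exists p (i : 'I_n -> Hom y p) q, is_power i q.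
Proof.
elim: n => [|n [p [i [q [qi1 qi0 iq]]]]].
  have [z0 z0P] := zero_exists T.
  exists z0, (fun=> 0), (fun=> 0); split; [by case|by case|].
  by rewrite big_ord0; apply/esym/zero_idm.
have [s [i1 [i2 [p1 [p2 [h1 h2 h3 h4 h5]]]]]] := biproduct_exists y p.
exists s, (fun j => if unlift ord0 j is Some l then i2 \oc i l else i1).
exists (fun j => if unlift ord0 j is Some l then q l \oc p2 else p1).
split=> [j|j l|].
- case: unliftP => [l _|_] //.
  by rewrite -compmA (compmA p2) h2 comp1m qi1.
- case: unliftP => [j'|] ->; case: unliftP => [l'|] -> // jl.
  + by rewrite -compmA (compmA p2) h2 comp1m qi0.
  + by rewrite -compmA h4 compm0.
  + by rewrite compmA h3 comp0m.
- rewrite big_ord_recl unlift_none.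
  under eq_bigr => j _ do rewrite liftK compmA -(compmA i2).
  by rewrite -comp_suml -comp_sumr iq compm1.
Qed.

Lemma power_orthl n p (i : 'I_n -> Hom y p) q t : is_power i q -> orth y t -> orth p t.
Proof.
move=> [_ _ iq] o f; rewrite -[f]compm1 -iq comp_sumr big1 // => j _.
by rewrite compmA (o (f \oc i j)) comp0m.
Qed.

Lemma power_orthr n p (i : 'I_n -> Hom y p) q t : is_power i q -> orth t y -> orth t p.
Proof.
move=> [_ _ iq] o f; rewrite -[f]comp1m -iq comp_suml big1 // => j _.
by rewrite -compmA (o (q j \oc f)) compm0.
Qed.

Lemma power_map n p (i : 'I_n -> Hom y p) q x (g : 'I_n -> Hom x y) :
  is_power i q -> forall j, q j \oc (\sum_l i l \oc g l) = g j.
Proof.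
move=> [qi1 qi0 _] j; rewrite comp_sumr (bigD1 j) //= compmA qi1 comp1m.
by rewrite big1 ?addr0 // => l lj; rewrite compmA qi0 ?comp0m // eq_sym.
Qed.

End Powers.

(** The shifts of a w-spherical object, described uniformly in w. Non-isomorphisms play the part of
    the multiples of X: they vanish unless j = i + w, form a line there, and compose to zero.
    [sph_end] says that an endomorphism of [S i] is a scalar up to a non-isomorphism, which covers
    both End = k and End = k[X]/(X^2). *)
Record spherical_family (k : fieldType) (T : triangulated_category k) (w : int)
    (S : int -> T) : Prop := SphericalFamily {
  sph_susp : forall i, isomorphic (susp (S i)) (S (i + 1));
  sph_comp : forall i j l (f : Hom (S i) (S j)) (g : Hom (S j) (S l)),
    ~ is_iso f -> ~ is_iso g -> g \oc f = 0;
  sph_deg : forall i j (f : Hom (S i) (S j)), ~ is_iso f -> j != i + w -> f = 0;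
  sph_rad : forall i j, j = i + w -> exists x : Hom (S i) (S j),
    [/\ ~ is_iso x, x <> 0 & forall y, ~ is_iso y -> exists c, y = c *: x];
  sph_iso : forall i j (f : Hom (S i) (S j)), is_iso f -> i = j;
  sph_end : forall i (f : Hom (S i) (S i)), exists c : k, ~ is_iso (f - c *: idm (S i))
}.

(** * Weight bounds and finite-dimensionality of Hom *)

Section Weights.
Variables (k : fieldType) (T : triangulated_category k) (w : int) (S : int -> T).
Hypotheses (w_le0 : w <= 0) (sphS : spherical_family w S).
Implicit Types (x y z t : T) (i j a b c : int).

Lemma sph_orth i j : j != i -> j != i + w -> orth (S i) (S j).
Proof.
move=> ji jw f; apply: (sph_deg sphS) jw => /(sph_iso sphS) e.
by rewrite e eqxx in ji.
Qed.

Lemma sph_orth_gt i j : i < j -> orth (S i) (S j).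
Proof. by move=> ij; apply: sph_orth; lia. Qed.

Lemma sph_neq0 i : ~ is_zero (S i).
Proof.
move=> zi; have [x [_ x0 _]] := sph_rad sphS (erefl (i + w)).
by apply: x0; case: (zi (S (i + w))).
Qed.

Lemma sph_susp_pred i : isomorphic (susp (S (i - 1))) (S i).
Proof. by have := sph_susp sphS (i - 1); rewrite subrK. Qed.

Lemma orth_suspl x i : orth (susp x) (S i) <-> orth x (S (i - 1)).
Proof.
split=> o; last exact: orth_isor (sph_susp_pred i) (orth_susp o).
apply: susp_orth; apply: orth_isor o.
exact: isomorphic_sym (sph_susp_pred i).
Qed.

Lemma orth_suspr x i : orth (S i) (susp x) <-> orth (S (i - 1)) x.
Proof.
split=> o; last exact: orth_isol (sph_susp_pred i) (orth_susp o).
apply: susp_orth; apply: orth_isol o.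
exact: isomorphic_sym (sph_susp_pred i).
Qed.

(** Upper and lower weight bounds are encoded by orthogonality to shifts alone, so that closure
    under extensions and retracts is immediate. The orthogonality between the two classes is a
    theorem, [Wle_orth_Wge]. *)
Definition Wle b x : Prop := forall i, b < i -> orth x (S i).
Definition Wge a x : Prop := forall i, i < a -> orth (S i) x.

Lemma Wle_mono b b' x : b <= b' -> Wle b x -> Wle b' x.
Proof. by move=> bb' h i ib; apply: h; exact: le_lt_trans ib. Qed.

Lemma Wge_mono a a' x : a' <= a -> Wge a x -> Wge a' x.
Proof. by move=> aa' h i ia; apply: h; exact: lt_le_trans aa'. Qed.

Lemma Wle_S i : Wle i (S i).
Proof. by move=> j; exact: sph_orth_gt. Qed.

Lemma Wge_S i : Wge i (S i).
Proof. by move=> j; exact: sph_orth_gt. Qed.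

Lemma Wle_iso b x y : isomorphic x y -> Wle b x -> Wle b y.
Proof. by move=> xy h i ib; apply: orth_isol xy _; exact: h. Qed.

Lemma Wge_iso a x y : isomorphic x y -> Wge a x -> Wge a y.
Proof. by move=> xy h i ia; apply: orth_isor xy _; exact: h. Qed.

Lemma Wle_ext b : extension_closed (Wle b).
Proof. by move=> x y z f g h d hx hz i ib; apply: orth_extl d _ _; auto. Qed.

Lemma Wge_ext a : extension_closed (Wge a).
Proof. by move=> x y z f g h d hx hz i ia; apply: orth_extr d _ _; auto. Qed.

Lemma Wle_retract b x y (i : Hom x y) (p : Hom y x) :
  p \oc i = idm x -> Wle b y -> Wle b x.
Proof. by move=> pi h j jb; apply: orth_retractl pi _; exact: h. Qed.

Lemma Wge_retract a x y (i : Hom x y) (p : Hom y x) :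
  p \oc i = idm x -> Wge a y -> Wge a x.
Proof. by move=> pi h j ja; apply: orth_retractr pi _; exact: h. Qed.

Lemma Wle_zero b x : is_zero x -> Wle b x.
Proof. by move=> z i _; exact: orth_zerol. Qed.

Lemma Wge_zero a x : is_zero x -> Wge a x.
Proof. by move=> z i _; exact: orth_zeror. Qed.

Lemma Wle_susp b x : Wle (b + 1) (susp x) <-> Wle b x.
Proof.
split=> h i ib; last by apply/orth_suspl; apply: h; lia.
have /orth_suspl : orth (susp x) (S (i + 1)) by apply: h; lia.
by rewrite addrK.
Qed.

Lemma Wge_susp a x : Wge (a + 1) (susp x) <-> Wge a x.
Proof.
split=> h i ia; last by apply/orth_suspr; apply: h; lia.
have /orth_suspr : orth (S (i + 1)) (susp x) by apply: h; lia.
by rewrite addrK.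
Qed.

Lemma Wle_desusp b x : Wle b x -> Wle (b - 1) (desusp x).
Proof.
move=> h; apply/Wle_susp; rewrite subrK; apply: Wle_iso h.
exact/isomorphic_sym/desuspK_isomorphic.
Qed.

Lemma Wge_desusp a x : Wge a x -> Wge (a - 1) (desusp x).
Proof.
move=> h; apply/Wge_susp; rewrite subrK; apply: Wge_iso h.
exact/isomorphic_sym/desuspK_isomorphic.
Qed.

Hypothesis genS : classically_generated (S 0).

Lemma Wle_exists x : exists b, Wle b x.
Proof.
move: x; apply: (thick_induction genS).
- by move=> x y xy [b h]; exists b; exact: Wle_iso h.
- by move=> x z; exists 0; exact: Wle_zero.
- move=> x y z f g h d [b hb] [b' hb']; exists (Num.max b b').
  by apply: (Wle_ext d); [apply: Wle_mono hb|apply: Wle_mono hb']; lia.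
- by move=> x [b h]; exists (b + 1); apply/Wle_susp.
- by move=> x [b h]; exists (b - 1); exact: Wle_desusp.
- by move=> x y i p pi [b h]; exists b; exact: Wle_retract pi h.
- by exists 0; exact: Wle_S.
Qed.

Lemma Wge_exists x : exists a, Wge a x.
Proof.
move: x; apply: (thick_induction genS).
- by move=> x y xy [b h]; exists b; exact: Wge_iso h.
- by move=> x z; exists 0; exact: Wge_zero.
- move=> x y z f g h d [b hb] [b' hb']; exists (Num.min b b').
  by apply: (Wge_ext d); [apply: Wge_mono hb|apply: Wge_mono hb']; lia.
- by move=> x [b h]; exists (b + 1); apply/Wge_susp.
- by move=> x [b h]; exists (b - 1); exact: Wge_desusp.
- by move=> x y i p pi [b h]; exists b; exact: Wge_retract pi h.
- by exists 0; exact: Wge_S.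
Qed.

(** The start of the induction in [Wle_orth_Wge]. A bound that may depend on [y] is weak enough to
    survive extensions, shifts in both directions and retracts. *)
Lemma orth_Wle_exists y : exists c, forall x, Wle c x -> orth x y.
Proof.
move: y; apply: (thick_induction genS).
- by move=> x y xy [c h]; exists c => z /h; exact: orth_isor.
- by move=> x z; exists 0 => y _; exact: orth_zeror.
- move=> x y z f g h d [b hb] [b' hb']; exists (Num.min b b') => t ht.
  by apply: (orth_extr d); [apply: hb|apply: hb']; apply: Wle_mono ht; lia.
- move=> x [c h]; exists (c + 1) => y hy.
  have dy := desuspK_isomorphic y.
  apply: (orth_isol dy); apply: orth_susp; apply: h; apply/Wle_susp.
  exact: Wle_iso (isomorphic_sym dy) hy.
- move=> x [c h]; exists (c - 1) => y /Wle_susp; rewrite subrK => /h o.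
  apply: susp_orth; apply: orth_isor o.
  exact/isomorphic_sym/desuspK_isomorphic.
- by move=> x y i p pi [c h]; exists c => z /h; exact: orth_retractr pi.
- by exists (- 1) => x h; apply: h; lia.
Qed.

Lemma fin_dim_sph i j : fin_dim (Hom (S i) (S j)).
Proof.
have [ij|ij] := eqVneq j i; last first.
  have ni (f : Hom (S i) (S j)) : ~ is_iso f.
    by move=> /(sph_iso sphS) e; rewrite e eqxx in ij.
  have [jw|jw] := eqVneq j (i + w).
    have [x [_ _ xP]] := sph_rad sphS jw.
    apply: (@spanned_fin_dim _ _ 1); exists (fun=> x) => y.
    have [c ->] := xP y (ni y); exists (fun=> c).
    by rewrite big_ord1.
  by apply: fin_dim0; exact: sph_orth.
subst j; have [iw|iw] := eqVneq i (i + w); last first.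
  apply: (@spanned_fin_dim _ _ 1); exists (fun=> idm (S i)) => y.
  have [c /(sph_deg sphS) /(_ iw) /eqP] := sph_end sphS y.
  by rewrite subr_eq0 => /eqP e; exists (fun=> c); rewrite big_ord1.
have [x [_ _ xP]] := sph_rad sphS iw.
apply: (@spanned_fin_dim _ _ 2).
exists (fun l : 'I_2 => if l == 0 then idm (S i) else x) => y.
have [c /xP[d e]] := sph_end sphS y.
exists (fun l : 'I_2 => if l == 0 then c else d).
by rewrite big_ord_recl big_ord1 /= -e addrC subrK.
Qed.

Lemma fin_dim_Hom x i : fin_dim (Hom x (S i)).
Proof.
move: x i; apply: (thick_induction genS).
- by move=> x y xy h i; apply: fin_dim_Hom_isol xy _; exact: h.
- by move=> x z i; apply: fin_dim0; exact: orth_zerol.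
- move=> x y z f g h d hx hz i.
  apply: (@fin_dim_exact _ _ _ _ (@precomp _ _ _ _ g (S i)) (@precomp _ _ _ _ f (S i))).
  + by move=> u /(dist_extend d).
  + exact: hz.
  + exact: hx.
- move=> x h i; have [a ai] := sph_susp_pred i.
  have [b bK Kb] := postcomp_bij (susp x) ai.
  apply: (@fin_dim_surj _ _ _ (postcomp a (x := susp x) \o
      fmap_fun (x := x) (y := S (i - 1)) susp)).
    move=> v; have [u uv] := susp_surj (b v); exists u.
    by rewrite /= /fmap_fun uv Kb.
  exact: h.
- move=> x h i; have [a ai] := sph_susp sphS i.
  have [b bK Kb] := postcomp_bij (susp (desusp x)) ai.
  apply: (@fin_dim_inj _ _ _ (postcomp a (x := susp (desusp x)) \o
      fmap_fun (x := desusp x) (y := S i) susp)).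
    move=> v /= v0; apply: susp_inj; rewrite fmap0; apply: (can_inj bK).
    by rewrite linear0.
  apply: fin_dim_Hom_isol (h (i + 1)).
  exact/isomorphic_sym/desuspK_isomorphic.
- move=> x y i p pi h j.
  apply: (@fin_dim_surj _ _ _ (precomp i (t := S j))); last exact: h.
  by move=> v; exists (v \oc p); rewrite /= /precomp -compmA pi compm1.
- by move=> i; exact: fin_dim_sph.
Qed.

End Weights.

(** * Weight decompositions by minimal approximations *)

Section Approximations.
Variables (k : fieldType) (T : triangulated_category k) (w : int) (S : int -> T).
Hypotheses (w_le0 : w <= 0) (sphS : spherical_family w S).
Hypotheses (genS : classically_generated (S 0)) (idemT : idempotent_complete T).
Implicit Types (x y z t : T) (a b c : int).

Local Notation Wle := (Wle S).
Local Notation Wge := (Wge S).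

(* Minimality: in a linear relation between the generators all coefficients lie
   in the radical of the local ring End (S b). *)
Lemma minimal_generators x b : exists n (g : 'I_n -> Hom x (S b)),
  (forall h : Hom x (S b), exists d : 'I_n -> Hom (S b) (S b),
     h = \sum_j d j \oc g j) /\
  (forall d : 'I_n -> Hom (S b) (S b), \sum_j d j \oc g j = 0 ->
     forall j, ~ is_iso (d j)).
Proof.
pose Q n := `[< exists g : 'I_n -> Hom x (S b), forall h : Hom x (S b),
  exists d : 'I_n -> Hom (S b) (S b), h = \sum_j d j \oc g j >].
have exQ : exists n, Q n.
  have [n [g gP]] := fin_dim_spanned (fin_dim_Hom sphS genS x b).
  exists n; apply/asboolP; exists g => h; have [c ->] := gP h.
  exists (fun j => c j *: idm (S b)); apply: eq_bigr => j _.
  by rewrite compmZl comp1m.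
case: (ex_minnP exQ) => n /asboolP [g gP] nmin; exists n, g; split=> // d.
case: n g gP nmin d => [|n] g gP nmin d; first by move=> _ [].
move=> d0 j [e [ed de]].
have gj : g j = - (e \oc \sum_l d (lift j l) \oc g (lift j l)).
  move: d0; rewrite (bigD1_ord j) //= => /eqP; rewrite addr_eq0 => /eqP.
  by move=> /(congr1 (fun u => e \oc u)); rewrite compmA ed comp1m compmN.
have : Q n.
  apply/asboolP; exists (fun l => g (lift j l)) => h; have [c ->] := gP h.
  exists (fun l => c (lift j l) - c j \oc e \oc d (lift j l)).
  rewrite (bigD1_ord j) //= {1}gj compmN comp_sumr comp_sumr -sumrN -big_split.
  by apply: eq_bigr => l _ /=; rewrite compmBl !compmA addrC.
by move/nmin; rewrite ltnn.
Qed.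

(** The top layer of [x]: generators of Hom (x, S b) over End (S b) form a map to a power of [S b],
    and generation forces the fibre into weights below [b]. The last clause is minimality of the
    generators: a map that kills the approximation has only non-isomorphisms as components. *)
Lemma left_approximation x b : Wle b x ->
  exists n p (i : 'I_n -> Hom (S b) p) (q : 'I_n -> Hom p (S b)) t
    (f : Hom t x) (g : Hom x p) (h : Hom p (susp t)),
  [/\ is_power i q, dist f g h, Wle (b - 1) t,
      forall u : Hom x (S b), exists v, u = v \oc g
    & forall u : Hom p (S b), u \oc g = 0 -> forall j, ~ is_iso (u \oc i j)].
Proof.
move=> xb; have [n [g [gP gmin]]] := minimal_generators x b.
have [p [i [q pw]]] := power_exists (S b) n.
pose G := \sum_l i l \oc g l.
have qG j : q j \oc G = g j by exact: power_map pw j.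
have genG (u : Hom x (S b)) : exists v, u = v \oc G.
  have [d ->] := gP u; exists (\sum_j d j \oc q j).
  by rewrite comp_suml; apply: eq_bigr => j _; rewrite -compmA qG.
have [t [f [h d]]] := fiber_exists G.
exists n, p, i, q, t, f, G, h; split=> //.
- move=> l lb v.
  have [|v' ->] := dist_extend'' d (u := v).
    have o : orth p (S (l + 1)).
      by apply: power_orthl pw _; apply: (sph_orth_gt w_le0 sphS); lia.
    apply: (orth_isor (isomorphic_sym (sph_susp sphS l)) o).
  have [e|lb'] := eqVneq l b; last by rewrite [v'](xb l) ?comp0m //; lia.
  subst l; have [v2 ->] := genG v'.
  by rewrite -compmA (dist_comp0 d) compm0.
- move=> u uG; have [_ _ iq] := pw.
  apply: gmin; rewrite -[RHS]uG /G comp_sumr.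
  by apply: eq_bigr => j _; rewrite compmA.
Qed.

(** A map from [S l] to the fibre that vanishes in [x] comes from a map [S (l + 1) -> p]. As l < a <
    b, it goes to copies of a strictly higher shift and is zero. *)
Lemma left_approximation_Wge x a b n p (i : 'I_n -> Hom (S b) p) q t
    (f : Hom t x) (g : Hom x p) (h : Hom p (susp t)) :
  is_power i q -> dist f g h -> a < b -> Wge a x -> Wge a t.
Proof.
move=> pw d ab xa l la v; apply: susp_inj; rewrite fmap0.
have [|u ->] := dist_lift' (dist_rot d) (u := fmap susp v).
  by rewrite compNm -fmap_comp (xa l la (f \oc v)) fmap0 oppr0.
have o : orth (S (l + 1)) p.
  by apply: power_orthr pw _; apply: (sph_orth_gt w_le0 sphS); lia.
by rewrite (orth_isol (isomorphic_sym (sph_susp sphS l)) o u) compm0.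
Qed.

(** Top layers of [x] are removed until its weights fall below the bound of [orth_Wle_exists]; each
    removed layer is a power of a shift lower than [j], hence orthogonal to [y]. *)
Theorem Wle_orth_Wge x y i j : i < j -> Wle i x -> Wge j y -> orth x y.
Proof.
move=> ij xi yj; have [c cP] := orth_Wle_exists w_le0 sphS genS y.
have [n] : exists n : nat, i <= c + n%:Z by exists `|i - c|%N; lia.
elim: n i x ij xi => [|n IH] i x ij xi inc.
  by apply: cP; apply: Wle_mono xi; lia.
have [m [p [l [q [t [f [g [h [pw d tb _ _]]]]]]]]] := left_approximation xi.
have ot : orth t y by apply: (IH (i - 1)) => //; lia.
apply: (orth_extl d ot); apply: power_orthl pw _; exact: yj.
Qed.

Lemma Wle_Wge_zero x i j : i < j -> Wle i x -> Wge j x -> is_zero x.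
Proof. by move=> ij xi xj; apply/zero_idm; exact: Wle_orth_Wge xi xj _. Qed.

(** The fibre of the approximation has lower weights than [x], so its map to [x] is zero and the
    approximation splits. *)
Lemma heart_retract x b : Wle b x -> Wge b x ->
  exists n p (i : 'I_n -> Hom (S b) p) (q : 'I_n -> Hom p (S b)) (g : Hom x p) r,
    is_power i q /\ r \oc g = idm x.
Proof.
move=> xb xb'.
have [m [p [l [q [t [f [g [h [pw d tb _ _]]]]]]]]] := left_approximation xb.
have f0 : f = 0 by apply: (Wle_orth_Wge _ tb xb'); lia.
have [|r e] := dist_extend d (u := idm x); first by rewrite f0 compm0.
by exists m, p, l, q, g, r.
Qed.

Lemma devissage (P : T -> Prop) a b x : extension_closed P ->
  (forall j y, a <= j <= b -> Wle j y -> Wge j y -> P y) ->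
  a <= b -> Wge a x -> Wle b x -> P x.
Proof.
move=> extP PE ab; have [n] : exists n : nat, b = a + n%:Z by exists `|b - a|%N; lia.
elim: n b x PE ab => [|n IH] b x PE ab be xa xb.
  have e : b = a by lia.
  by subst b; rewrite e in PE xb; apply: (PE a) => //; lia.
have [m [p [l [q [t [f [g [h [pw d tb _ _]]]]]]]]] := left_approximation xb.
apply: (extP _ _ _ _ _ _ d); last first.
  apply: (PE b); first by lia.
    by move=> j jb; apply: power_orthl pw _; exact: (Wle_S w_le0 sphS).
  by move=> j jb; apply: power_orthr pw _; exact: (Wge_S w_le0 sphS).
apply: (IH (b - 1)) => //; last first.
- by apply: left_approximation_Wge pw d _ xa; lia.
- by lia.
- by lia.
- by move=> j y jb; apply: PE; lia.
Qed.

Lemma devissage_orthl a b x y : (forall j, a <= j <= b -> orth (S j) y) ->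
  a <= b -> Wge a x -> Wle b x -> orth x y.
Proof.
move=> o; apply: (devissage (P := fun x => orth x y)).
  by move=> x1 x2 x3 f g h d; exact: orth_extl d.
move=> j z jab zj zj'; have [n [p [i [q [g [r [pw rg]]]]]]] := heart_retract zj zj'.
by apply: orth_retractl rg _; apply: power_orthl pw _; exact: o.
Qed.

Lemma devissage_orthr a b x y : (forall j, a <= j <= b -> orth y (S j)) ->
  a <= b -> Wge a x -> Wle b x -> orth y x.
Proof.
move=> o; apply: (devissage (P := fun x => orth y x)).
  by move=> x1 x2 x3 f g h d; exact: orth_extr d.
move=> j z jab zj zj'; have [n [p [i [q [g [r [pw rg]]]]]]] := heart_retract zj zj'.
by apply: orth_retractr rg _; apply: power_orthr pw _; exact: o.
Qed.

(** The identity of [x] is a sum of maps through [S b]. If no composite [S b -> x -> S b] were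
    invertible, inserting this sum twice would write each component through two successive
    non-isomorphisms, so [x] would be zero. *)
Lemma heart_retract_sph x b : Wle b x -> Wge b x -> ~ is_zero x ->
  exists (f : Hom (S b) x) (g : Hom x (S b)), g \oc f = idm (S b).
Proof.
move=> xb xb' x0; have [n [p [i [q [G [r [[_ _ iq] rG]]]]]]] := heart_retract xb xb'.
apply: contrapT => no; apply: x0; apply/zero_idm.
have [A [B [BA idE]]] : exists (A : 'I_n -> Hom (S b) x) (B : 'I_n -> Hom x (S b)),
    (forall j l, ~ is_iso (B j \oc A l)) /\ idm x = \sum_j A j \oc B j.
  exists (fun j => r \oc i j), (fun j => q j \oc G); split.
    move=> j l [u [u1 u2]]; apply: no; exists (r \oc i l), (u \oc (q j \oc G)).
    by rewrite -compmA.
  rewrite -rG -[r in LHS]compm1 -iq comp_sumr comp_suml.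
  by apply: eq_bigr => j _; rewrite !compmA.
have B0 j : B j = 0.
  rewrite -[B j]compm1 idE comp_sumr big1 // => l _.
  rewrite -[B l]compm1 idE !comp_sumr big1 // => m _.
  by rewrite !compmA -(compmA (B j \oc A l)) (sph_comp sphS (BA l m) (BA j l)) comp0m.
by rewrite idE big1 // => j _; rewrite B0 compm0.
Qed.

(** If Hom (x, y) vanished, a map u from [S b] to [y], extended to the top layer of [x], would
    factor through the connecting map to [susp t], and then through the top layer of [susp t], since
    lower weights do not map to [y]. By minimality u is a sum of maps preceded by non-isomorphisms;
    repeating this for those maps kills u. *)
Lemma nonzero_maps x y b : Wle b x -> Wge b y -> ~ orth x (S b) -> ~ orth (S b) y ->
  ~ orth x y.
Proof.
move=> xb yb nx ny o.
have [n [p [i [q [t [f [g [h [pw d tb genG minG]]]]]]]]] := left_approximation xb.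
have stb : Wle b (susp t) by have /(Wle_susp w_le0 sphS) := tb; rewrite subrK; exact.
have [n' [p' [i' [q' [t' [f' [g' [h' [pw' d' tb' _ _]]]]]]]]] := left_approximation stb.
have n0 : (0 < n)%N.
  rewrite lt0n; apply/negP => /eqP n0; subst n.
  apply: nx => u; have [v ->] := genG u; case: pw => _ _.
  rewrite big_ord0 => p0; by rewrite -[v]compm1 -p0 compm0 comp0m.
pose o0 := Ordinal n0.
have radE (u : Hom (S b) y) : exists v e : 'I_n' -> _,
    (forall l, ~ is_iso (e l : Hom (S b) (S b))) /\
    u = \sum_l (v l : Hom (S b) y) \oc e l.
  have [|F FE] := dist_extend' d (u := u \oc q o0); first exact: o.
  have [|F' F'E] := dist_extend d' (u := F).
    by apply: (Wle_orth_Wge _ tb' yb); lia.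
  exists (fun l => F' \oc i' l), (fun l => q' l \oc g' \oc h \oc i o0); split.
    by move=> l; apply: minG; rewrite -!compmA (dist_comp0' d) !compm0.
  have [qi _ _] := pw; have [_ _ iq'] := pw'.
  rewrite -[LHS]compm1 -(qi o0) compmA FE F'E -!compmA.
  under eq_bigr => l _ do rewrite -!compmA (compmA (i' l)).
  by rewrite -comp_sumr -comp_suml iq' comp1m.
apply: ny => u; have [v [e [eP ->]]] := radE u.
rewrite big1 // => l _; have [v' [e' [e'P ->]]] := radE (v l).
rewrite comp_suml big1 // => m _.
by rewrite -compmA (sph_comp sphS (eP l) (e'P m)) compm0.
Qed.

Lemma sph_orth_Wle i c y : c < i + w -> Wle c y -> orth (S i) y.
Proof.
move=> ci yc; have [a ya] := Wge_exists w_le0 sphS genS y.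
have [ac|ca] := leP a c; last by apply: orth_zeror; exact: Wle_Wge_zero yc ya.
apply: (devissage_orthr _ ac ya yc) => j jac.
by apply: (sph_orth sphS); lia.
Qed.

(** The map X from [S (b - w)] into the top layer of [x] lifts to [x]. Its obstruction in [susp t]
    vanishes on the top layer of [susp t], where minimality produces two successive
    non-isomorphisms, and [S (b - w)] has no maps to the remaining weights below [b]. In this way
    information on maps into [x] bounds the weights of [x] from above. *)
Lemma top_socle x b : Wle b x -> ~ orth x (S b) -> ~ orth (S (b - w)) x.
Proof.
move=> xb nx o.
have [n [p [i [q [t [f [g [h [pw d tb genG minG]]]]]]]]] := left_approximation xb.
have stb : Wle b (susp t) by have /(Wle_susp w_le0 sphS) := tb; rewrite subrK; exact.
have [n' [p' [i' [q' [t' [f' [g' [h' [pw' d' tb' _ _]]]]]]]]] := left_approximation stb.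
have n0 : (0 < n)%N.
  rewrite lt0n; apply/negP => /eqP n0; subst n.
  apply: nx => u; have [v ->] := genG u; case: pw => _ _.
  rewrite big_ord0 => p0; by rewrite -[v]compm1 -p0 compm0 comp0m.
pose o0 := Ordinal n0.
have [X [Xni X0 _]] := sph_rad sphS (esym (subrK w b)).
have [qi _ _] := pw; have [_ _ iq'] := pw'.
have hX : h \oc i o0 \oc X = 0.
  have [|u ->] := dist_lift d' (u := h \oc i o0 \oc X).
    rewrite -[LHS]comp1m -iq' comp_suml big1 // => l _.
    rewrite -!compmA; have -> : q' l \oc (g' \oc (h \oc (i o0 \oc X))) =
      (q' l \oc g' \oc h \oc i o0) \oc X by rewrite !compmA.
    rewrite (sph_comp sphS Xni) ?compm0 //; apply: minG.
    by rewrite -!compmA (dist_comp0' d) !compm0.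
  have ot' : orth (S (b - w)) t' by apply: sph_orth_Wle tb'; lia.
  by rewrite (ot' u) compm0.
have [|u uE] := dist_lift' d (u := i o0 \oc X); first by rewrite compmA.
apply: X0; rewrite -[X]comp1m -(qi o0) -compmA uE (o u) !compm0 //.
Qed.

(** Copies of [S b] are split off one at a time: idempotent completeness supplies the complement,
    and the dimension of Hom (x, S b) drops. *)
Lemma heart_induction (P : T -> Prop) b : (forall x, is_zero x -> P x) ->
  (forall x y, is_biproduct (S b) x y -> P x -> P y) ->
  forall x, Wle b x -> Wge b x -> P x.
Proof.
move=> zeroP sumP x; have [m] := ubnP (dimk (Hom x (S b))).
elim: m x => // m IH y; rewrite ltnS => ym yb yb'.
have [y0|y0] := pselect (is_zero y); first exact: zeroP.
have [f [g gf]] := heart_retract_sph yb yb' y0.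
have [z bz] := retract_summand idemT gf; apply: (sumP _ _ bz).
have [i1 [i2 [p1 [p2 [h1 h2 h3 h4 h5]]]]] := bz.
apply: IH; [|exact: Wle_retract h2 yb|exact: Wge_retract h2 yb'].
apply: leq_trans ym.
apply: (@dimk_lt _ _ _ _ (precomp p2 (t := S b)) (precomp i1 (t := S b)) p1).
- exact: (fin_dim_Hom sphS genS).
- exact: (fin_dim_Hom sphS genS).
- move=> u; rewrite /= /precomp => u0.
  by rewrite -[u]compm1 -h2 compmA u0 comp0m.
- by move=> u; rewrite /= /precomp -compmA h4 compm0.
- move=> v; rewrite /= /precomp => v0; exists (v \oc i2).
  by rewrite -[v in LHS]compm1 -h5 compmDr !compmA v0 comp0m add0r.
- rewrite /= /precomp h1; apply/negP => /eqP /zero_idm.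
  exact: (sph_neq0 sphS).
Qed.

(** In contrast to [thick_induction], [P] need not pass to retracts or shifts. This is the form
    suited to additive invariants, which are controlled on triangles but not on retracts. *)
Lemma finite_extension_induction (P : T -> Prop) :
  (forall x, is_zero x -> P x) -> extension_closed P -> (forall j, P (S j)) ->
  forall x, P x.
Proof.
move=> zeroP extP PS x.
have heartP j y : Wle j y -> Wge j y -> P y.
  apply: heart_induction => // z t bz; apply: (sum_of_extension extP bz (PS j)).
have [a xa] := Wge_exists w_le0 sphS genS x.
have [b xb] := Wle_exists w_le0 sphS genS x.
have [ab|ba] := leP a b; last by apply: zeroP; exact: Wle_Wge_zero xb xa.
by apply: (devissage extP _ ab xa xb) => j y _; exact: heartP.
Qed.

End Approximations.

(** * The spherical family *)

Section DualNumbers.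
Variable k : fieldType.

Definition dual_X : dual_numbers k := in_qpoly 'X^2 'X.

Arguments dual_X : simpl never.

Lemma mk_monic_X2 : mk_monic ('X^2 : {poly k}) = 'X^2.
Proof. by rewrite /mk_monic size_polyXn monicXn. Qed.

Lemma dual_XE : dual_X = 'X :> {poly k}.
Proof. by rewrite /dual_X in_qpoly_small // mk_monic_X2 size_polyX size_polyXn. Qed.

Lemma dual_X_sqr : dual_X * dual_X = 0.
Proof.
apply/val_inj; rewrite -[LHS]/(Pdiv.CommonRing.rmodp
  ((dual_X : {poly k}) * (dual_X : {poly k})) (mk_monic 'X^2)).
rewrite dual_XE [X in Pdiv.CommonRing.rmodp _ X]mk_monic_X2 -expr2.
by rewrite Pdiv.RingMonic.rmodpp // monicXn.
Qed.

Lemma dual_coef (a : dual_numbers k) n : (1 < n)%N -> (a : {poly k})`_n = 0.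
Proof.
move=> n1; rewrite nth_default //; apply: leq_trans n1.
by have := size_mk_monic a; rewrite [X in (_ < size (polyseq X))%N]mk_monic_X2 size_polyXn.
Qed.

Lemma dual_eq (a : dual_numbers k) :
  a = (a : {poly k})`_0 *: 1 + (a : {poly k})`_1 *: dual_X.
Proof.
apply/val_inj/polyP => n /=.
rewrite coefD !coefZ -[Pdiv.CommonRing.rmodp _ _]/(polyn dual_X) dual_XE.
case: n => [|[|n]].
- by rewrite coefX mulr0 addr0 coef1 mulr1.
- by rewrite coefX mulr1 coef1 mulr0 add0r.
- by rewrite dual_coef // coefX coef1 !mulr0 addr0.
Qed.

End DualNumbers.

(** * From a spherical object to the family of its shifts *)

Section SphericalFamily.
Variables (k : fieldType) (T : triangulated_category k).
Implicit Types (x y : T).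

Lemma susp_spow_isomorphic (i : int) x :
  isomorphic (susp (spow T i x)) (spow T (i + 1) x).
Proof.
case: i => [n|[|n]].
- by rewrite -addPosz1; exact: isomorphic_refl.
- by rewrite -addNegz0_1; exact: desuspK_isomorphic.
- by rewrite -addNegz1; exact: desuspK_isomorphic.
Qed.

Definition hom_line x y : Prop :=
  exists u : Hom x y, u <> 0 /\ forall v, exists c, v = c *: u.

Definition iso_invariant (P : T -> T -> Prop) : Prop :=
  forall x x' y y', isomorphic x x' -> isomorphic y y' -> P x y -> P x' y'.

Lemma hom_line_iso : iso_invariant hom_line.
Proof.
move=> x x' y y' [a [a' [a'a aa']]] [b [b' [b'b bb']]] [u [u0 uP]].
exists (b \oc u \oc a'); split.
  move=> e; apply: u0; rewrite -[u]comp1m -b'b -[_ \oc u]compm1 -a'a.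
  have -> : b' \oc b \oc u \oc (a' \oc a) = b' \oc (b \oc u \oc a') \oc a.
    by rewrite !compmA.
  by rewrite e compm0 comp0m.
move=> v; have [c ce] := uP (b' \oc v \oc a); exists c.
rewrite -[LHS]comp1m -bb' -[_ \oc v]compm1 -aa'.
have -> : b \oc b' \oc v \oc (a \oc a') = b \oc (b' \oc v \oc a) \oc a'.
  by rewrite !compmA.
by rewrite ce compmZr compmZl.
Qed.

Lemma orth_iso_invariant : iso_invariant (@orth k T).
Proof. by move=> x x' y y' xx' yy' /(orth_isol xx')/(orth_isor yy'). Qed.

Lemma hom_line_susp x y : hom_line (susp x) (susp y) <-> hom_line x y.
Proof.
split=> [[u [u0 uP]]|[u [u0 uP]]].
  have [v ve] := susp_surj u; exists v; split.
    by move=> v0; apply: u0; rewrite -ve v0 fmap0.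
  move=> z; have [c] := uP (fmap susp z); rewrite -ve -fmapZ => /susp_inj ->.
  by exists c.
exists (fmap susp u); split.
  by move=> e; apply: u0; apply: susp_inj; rewrite e fmap0.
by move=> v; have [z <-] := susp_surj v; have [c ->] := uP z; exists c; rewrite fmapZ.
Qed.

Lemma orth_susp_iff x y : orth (susp x) (susp y) <-> orth x y.
Proof. by split=> [/susp_orth|/orth_susp]. Qed.

(* The idle second argument gives [end_dual] the type required by [shift_induction]. *)
Definition end_dual x (_ : T) : Prop :=
  exists u : Hom x x, [/\ u <> 0, u \oc u = 0
    & forall v, exists c d, v = c *: idm x + d *: u].

Lemma end_dual_iso : iso_invariant end_dual.
Proof.
move=> x x' y y' [a [a' [a'a aa']]] _ [u [u0 uu uP]].
have conj (f g : Hom x x) : a \oc f \oc a' \oc (a \oc g \oc a') = a \oc (f \oc g) \oc a'.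
  by rewrite !compmA -(compmA _ a' a) a'a compm1.
exists (a \oc u \oc a'); split.
- move=> e; apply: u0; rewrite -[u]comp1m -a'a -[_ \oc u]compm1 -a'a.
  have -> : a' \oc a \oc u \oc (a' \oc a) = a' \oc (a \oc u \oc a') \oc a.
    by rewrite !compmA.
  by rewrite e compm0 comp0m.
- by rewrite conj uu compm0 comp0m.
- move=> v; have [c [d e]] := uP (a' \oc v \oc a); exists c, d.
  rewrite -[LHS]comp1m -aa' -[_ \oc v]compm1 -aa'.
  have -> : a \oc a' \oc v \oc (a \oc a') = a \oc (a' \oc v \oc a) \oc a'.
    by rewrite !compmA.
  by rewrite e compmDr compmDl !compmZr !compmZl compm1 aa'.
Qed.

Lemma end_dual_susp x y : end_dual (susp x) (susp y) <-> end_dual x y.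
Proof.
split=> [[u [u0 uu uP]]|[u [u0 uu uP]]].
  have [v ve] := susp_surj u; exists v; split.
  - by move=> v0; apply: u0; rewrite -ve v0 fmap0.
  - by apply: susp_inj; rewrite fmap_comp ve uu fmap0.
  - move=> z; have [c [d]] := uP (fmap susp z).
    rewrite -ve -fmap1 -!fmapZ -fmapD => /susp_inj ->.
    by exists c, d.
exists (fmap susp u); split.
- by move=> e; apply: u0; apply: susp_inj; rewrite e fmap0.
- by rewrite -fmap_comp uu fmap0.
- move=> v; have [z <-] := susp_surj v; have [c [d ->]] := uP z.
  by exists c, d; rewrite fmapD !fmapZ fmap1.
Qed.

(** Reduces statements about all pairs of shifts with a fixed difference to Hom out of the object
    itself, which is what the graded endomorphism algebra describes. *)
Lemma shift_induction (P : T -> T -> Prop) (S S' : int -> T) : iso_invariant P ->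
  (forall x y, P (susp x) (susp y) <-> P x y) ->
  (forall i, isomorphic (susp (S i)) (S (i + 1))) ->
  (forall i, isomorphic (susp (S' i)) (S' (i + 1))) ->
  forall d, P (S 0) (S' d) -> forall i, P (S i) (S' (i + d)).
Proof.
move=> isoP suspP hS hS' d P0.
have up i : P (S i) (S' (i + d)) <-> P (S (i + 1)) (S' (i + 1 + d)).
  rewrite -(suspP (S i)) (addrAC i 1); split; apply: isoP => //.
    exact/isomorphic_sym.
  exact/isomorphic_sym.
case=> n; elim: n => [|n IH]; first by rewrite add0r.
- by rewrite addPosz1; apply/(up n).
- by apply/up; rewrite -addNegz0_1 add0r.
- by apply/up; rewrite -addNegz1.
Qed.

Lemma spherical_orth w (s : T) j : spherical w s -> j != 0 -> j != w ->
  orth s (spow T j s).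
Proof.
move=> [phi [inj img _ _]] j0 jw f; apply: inj; rewrite linear0.
have : dual_numbers_deg (k := k) w j (phi j f) by rewrite -img; exists f.
move=> d; apply/npolyP => n; transitivity (0 : k); last by rewrite [RHS]coef0.
have [//|nz] := eqVneq (phi j f : {poly k})`_n 0.
have := d n nz; case: n nz => [|[|n]] nz e.
- by rewrite mul0r in e; rewrite -e eqxx in j0.
- by rewrite mul1r in e; rewrite -e eqxx in jw.
- by rewrite dual_coef ?eqxx in nz.
Qed.

Lemma dual_X_neq0 : dual_X k <> 0.
Proof.
move=> e; have := dual_XE k; rewrite e => /(congr1 (fun p : {poly k} => p`_1)).
by rewrite coefX coef0 => /eqP; rewrite eq_sym oner_eq0.
Qed.

Lemma spherical_line0 w (s : T) : spherical w s -> w != 0 -> hom_line s s.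
Proof.
move=> [phi [inj img one _]] w0; exists (idm s); split.
  move=> e; have := one; rewrite e linear0 => /esym/eqP.
  by rewrite oner_eq0.
move=> v; exists (phi 0 v : {poly k})`_0; apply: (inj 0).
rewrite linearZ /= one.
have d : dual_numbers_deg (k := k) w 0 (phi 0 v) by rewrite -img; exists v.
rewrite {1}(dual_eq (phi 0 v)).
have [->|nz] := eqVneq (phi 0 v : {poly k})`_1 0; first by rewrite scale0r addr0.
by have := d 1%N nz; rewrite mul1r => e; rewrite e eqxx in w0.
Qed.

Lemma spherical_linew w (s : T) : spherical w s -> w != 0 ->
  hom_line s (spow T w s).
Proof.
move=> [phi [inj img _ _]] w0.
have [u _ uE] : range (phi w) (dual_X k).
  rewrite img => n; rewrite dual_XE coefX.
  by case: (n =P 1%N) => [->|]; rewrite ?mul1r // eqxx.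
exists u; split.
  by move=> e; apply: (@dual_X_neq0); rewrite -uE e linear0.
move=> v; exists (phi w v : {poly k})`_1; apply: inj.
rewrite linearZ /= uE.
have d : dual_numbers_deg (k := k) w w (phi w v) by rewrite -img; exists v.
rewrite {1}(dual_eq (phi w v)).
have [->|nz] := eqVneq (phi w v : {poly k})`_0 0; first by rewrite scale0r add0r.
by have := d 0%N nz; rewrite mul0r => e; rewrite -e eqxx in w0.
Qed.

Lemma spherical_dual0 (s : T) : spherical 0 s -> end_dual s s.
Proof.
move=> [phi [inj img one mul]].
have phiM (f g : Hom s s) : phi 0 (g \oc f) = phi 0 g * phi 0 f.
  have := mul 0 0 g f; rewrite /graded_mul /=.
  (* In degrees 0 and 0 the map [spowD] is a transport along a proof of 0 = 0 + 0; once that proof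
     is [erefl], [graded_mul] is plain composition. *)
  have e0 : (esym (add0r 0) : (0 : int) = 0 + 0) = erefl by exact: eq_irrelevance.
  by rewrite e0 /= comp1m.
have [u _ uE] : range (phi 0) (dual_X k).
  by rewrite img => n _; rewrite mulr0.
exists u; split.
- by move=> e; apply: (@dual_X_neq0); rewrite -uE e linear0.
- by apply: (inj 0); rewrite phiM uE dual_X_sqr linear0.
- move=> v; exists (phi 0 v : {poly k})`_0, (phi 0 v : {poly k})`_1.
  by apply: (inj 0); rewrite linearD !linearZ /= one uE {1}(dual_eq (phi 0 v)).
Qed.

(** The cases differ in how a non-isomorphism is recognised. For w = 0 it is an endomorphism with
    zero scalar part, hence a multiple of a square-zero map. For w < 0 the endomorphisms are
    scalars, and a nonzero non-isomorphism has to change the shift by w. *)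
Theorem spherical_family_spow w (s : T) : w <= 0 -> spherical w s ->
  spherical_family w (fun i => spow T i s).
Proof.
move=> w_le0 sph; pose S i := spow T i s; rewrite -/S.
have hS i : isomorphic (susp (S i)) (S (i + 1)) by exact: susp_spow_isomorphic.
have SO i j : j != i -> j != i + w -> orth (S i) (S j).
  move=> ji jw; have -> : j = i + (j - i) by rewrite addrC subrK.
  apply: (shift_induction orth_iso_invariant orth_susp_iff hS hS).
  by apply: (spherical_orth sph); apply/negP => /eqP e; move: ji jw; lia.
have [w0|w0] := eqVneq w 0.
- subst w.
  have SD i : end_dual (S i) (S i).
    rewrite -[X in end_dual _ (S X)]addr0.
    apply: (shift_induction end_dual_iso end_dual_susp hS hS).
    exact: spherical_dual0.
  have SN i : ~ is_zero (S i).
    by move=> z; have [u [u0 _ _]] := SD i; apply: u0; have [] := z (S i).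
  have neq i j (f : Hom (S i) (S j)) : j != i -> f = 0.
    by move=> ji; apply: SO; rewrite ?addr0.
  have isoeq i j (f : Hom (S i) (S j)) : is_iso f -> i = j.
    move=> [g [gf _]]; apply/eqP; rewrite eq_sym; apply/negPn/negP => ji.
    by apply: (SN i); apply/zero_idm; rewrite -gf (neq _ _ f ji) compm0.
  (* If c is nonzero, c + d u is invertible with inverse 1/c - (d/c^2) u, because u has square
     zero. *)
  have nilS i (u f : Hom (S i) (S i)) c d : u <> 0 -> u \oc u = 0 ->
      f = c *: idm (S i) + d *: u -> ~ is_iso f -> c = 0.
    move=> u0 uu -> ni; apply/eqP/negP => /negP c0; apply: ni.
    have mulE c1 d1 c2 d2 : (c1 *: idm (S i) + d1 *: u) \oc (c2 *: idm (S i) + d2 *: u)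
        = (c1 * c2) *: idm (S i) + (c1 * d2 + d1 * c2) *: u.
      rewrite compmDl !compmDr !compmZl !compmZr !comp1m compm1 uu !scaler0 addr0.
      by rewrite !scalerA -addrA -scalerDl.
    exists (c^-1 *: idm (S i) + (- (d / c ^+ 2)) *: u); rewrite !mulE.
    rewrite mulVf // mulfV // scale1r.
    have -> : c^-1 * d + - (d / c ^+ 2) * c = 0 by field.
    have -> : c * - (d / c ^+ 2) + d / c = 0 by field.
    by rewrite !scale0r addr0.
  split=> //.
  + move=> i j l f g nf ng.
    have [ji|ji] := eqVneq j i; last by rewrite (neq _ _ f ji) compm0.
    have [lj|lj] := eqVneq l j; last by rewrite (neq _ _ g lj) comp0m.
    subst j; subst l; have [u [u0 uu uP]] := SD i.
    have [c [d fE]] := uP f; have [c' [d' gE]] := uP g.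
    have c0 := nilS _ _ _ _ _ u0 uu fE nf; have c0' := nilS _ _ _ _ _ u0 uu gE ng.
    by rewrite fE gE c0 c0' !scale0r !add0r compmZl compmZr uu !scaler0.
  + by move=> i j f _; rewrite addr0; exact: neq.
  + move=> i j; rewrite addr0 => ->; have [u [u0 uu uP]] := SD i.
    exists u; split=> //.
      move=> [v [vu _]]; apply: u0.
      by rewrite -[u]comp1m -vu -compmA uu compm0.
    move=> y ny; have [c [d yE]] := uP y.
    by exists d; rewrite {1}yE (nilS _ _ _ _ _ u0 uu yE ny) scale0r add0r.
  + move=> i f; have [u [u0 uu uP]] := SD i; have [c [d fE]] := uP f.
    exists c; rewrite fE addrC addKr => -[v [vu _]]; apply: u0.
    by rewrite -[u]comp1m -vu -compmA compmZl uu scaler0 compm0.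
- have SL i : hom_line (S i) (S i).
    rewrite -[X in hom_line _ (S X)]addr0.
    apply: (shift_induction (@hom_line_iso) hom_line_susp hS hS).
    exact: spherical_line0 sph w0.
  have SX i : hom_line (S i) (S (i + w)).
    apply: (shift_induction (@hom_line_iso) hom_line_susp hS hS).
    exact: spherical_linew sph w0.
  have SN i : ~ is_zero (S i).
    by move=> z; have [u [u0 _]] := SL i; apply: u0; have [] := z (S i).
  have SE i (f : Hom (S i) (S i)) : exists c, f = c *: idm (S i).
    have [u [u0 uP]] := SL i; have [c ce] := uP (idm (S i)); have [d ->] := uP f.
    exists (d / c); rewrite ce scalerA divfK //.
    apply/negP => /eqP c0; apply: (SN i); apply/zero_idm.
    by rewrite ce c0 scale0r.
  have isoeq i j (f : Hom (S i) (S j)) : is_iso f -> i = j.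
    move=> [g [gf _]]; apply/eqP; rewrite eq_sym; apply/negPn/negP => ji.
    apply: (SN i); apply/zero_idm; rewrite -gf.
    have [jw|jw] := eqVneq j (i + w); last by rewrite [f]SO // compm0.
    by rewrite [g]SO ?comp0m //; apply/negP => /eqP e; move: ji; lia.
  have Sdeg i j (f : Hom (S i) (S j)) : ~ is_iso f -> j != i + w -> f = 0.
    move=> nf jw; have [ji|ji] := eqVneq j i; last exact: SO.
    subst j; have [c fE] := SE i f.
    have [c0|c0] := eqVneq c 0; first by rewrite fE c0 scale0r.
    case: nf; exists (c^-1 *: idm (S i)).
    by rewrite fE !compmZl !compmZr comp1m !scalerA mulVf // mulfV // scale1r.
  split=> //.
  + move=> i j l f g nf ng.
    have [jw|/(Sdeg _ _ _ nf) ->] := eqVneq j (i + w); last by rewrite compm0.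
    have [lw|/(Sdeg _ _ _ ng) ->] := eqVneq l (j + w); last by rewrite comp0m.
    by apply: SO; apply/negP => /eqP; lia.
  + move=> i j ->; have [u [u0 uP]] := SX i; exists u.
    by split=> // /isoeq; lia.
  + move=> i f; have [c ->] := SE i f; exists c; rewrite subrr => -[v [v0 _]].
    by apply: (SN i); apply/zero_idm; rewrite -v0 compm0.
Qed.

End SphericalFamily.

(** * Strings *)

Section Strings.
Variables (k : fieldType) (T : triangulated_category k) (w : int) (S : int -> T).
Hypotheses (w_le0 : w <= 0) (sphS : spherical_family w S).

(* The strings are the truncations of the minimal resolution of the simple
   module of k[X]/(X^2): the next string is the fibre of [str_xi], which
   continues the string by one more copy of X. *)
Record string := String {
  str_deg : int;
  str_obj : T;
  str_xi : Hom str_obj (S str_deg);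
  str_rho : Hom str_obj (S 0)
}.

(** The invariants that close the induction in [string_step]. [str_rad] and [str_lift] express
    minimality and exactness at the end of the string. By [str_socle0] and [str_socle], the maps
    from shifts that are killed by [str_xi] form a single line, in degree -w, as for the simple
    module. [str_rho_xi] keeps the map to the top nonzero on the next string. *)
Record string_axioms (r : string) : Prop := StringAxioms {
  str_deg_le : str_deg r <= w;
  str_rad : forall l (x : Hom (S (str_deg r)) (S l)),
    ~ is_iso x -> x \oc str_xi r = 0;
  str_low : forall i, i < str_deg r -> orth (str_obj r) (S i);
  str_socle0 : forall i (h : Hom (S i) (str_obj r)),
    i != - w -> str_xi r \oc h = 0 -> h = 0;
  str_socle : exists c : Hom (S (- w)) (str_obj r), [/\ c <> 0, str_xi r \oc c = 0 &
    forall h, str_xi r \oc h = 0 -> exists a, h = a *: c];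
  str_lift : forall i (x : Hom (S i) (S (str_deg r))),
    ~ is_iso x -> exists h, x = str_xi r \oc h;
  str_high : forall i, 0 < i -> orth (str_obj r) (S i);
  str_top : forall h : Hom (str_obj r) (S 0), exists d, h = d \oc str_rho r;
  str_rho_neq0 : str_rho r <> 0;
  str_rho_xi : forall c, str_rho r <> c \oc str_xi r
}.

Lemma comp_iso_eq0 x y z (f : Hom x y) (g : Hom y z : lmodType k) :
  @is_iso k T x y f -> g \oc f = 0 -> g = 0.
Proof.
by move=> [h [_ fh]] e; rewrite -[g]compm1 -fh compmA e comp0m.
Qed.

(** The last clause prepares the vanishing of non-isomorphisms after [str_rho]. This fails for the
    one-term string, where [str_rho] is the identity, but holds from the next string on. *)
Lemma string0_exists : exists r : string, [/\ string_axioms r, str_deg r = w &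
  forall l (x : Hom (S 0) (S l)) p (pi : Hom p (str_obj r)),
    ~ is_iso x -> str_xi r \oc pi = 0 -> x \oc (str_rho r \oc pi) = 0].
Proof.
have [X [Xni X0 XP]] := sph_rad sphS (esym (add0r w)).
pose r := @String w (S 0) X (idm (S 0)).
have noniso i (h : Hom (S i) (S 0)) : X \oc h = 0 -> ~ is_iso h.
  by move=> e hi; apply: X0; exact: comp_iso_eq0 hi e.
exists r; split=> //; last first.
  move=> l x p pi; rewrite /= => nx xpi; rewrite comp1m.
  have [lw|lw] := eqVneq l (0 + w).
    have {lw} e : l = w by lia.
    by subst l; have [c ->] := XP x nx; rewrite compmZl xpi scaler0.
  by rewrite (sph_deg sphS nx lw) comp0m.
split=> //=.
- by move=> l x; exact: (sph_comp sphS Xni).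
- by move=> i iw; apply: (sph_orth sphS); lia.
- move=> i h iw /noniso nh; apply: (sph_deg sphS nh); apply/negP => /eqP e.
  by move: iw; lia.
- have [c [cni c0 cP]] := sph_rad sphS (esym (addNr w)).
  exists c; split=> //; first exact: (sph_comp sphS).
  by move=> h /noniso; exact: cP.
- move=> i x nx; have [i0|i0] := eqVneq i 0.
    by subst i; have [c ->] := XP x nx; exists (c *: idm (S 0)); rewrite compmZr compm1.
  exists 0; rewrite compm0; apply: (sph_deg sphS nx); apply/negP => /eqP e.
  by move: i0; lia.
- by move=> i i0; apply: (sph_orth_gt w_le0 sphS).
- by move=> h; exists h; rewrite compm1.
- by move/zero_idm; exact: (sph_neq0 sphS).
- move=> c e; have [ci|nc] := pselect (is_iso c).
    apply: Xni; have [d [dc cd]] := ci; exists c; split=> //.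
    by rewrite -[X in X \oc c]comp1m -dc -compmA -e compm1 dc.
  apply: (sph_neq0 sphS (i := 0)); apply/zero_idm.
  by rewrite e (sph_comp sphS Xni nc).
Qed.

Definition next_string (r r' : string) : Prop :=
  str_deg r' = str_deg r - 1 + w /\
  exists (pi : Hom (str_obj r') (str_obj r)) h,
    dist pi (str_xi r) h /\ str_rho r' = str_rho r \oc pi.

Lemma string_step r : string_axioms r ->
  exists r', string_axioms r' /\ next_string r r'.
Proof.
case: r => e r xi rho [/= ew rad low soc0 [chi [chi0 xichi chiP]] lift high top rho0 rhoxi].
have [r' [pi [h d]]] := fiber_exists xi.
have [al [be [beal albe]]] := sph_susp_pred sphS e.
(* The desuspended connecting map: the copy of [S (e - 1)] added at the bottom of the string. *)
have [io ioE] := susp_surj (h \oc al).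
have hE : h = fmap susp io \oc be by rewrite ioE -compmA albe compm1.
have L1 t (u : Hom t r') : pi \oc u = 0 -> exists v, u = io \oc v.
  move=> pu; have [|v vE] := dist_lift' (dist_rot d) (u := fmap susp u).
    by rewrite compNm -fmap_comp pu fmap0 oppr0.
  have [v' v'E] := susp_surj (be \oc v); exists v'; apply: susp_inj.
  by rewrite vE fmap_comp v'E hE -compmA.
have L2 t (u : Hom r' t) : u \oc io = 0 -> exists v, u = v \oc pi.
  move=> ui; apply: (dist_extend'' d).
  by rewrite hE compmA -fmap_comp ui fmap0 comp0m.
have [X [Xni X0 XP]] := sph_rad sphS (erefl (e - 1 + w)).
(* X on the new bottom copy extends to the whole fibre: the obstruction is the suspended X after
   [xi], a non-isomorphism after [xi], which vanishes by [rad]. *)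
have [xi' xi'E] : exists xi', X = xi' \oc io.
  have [|v vE] := dist_extend' d (u := fmap susp X \oc be).
    have [th [th' [th'th thth']]] := sph_susp sphS (e - 1 + w).
    rewrite -[_ \oc xi]comp1m -th'th -compmA (compmA th).
    rewrite (rad _ (th \oc (fmap susp X \oc be))) ?compm0 //.
    move=> hi; apply: Xni; apply: susp_iso_reflect.
    have -> : fmap susp X = th' \oc (th \oc (fmap susp X \oc be)) \oc al.
      by rewrite compmA th'th comp1m -compmA beal compm1.
    apply: iso_comp; last by exists be.
    by apply: iso_comp hi; exists th.
  have [y yE] := susp_surj v; exists y; apply: susp_inj.
  by rewrite fmap_comp yE ioE compmA -vE -compmA beal compm1.
(* Such a map comes from some [v] into the bottom copy that is killed by X, hence is no isomorphism.
   The suspension of [v] lifts through [xi], and the connecting map [h] kills [xi]. *)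
have K i (u : Hom (S i) r') : pi \oc u = 0 -> xi' \oc u = 0 -> u = 0.
  move=> /L1[v ->]; rewrite compmA -xi'E => Xv.
  have nv : ~ is_iso v by move=> vi; apply: X0; exact: comp_iso_eq0 vi Xv.
  have [th [th' [th'th thth']]] := sph_susp sphS i.
  have [|u' u'E] := lift _ (al \oc fmap susp v \oc th').
    move=> hi; apply: nv; apply: susp_iso_reflect.
    have -> : fmap susp v = be \oc (al \oc fmap susp v \oc th') \oc th.
      by rewrite -!compmA th'th compm1 compmA beal comp1m.
    apply: iso_comp; last by exists th'.
    by apply: iso_comp hi; exists al.
  apply: susp_inj; rewrite fmap0 fmap_comp ioE -compmA.
  have -> : al \oc fmap susp v = xi \oc u' \oc th by rewrite -u'E -compmA th'th compm1.
  by rewrite !compmA (dist_comp0' d) !comp0m.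
have rho'0 : rho \oc pi <> 0.
  by move=> /(dist_extend d)[c]; exact: rhoxi.
have rad' l (x : Hom (S (e - 1 + w)) (S l)) : ~ is_iso x -> x \oc xi' = 0.
  move=> nx; have [lw|lw] := eqVneq l (e - 1 + w + w); last first.
    by rewrite (sph_deg sphS nx lw) comp0m.
  have [|v ->] := L2 _ (x \oc xi'); first by rewrite -compmA -xi'E (sph_comp sphS).
  by rewrite (low l _ v) ?comp0m //; lia.
exists (@String (e - 1 + w) r' xi' (rho \oc pi)); split; last first.
  by split=> //=; exists pi, h.
split=> //=.
- by lia.
- move=> i ie u; have [|v ->] := L2 _ u.
    by have o : orth (S (e - 1)) (S i) by [apply: (sph_orth sphS); lia]; exact: o.
  by rewrite (low i _ v) ?comp0m //; lia.
- move=> i u iw xu; apply: K => //; apply: soc0 => //.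
  by rewrite compmA (dist_comp0 d) comp0m.
- have [chi' chi'E] := dist_lift d xichi; exists chi'.
  have xc : xi' \oc chi' = 0.
    by have o : orth (S (- w)) (S (e - 1 + w)) by [apply: (sph_orth sphS); lia]; exact: o.
  split=> //; first by move=> c0; apply: chi0; rewrite chi'E c0 compm0.
  move=> u xu; have [|a aE] := chiP (pi \oc u).
    by rewrite compmA (dist_comp0 d) comp0m.
  exists a; apply/eqP; rewrite -subr_eq0; apply/eqP; apply: K.
    by rewrite compmBr aE compmZr -chi'E subrr.
  by rewrite compmBr xu compmZr xc scaler0 subr0.
- move=> i x nx; have [ie|ie] := eqVneq i (e - 1).
    subst i; have [c ->] := XP x nx; exists (c *: io).
    by rewrite compmZr -xi'E.
  exists 0; rewrite compm0; apply: (sph_deg sphS nx); apply/negP => /eqP ie'.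
  by move: ie; lia.
- move=> i i0 u; have [|v ->] := L2 _ u.
    by have o : orth (S (e - 1)) (S i) by [apply: (sph_orth_gt w_le0 sphS); lia]; exact: o.
  by rewrite (high i i0 v) comp0m.
- move=> u; have [|v ->] := L2 _ u.
    by have o : orth (S (e - 1)) (S 0) by [apply: (sph_orth_gt w_le0 sphS); lia]; exact: o.
  by have [d' ->] := top v; exists d'; rewrite compmA.
- move=> c cE; apply: rho'0; rewrite cE; apply: rad'.
  by move=> /(sph_iso sphS); lia.
Qed.

Lemma string_sequence : exists r : nat -> string, [/\ forall n, string_axioms (r n),
  forall n, next_string (r n) (r n.+1), forall n, str_deg (r n) = w - n%:Z * (1 - w)
  & forall n l (x : Hom (S 0) (S l)), (0 < n)%N -> ~ is_iso x ->
      x \oc str_rho (r n) = 0].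
Proof.
have [r0 [r0P r0w r0X]] := string0_exists.
have /choice[nxt nxtP] : forall r : {r | string_axioms r}, exists r' : {r | string_axioms r},
    next_string (sval r) (sval r').
  by move=> [r rP]; have [r' [r'P n]] := string_step rP; exists (exist _ r' r'P).
pose f n := iter n nxt (exist _ r0 r0P); exists (fun n => sval (f n)).
have fS n : next_string (sval (f n)) (sval (f n.+1)) by exact: nxtP.
split=> //; first by move=> n; case: (f n).
  elim=> [|n IH]; first by rewrite r0w mul0r subr0.
  by have [-> _] := fS n; rewrite IH; lia.
move=> [|n] // l x _ nx; elim: n => [|n IH].
  have [_ [pi [h [d ->]]]] := fS 0%N; apply: r0X => //.
  exact: dist_comp0 d.
have [_ [pi [h [d ->]]]] := fS n.+1.
by rewrite compmA IH comp0m.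
Qed.

(** Maps detected by [str_xi] sit in degrees at most [str_deg r - w]. Along the sequence of strings
    this bound tends to minus infinity, and only the class in degree -w stays. *)
Lemma string_orth r i : string_axioms r -> str_deg r - w < i -> i != - w ->
  orth (S i) (str_obj r).
Proof.
move=> rP ir iw h; apply: (str_socle0 rP) => //.
have o : orth (S i) (S (str_deg r)) by apply: (sph_orth sphS); lia.
exact: o.
Qed.

End Strings.

(** * Slicings *)

Section Filtrations.
Variables (k : fieldType) (T : triangulated_category k) (n : nat).
Variables (c : nat -> T) (a : forall i, Hom (c i) (c i.+1)) (q : nat -> T).
Hypothesis c0 : is_zero (c 0).
Hypothesis cq : forall i, (i < n)%N ->
  exists (b : Hom (c i.+1) (q i)) (d : Hom (q i) (susp (c i))), dist (a i) b d.

Lemma filtration_orthr x m : (m <= n)%N -> (forall i, (i < m)%N -> orth x (q i)) ->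
  orth x (c m).
Proof.
elim: m => [|m IH] mn h; first exact: orth_zeror.
have [b [d D]] := cq mn; apply: orth_extr D _ (h m (ltnSn m)).
by apply: IH => [|i im]; [exact: ltnW|apply: h; exact: ltnW].
Qed.

Lemma filtration_orthl x m : (m <= n)%N -> (forall i, (i < m)%N -> orth (q i) x) ->
  orth (c m) x.
Proof.
elim: m => [|m IH] mn h; first exact: orth_zerol.
have [b [d D]] := cq mn; apply: orth_extl D _ (h m (ltnSn m)).
by apply: IH => [|i im]; [exact: ltnW|apply: h; exact: ltnW].
Qed.

End Filtrations.

Lemma finite_bound (R : realType) (f : nat -> R) n :
  exists C, forall i, (i < n)%N -> `|f i| <= C.
Proof.
exists (\sum_(i < n) `|f i|) => i lt_in.
by rewrite (bigD1 (Ordinal lt_in)) //= lerDl sumr_ge0.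
Qed.

(** * Non-existence of slicings *)

Section NoSlicing.
Variables (R : realType) (k : fieldType) (T : triangulated_category k).
Variables (w : int) (S : int -> T).
Hypotheses (w_le0 : w <= 0) (sphS : spherical_family w S).
Hypotheses (genS : classically_generated (S 0)).
Variable P : R -> set T.
Hypothesis slP : slicing P.

Lemma slicing_susp r x : P r x -> P (r + 1) (susp x).
Proof.
have [_ sP _ _] := slP => rx; apply/sP; exists x; split=> //.
exact: isomorphic_refl.
Qed.

(** [C] bounds the phases of the factors of [S 0]; suspension moves the bound to every [S i]. *)
Lemma slicing_bound : exists C : R, forall (i : int) r x, P r x ->
  (i%:~R + C < r -> orth x (S i)) /\ (r < i%:~R - C -> orth (S i) x).
Proof.
have [isoP sP oP fP] := slP.
have [n [c [a [q [ph [n0 c0 cn cq dec]]]]]] := fP _ (@sph_neq0 _ _ _ _ sphS 0).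
have [C CP] := finite_bound ph n; exists C.
have cq' i : (i < n)%N -> exists (b : Hom (c i.+1) (q i)) (d : Hom (q i) (susp (c i))),
  dist (a i) b d by move=> /cq[].
have base r x : P r x ->
    ((0 : int)%:~R + C < r -> orth x (S 0)) /\ (r < (0 : int)%:~R - C -> orth (S 0) x).
  move=> rx; split=> h.
    apply: orth_isor cn _; apply: (filtration_orthr c0 cq') => // i lt_in.
    have [qi _] := cq i lt_in; apply: oP rx qi; rewrite add0r in h.
    by apply: le_lt_trans h; apply: le_trans (CP i lt_in); exact: ler_norm.
  apply: orth_isol cn _; apply: (filtration_orthl c0 cq') => // i lt_in.
  have [qi _] := cq i lt_in; apply: oP qi rx; rewrite sub0r in h.
  apply: lt_le_trans h _; rewrite lerNl.
  by apply: le_trans (CP i lt_in); rewrite -normrN; exact: ler_norm.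
have up (i : int) : (forall r x, P r x -> (i%:~R + C < r -> orth x (S i)) /\
      (r < i%:~R - C -> orth (S i) x)) <->
    (forall r x, P r x -> ((i + 1)%:~R + C < r -> orth x (S (i + 1))) /\
      (r < (i + 1)%:~R - C -> orth (S (i + 1)) x)).
  split=> h r x rx.
    have /sP[y [ry yx]] : P (r - 1 + 1) x by rewrite subrK.
    have [h1 h2] := h _ _ ry; rewrite intrD; split=> rC.
      apply: orth_isol yx _; apply: orth_isor (sph_susp sphS i) _.
      by apply/orth_susp/h1; lra.
    apply: orth_isor yx _; apply: orth_isol (sph_susp sphS i) _.
    by apply/orth_susp/h2; lra.
  have [h1 h2] := h _ _ (slicing_susp rx); move: h1 h2; rewrite intrD => h1 h2.
  have hS := isomorphic_sym (sph_susp sphS i).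
  split=> rC; apply: susp_orth.
    by apply: orth_isor hS _; apply: h1; lra.
  by apply: orth_isol hS _; apply: h2; lra.
case=> m; elim: m => [|m IH]; [exact: base| | |].
- by rewrite addPosz1; exact: (up m).1 IH.
- by apply: (up (Negz 0)).2; rewrite -addNegz0_1.
- by apply: (up (Negz m.+1)).2; rewrite -addNegz1.
Qed.

Lemma slicing_false : False.
Proof.
have [isoP sP oP fP] := slP.
have [C CP] := slicing_bound.
(* Were [S b] with b >= i a top of [x], [top_socle] would give a nonzero map from [S (b - w)] to
   [x], excluded by the bound [C]. The highest weight thus descends until it is below [i]. *)
have topP i r x : P r x -> r < i%:~R - C - w%:~R -> orth x (S i).
  move=> rx ri.
  have [b bP] := Wle_exists w_le0 sphS genS x.
  have [n] : exists n : nat, b < i + n%:Z by exists `|b - i|.+1%N; lia.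
  elim: n b bP => [|n IH] b bP bin; first by apply: bP; lia.
  have [bi|ib] := ltP b i; first exact: bP.
  have ob : orth x (S b).
    apply: contrapT => nb; apply: (top_socle w_le0 sphS genS bP nb).
    have [_ h] := CP (b - w) _ _ rx; apply: h; rewrite intrB.
    have : (i%:~R : R) <= b%:~R by rewrite ler_int.
    by move: ri; lra.
  apply: (IH (b - 1)); last by lia.
  move=> j jb; have [e|jb'] := eqVneq j b; first by rewrite e.
  by apply: bP; lia.
(* The threshold of [topP] at i = 0: objects of smaller phase have negative weights only. *)
pose th := - C - w%:~R.
have topP' i r x : 0 <= i -> P r x -> r < th -> orth x (S i).
  move=> i0 rx rth; apply: topP rx _.
  have : (0 : R) <= i%:~R by rewrite ler0z.
  by move: rth; rewrite /th; lra.
have [r [rP rN rE rX]] := string_sequence w_le0 sphS.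
(* From [m0] on, objects of phase at least [th] have no map to the target of [str_xi], so they do
   not see the obstruction to passing to the next string. *)
have [m0 m0P] : exists m0 : nat, forall m, (m0 <= m)%N ->
    (str_deg (r m))%:~R + C < th.
  have [m0 m0P] : exists m0 : nat, C - th < m0%:R.
    by exists (Num.bound `|C - th|); apply: le_lt_trans (ler_norm _) (archi_boundP _).
  exists m0 => m mm; rewrite rE.
  have : ((w - m%:Z * (1 - w))%:~R : R) <= (- m%:Z)%:~R by rewrite ler_int; nia.
  have : (m0%:R : R) <= m%:R by rewrite ler_nat.
  by move: m0P; rewrite intrN; lra.
have r0 : ~ is_zero (str_obj (r m0)).
  by move=> z; apply: (str_rho_neq0 (rP m0)); exact: orth_zerol.
have [n [c [a [q [ph [n0 c0 cn cq dec]]]]]] := fP _ r0.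
have cq' i : (i < n)%N -> exists (b : Hom (c i.+1) (q i)) (d : Hom (q i) (susp (c i))),
  dist (a i) b d by move=> /cq[].
(* [L] is the part of the filtration with phases at least [th]. The factors cut off have negative
   weights, so Hom into [S l] with l >= 0 does not change. *)
have cutP m : (m <= n)%N -> exists L (u : Hom L (c m)),
  [/\ forall l, (m0 <= l)%N -> orth L (S (str_deg (r l))),
      forall l, 0 <= l -> forall h : Hom L (S l), exists v, h = v \oc u
    & forall l, 0 <= l -> forall v : Hom (c m) (S l), v \oc u = 0 -> v = 0].
  elim: m => [|m IH] mn.
    exists (c 0), (idm _); split.
    - by move=> l _; exact: orth_zerol.
    - by move=> l _ h; exists h; rewrite compm1.
    - by move=> l _ v; rewrite compm1.
  have [thm|mth] := leP th (ph m).
    exists (c m.+1), (idm _); split.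
    - move=> l ml; apply: (filtration_orthl c0 cq') => // j jm.
      have [qj _] := cq j (leq_trans jm mn).
      have [h _] := CP (str_deg (r l)) _ _ qj; apply: h.
      apply: lt_le_trans (m0P l ml) _; apply: le_trans thm _.
      have [->//|jm'] := eqVneq j m.
      by apply/ltW/dec; rewrite mn andbT ltn_neqAle jm' -ltnS.
    - by move=> l _ h; exists h; rewrite compm1.
    - by move=> l _ v; rewrite compm1.
  have [L [u [oL uS uI]]] := IH (ltnW mn).
  have [qm [b [d D]]] := cq m mn.
  exists L, (a m \oc u); split=> //.
  - move=> l l0 h; have [v ->] := uS l l0 h.
    have [|v' ->] := dist_extend'' D (u := v).
      have o : orth (q m) (S (l + 1)) by apply: (topP' _ _ _ _ qm mth); lia.
      exact: (orth_isor (isomorphic_sym (sph_susp sphS l)) o).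
    by exists v'; rewrite compmA.
  - move=> l l0 v; rewrite compmA => /(uI l l0).
    move=> /(dist_extend D)[v' ->].
    have o : orth (q m) (S l) by apply: (topP' _ _ _ l0 qm mth).
    by rewrite (o v') comp0m.
have [L [u0 [oL uS uI]]] := cutP n (leqnn n).
have [al [be [beal albe]]] := cn.
pose u := al \oc u0; pose g := str_rho (r m0) \oc u.
have g0 : g <> 0.
  rewrite /g /u compmA => /(uI 0 (lexx _)) e; apply: (str_rho_neq0 (rP m0)).
  by rewrite -[LHS]compm1 -albe compmA e comp0m.
have gS (h : Hom L (S 0)) : exists d, h = d \oc g.
  have [v ->] := uS 0 (lexx _) h; have [d dE] := str_top (rP m0) (v \oc be).
  exists d; rewrite /g /u !compmA -dE -(compmA v) beal compm1 //.
have Lle l : 0 < l -> orth L (S l).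
  move=> l0 h; have [v ->] := uS l (ltW l0) h.
  have e : v \oc be = 0 by exact: (str_high (rP m0) l0).
  by rewrite -[v]compm1 -beal compmA e !comp0m.
(* The obstruction to lifting along [pi] is a map from [L] to the target of [str_xi], which is zero
   by the choice of [m0]. *)
have lift m : (m0 <= m)%N -> exists um : Hom L (str_obj (r m)),
    str_rho (r m) \oc um = g.
  move=> /subnKC <-; elim: (m - m0)%N => [|d [um umE]].
    by rewrite addn0; exists u.
  rewrite addnS; have [_ [pi [h [D rhoE]]]] := rN (m0 + d)%N.
  have [um' um'E] := dist_lift D (oL _ (leq_addr d m0) (str_xi (r (m0 + d)%N) \oc um)).
  by exists um'; rewrite rhoE -compmA -um'E.
have [L1 [f [h D]]] := fiber_exists g.
have L1le : Wle S (- 1) L1.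
  move=> i i1 v; have [|v' ->] := dist_extend'' D (u := v).
    have o : orth (S 0) (S (i + 1)) by apply: (sph_orth_gt w_le0 sphS); lia.
    exact: (orth_isor (isomorphic_sym (sph_susp sphS i)) o).
  have [i0|i0] := eqVneq i 0.
    by subst i; have [d ->] := gS v'; rewrite -compmA (dist_comp0 D) compm0.
  by rewrite (Lle i _ v') ?comp0m //; lia.
have [b bP] := Wge_exists w_le0 sphS genS L1.
(* The length exceeds the depth of the weights of [L1], which lie between [b] and -1, so that [L1]
   has no map to this string. The successor also makes [m] positive, as [rX] requires. *)
pose m := maxn m0 `|b|.+1.
have oL1 : orth L1 (str_obj (r m)).
  have [b1|b1] := leP b (- 1); last first.
    by apply: orth_zerol; exact: (Wle_Wge_zero w_le0 sphS genS b1 L1le bP).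
  apply: (devissage_orthl w_le0 sphS genS _ b1 bP L1le) => j jb.
  apply: (string_orth w_le0 sphS (rP m)); last by lia.
  have bm : - b < m%:Z by rewrite /m; lia.
  by rewrite rE; nia.
have [um umE] := lift m (leq_maxl _ _).
have [ka kaE] := dist_extend D (oL1 (um \oc f)).
have [X [Xni X0 _]] := sph_rad sphS (erefl (0 + w)).
(* The lift of [g] to the long string factors through [g], hence [g] = [e] [g]. As X vanishes after
   the top map of the string, [e] is no isomorphism, so its square is zero and [g] vanishes. *)
pose e := str_rho (r m) \oc ka.
have m_gt0 : (0 < m)%N by rewrite leq_max orbT.
have ne : ~ is_iso e.
  move=> ie; apply: X0; apply: (comp_iso_eq0 ie).
  by rewrite /e compmA (rX m _ X m_gt0 Xni) comp0m.
apply: g0; have ge : g = e \oc g by rewrite /e -compmA -kaE umE.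
by rewrite ge ge compmA (sph_comp sphS ne ne) comp0m.
Qed.

End NoSlicing.

(** * The Grothendieck group *)

Section GrothendieckGroupTheory.
Variables (k : fieldType) (T : triangulated_category k).
Implicit Types x y z : T.

Lemma K0_dist x y z (f : Hom x y) (g : Hom y z) (h : Hom z (susp x)) :
  dist f g h -> K0_class y = K0_class x + K0_class z.
Proof.
move=> d; have r : generator y - (generator x + generator z)
    \in (triangle_relations (T := T)).
  by apply/asboolP => H _ HR; rewrite opprD addrA; exact: HR d.
by rewrite /K0_class -raddfD; apply/eqP; rewrite -Quotient.idealrBE.
Qed.

Lemma K0_zero x : is_zero x -> K0_class x = 0.
Proof.
move=> x0; have := K0_dist (tr1_id (tr_axioms T) x x0).
by rewrite -[LHS]addr0 => /addrI/esym.
Qed.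

Lemma K0_iso x y : isomorphic x y -> K0_class x = K0_class y.
Proof.
move=> xy; have [z0 z0P] := zero_exists T.
have [f [g d]] := dist_iso2 (tr1_id (tr_axioms T) x z0P) xy.
by rewrite (K0_dist d) (K0_zero z0P) addr0.
Qed.

Lemma K0_susp x : K0_class (susp x) = - K0_class x.
Proof.
have [z0 z0P] := zero_exists T.
have := K0_dist (dist_rot (tr1_id (tr_axioms T) x z0P)).
by rewrite (K0_zero z0P) => /esym/eqP; rewrite addrC addr_eq0 => /eqP.
Qed.

Lemma K0_biproduct x y s : is_biproduct x y s ->
  K0_class s = K0_class x + K0_class y.
Proof.
move=> [i1 [i2 [p1 [p2 [h1 h2 _ h4 h5]]]]].
exact: K0_dist (biproduct_dist h1 h2 h4 h5).
Qed.

Lemma K0_ext (V : zmodType) (F G : {additive K0 T -> V}) :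
  (forall x, F (K0_class x) = G (K0_class x)) -> F =1 G.
Proof.
move=> FG u; rewrite -[u]reprK; set D := repr u.
rewrite -[D]freeg_sumE !raddf_sum; apply: eq_bigr => x _.
have -> : << coeff x D *g x >> = << x >> *~ coeff x D :> {freeg {classic T} / int}.
  by rewrite freegU_mulz intz.
by rewrite !raddfMz FG.
Qed.

Lemma K0_lift (f : T -> int) :
  (forall x y z (u : Hom x y) (v : Hom y z) (h : Hom z (susp x)),
     dist u v h -> f y = f x + f z) ->
  exists F : {additive K0 T -> int}, forall x, F (K0_class x) = f x.
Proof.
move=> fadd; pose f' : {classic T} -> int^o := f.
pose L : {freeg {classic T} / int} -> int^o := fglift f'.
have LB (u v : {freeg {classic T} / int}) : L (u - v) = L u - L v.
  exact: (@lift_is_additive _ _ _ f').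
have Lgen x : L (generator x) = f x by rewrite /L /generator liftU scale1r.
have L0 u : u \in (triangle_relations (T := T)) -> L u = 0.
  move=> /asboolP /(_ [set v | L v = 0]); apply.
    split=> [|u' v' /= e e']; last by rewrite LB e e' subrr.
    by rewrite /= -[X in L X](subrr 0) LB subrr.
  by move=> x y z a b c d /=; rewrite !LB !Lgen (fadd _ _ _ _ _ _ d) addrAC addrK subrr.
pose F (u : K0 T) : int := L (repr u).
have FE u : F (\pi_({ideal_quot (triangle_relations (T := T) : zmodClosed _)}) u) = L u.
  apply/eqP; rewrite -subr_eq0 /F -[X in X == _]LB; apply/eqP/L0.
  by rewrite Quotient.idealrBE reprK.
have FB : zmod_morphism F.
  move=> u v; rewrite -[u]reprK -[v]reprK -raddfB !FE LB //.
pose FA : {additive K0 T -> int} := HB.pack F (GRing.isZmodMorphism.Build _ _ F FB).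
by exists FA => x; rewrite /= FE Lgen.
Qed.

End GrothendieckGroupTheory.

(** * Euler characteristics and the rank function *)

Section EulerCharacteristic.
Variables (k : fieldType) (T : triangulated_category k).
Implicit Types x y z : T.

Lemma fin_dim_dist x y z (f : Hom x y) (g : Hom y z) (h : Hom z (susp x)) t :
  dist f g h -> fin_dim (Hom x t) -> fin_dim (Hom z t) -> fin_dim (Hom y t).
Proof.
move=> d fx fz.
apply: (@fin_dim_exact _ _ _ _ (@precomp _ _ _ _ g t) (@precomp _ _ _ _ f t)) fz fx.
by move=> u /(dist_extend d).
Qed.

(* The dimensions along the long exact sequence obtained by applying the
   Hom (-, Q n), with Q n+1 the suspension of Q n, to a triangle; the ranks of
   the connecting morphisms telescope. *)
Lemma euler_additive (Q : nat -> T) n x y z (f : Hom x y) (g : Hom y z)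
    (h : Hom z (susp x)) : (forall i, isomorphic (susp (Q i)) (Q i.+1)) ->
  (forall i, (i <= n.+1)%N -> fin_dim (Hom x (Q i)) /\ fin_dim (Hom z (Q i))) ->
  orth x (Q 0) -> orth x (Q n) -> dist f g h ->
  \sum_(i < n) (-1) ^+ i * (dimk (Hom y (Q i.+1)))%:Z =
  \sum_(i < n) (-1) ^+ i * (dimk (Hom x (Q i.+1)))%:Z +
  \sum_(i < n) (-1) ^+ i * (dimk (Hom z (Q i.+1)))%:Z :> int.
Proof.
move=> hQ fd o0 on d.
have fdx i : (i <= n.+1)%N -> fin_dim (Hom x (Q i)) by case/fd.
have fdz i : (i <= n.+1)%N -> fin_dim (Hom z (Q i)) by case/fd.
have fdy i : (i <= n.+1)%N -> fin_dim (Hom y (Q i)).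
  by move=> le_in; apply: fin_dim_dist d _ _; [exact: fdx|exact: fdz].
pose th i : Hom (susp (Q i)) (Q i.+1) := sval (cid (hQ i)).
have thP i : is_iso (th i) by rewrite /th; case: cid.
(* The connecting map Hom (x, Q i) -> Hom (z, Q (i + 1)) of the long exact sequence. *)
pose con i := (precomp h (t := Q i.+1) \o
  (postcomp (th i) (x := susp x) \o fmap_fun susp (x := x) (y := Q i))).
have conE i u : con i u = th i \oc fmap susp u \oc h by [].
pose D i := rankk (con i).
pose A i := rankk (precomp f (t := Q i)); pose B i := rankk (precomp g (t := Q i)).
have yE i : (i <= n.+1)%N -> dimk (Hom y (Q i)) = (B i + A i)%N.
  move=> le_in; apply: dimk_exact; [exact: fdz|exact: fdy|exact: fdx| |].
    by move=> u; rewrite /= /precomp -compmA (dist_comp0 d) compm0.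
  by move=> v /(dist_extend d).
have xE i : (i <= n)%N -> dimk (Hom x (Q i)) = (A i + D i)%N.
  move=> le_in; apply: dimk_exact.
  - exact/fdy/leqW.
  - exact/fdx/leqW.
  - exact: fdz.
  - move=> u; rewrite -[LHS]/(con i (u \oc f)) conE fmap_comp -!compmA.
    by rewrite (dist_comp0'' d) !compm0.
  - move=> v; rewrite -[X in X = _]/(con i v) conE => v0.
    apply: (dist_extend'' d); have [t [tth _]] := thP i.
    by rewrite -[LHS]comp1m -tth -!compmA (compmA (th i)) v0 compm0.
have zE i : (i <= n)%N -> dimk (Hom z (Q i.+1)) = (D i + B i.+1)%N.
  move=> le_in; apply: dimk_exact.
  - exact/fdx/leqW.
  - exact: fdz.
  - exact: fdy.
  - move=> u; rewrite -[LHS]/(con i u \oc g) conE -!compmA.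
    by rewrite (dist_comp0' d) !compm0.
  - move=> v /(dist_extend' d)[v' ->]; have [t [_ tht]] := thP i.
    have [u uE] := susp_surj (t \oc v'); exists u.
    by rewrite -[RHS]/(con i u) conE uE compmA tht comp1m.
have D0 i : (i <= n)%N -> orth x (Q i) -> D i = 0%N.
  move=> le_in o; apply: rankk_triv; [exact/fdx/leqW|exact: fdz|].
  by left; apply: dimk_eq0.
have tele m : (m <= n)%N ->
  \sum_(i < m) (-1) ^+ i * (dimk (Hom y (Q i.+1)))%:Z -
  \sum_(i < m) (-1) ^+ i * (dimk (Hom x (Q i.+1)))%:Z -
  \sum_(i < m) (-1) ^+ i * (dimk (Hom z (Q i.+1)))%:Z =
  (-1) ^+ m * (D m)%:Z - (D 0%N)%:Z :> int.
  elim: m => [|m IH] mn; first by rewrite !big_ord0 expr0 mul1r !subr0 subrr.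
  rewrite !big_ord_recr /= exprS yE; last exact: ltnW.
  rewrite xE // zE; last exact: ltnW.
  rewrite !PoszD; have := IH (ltnW mn).
  set X1 := \sum_(_ < _) _; set X2 := \sum_(_ < _) _; set X3 := \sum_(_ < _) _.
  set s := (-1) ^+ m => e.
  rewrite -[X in _ = X](_ : (s * (D m)%:Z - (D 0%N)%:Z) - s * (D m)%:Z - s * (D m.+1)%:Z = _).
    by rewrite -e; ring.
  by ring.
have := tele n (leqnn n); rewrite (D0 n) // (D0 0%N) // mulr0 subrr.
by move/eqP; rewrite -addrA -opprD subr_eq0 => /eqP.
Qed.

End EulerCharacteristic.

Section Rank.
Variables (k : fieldType) (T : triangulated_category k) (w : int) (S : int -> T).
Hypotheses (w_le0 : w <= 0) (sphS : spherical_family w S).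
Hypotheses (genS : classically_generated (S 0)) (idemT : idempotent_complete T).
Implicit Types (x y z : T).

Lemma shift_sph (P : T -> T -> Prop) (b i : int) t : iso_invariant P ->
  (forall x y, P (susp x) (susp y) <-> P x y) ->
  P (S (b - i)) t -> P (S b) (spow T i t).
Proof.
move=> isoP suspP h.
have := @shift_induction _ _ P (fun j => S (b - i + j)) (fun j => spow T j t) isoP suspP.
move=> /(_ _ _ 0 _ i); rewrite !addr0 subrK; apply => //.
- by move=> j; rewrite addrA; exact: (sph_susp sphS).
- by move=> j; exact: susp_spow_isomorphic.
Qed.

(* The strings approximate the simple module of k[X]/(X^2), so inside the
   window of degrees [-N, N] the Euler characteristic of Hom (-, string) is
   that of a cohomological functor which is one-dimensional on S 0. *)
Theorem rank_exists : exists f : T -> int,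
  (forall x y z (u : Hom x y) (v : Hom y z) (h : Hom z (susp x)),
     dist u v h -> f y = f x + f z) /\ f (S 0) = 1.
Proof.
have [r [rP _ rE _]] := string_sequence w_le0 sphS.
(* Indices 1 to 2N + 1 run over the degrees -N to N. The string with index 2N has its spurious
   classes in degrees at most -2N, beyond reach of the window once N is large against the object. *)
pose Q N i := spow T (i%:Z - N%:Z - 1) (str_obj (r (2 * N)%N)).
have hQ N i : isomorphic (susp (Q N i)) (Q N i.+1).
  rewrite /Q; have -> : i.+1%:Z - N%:Z - 1 = i%:Z - N%:Z - 1 + 1 by lia.
  exact: susp_spow_isomorphic.
(* The factor (-1)^N turns the sign of each term into the parity of its degree, which makes the
   value independent of large N. *)
pose chi N x : int :=
  (-1) ^+ N * \sum_(i < (2 * N).+1) (-1) ^+ i * (dimk (Hom x (Q N i.+1)))%:Z.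
pose fd N x := forall i, (i <= (2 * N).+2)%N -> fin_dim (Hom x (Q N i)).
pose good x v := exists N0, forall N, (N0 <= N)%N ->
  [/\ fd N x, orth x (Q N 0%N), orth x (Q N (2 * N).+1) & chi N x = v].
have good_uniq x v v' : good x v -> good x v' -> v = v'.
  move=> [N NP] [N' N'P]; have [_ _ _ <-] := NP _ (leq_maxl N N').
  by have [_ _ _ <-] := N'P _ (leq_maxr N N').
have good_dist x y z (u : Hom x y) (v : Hom y z) (h : Hom z (susp x)) a b :
    dist u v h -> good x a -> good z b -> good y (a + b).
  move=> d [N1 N1P] [N2 N2P]; exists (maxn N1 N2) => N; rewrite geq_max => /andP[n1 n2].
  have [fx x0 xn <-] := N1P N n1; have [fz z0 zn <-] := N2P N n2; split.
  - by move=> i iN; apply: fin_dim_dist d (fx i iN) (fz i iN).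
  - exact: orth_extl d x0 z0.
  - exact: orth_extl d xn zn.
  - rewrite /chi -mulrDr; congr (_ * _).
    apply: (euler_additive (hQ N)) x0 xn d => i iN.
    by split; [exact: fx|exact: fz].
have good_zero x : is_zero x -> good x 0.
  move=> x0; exists 0%N => N _; split.
  - by move=> i _; apply: fin_dim0; exact: orth_zerol.
  - exact: orth_zerol.
  - exact: orth_zerol.
  - rewrite /chi big1 ?mulr0 // => i _; rewrite dimk_eq0 ?mulr0 //.
    exact: orth_zerol.
have good_sph b : good (S b) ((-1) ^+ absz (b + w)).
  (* N >= |b| + 2 keeps the spurious classes of the string out of the window and its margins; the
     summand |w| keeps the one relevant degree b + w strictly inside. *)
  exists ((absz b).+2 + absz w)%N => N bN.
  have rN : str_deg (r (2 * N)%N) - w <= - (2 * N)%:Z by rewrite rE; nia.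
  have off i : (i <= (2 * N).+2)%N -> i%:Z - N%:Z - 1 != b + w -> orth (S b) (Q N i).
    move=> iN ib; apply: (shift_sph (@orth_iso_invariant _ _) (@orth_susp_iff _ _)).
    by apply: (string_orth w_le0 sphS (rP _)); lia.
  have on i : i%:Z - N%:Z - 1 = b + w -> hom_line (S b) (Q N i).
    move=> ib; apply: (shift_sph (@hom_line_iso _ _) (@hom_line_susp _ _)).
    have -> : b - (i%:Z - N%:Z - 1) = - w by rewrite ib; lia.
    have [c [c0 _ cP]] := str_socle (rP (2 * N)%N); exists c; split=> // h.
    apply: cP; have o : orth (S (- w)) (S (str_deg (r (2 * N)%N))).
      by apply: (sph_orth sphS); lia.
    exact: o.
  have dim_on i : i%:Z - N%:Z - 1 = b + w -> has_dim (Hom (S b) (Q N i)) 1.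
    by move=> /on[u [/eqP u0 uP]]; exact: has_dim1 u0 uP.
  split.
  - move=> i iN; have [/dim_on h|/(off _ iN) h] := eqVneq (i%:Z - N%:Z - 1) (b + w).
      by exists 1%N.
    exact: fin_dim0.
  - by apply: off => //; lia.
  - by apply: off; lia.
  - have i0N : (absz (b + w + N%:Z)%R < (2 * N).+1)%N by lia.
    rewrite /chi (bigD1 (Ordinal i0N)) //= (dimkE (dim_on _ _)); last by lia.
    rewrite big1 ?addr0 => [|i /eqP ii0]; last first.
      rewrite dimk_eq0 ?mulr0 //; apply: off; first by rewrite ltnS ltnW.
      apply/negP => /eqP e; apply: ii0; apply/val_inj => /=.
      by move: e; lia.
    rewrite mulr1 -exprD.
    have [c ->] : exists c, (N + absz (b + w + N%:Z)%R = absz (b + w)%R + 2 * c)%N.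
      by exists ((N + absz (b + w + N%:Z)%R - absz (b + w)%R) %/ 2)%N; lia.
    by rewrite exprD exprM sqrrN !expr1n mulr1.
have goodE : forall x, exists v, good x v.
  apply: (finite_extension_induction w_le0 sphS genS idemT).
  - by move=> x /good_zero h; exists 0.
  - by move=> x y z u v h d [a xa] [b zb]; exists (a + b); exact: good_dist d xa zb.
  - by move=> b; exists ((-1) ^+ absz (b + w)); exact: good_sph.
have /choice[f fP] := goodE.
(* At [S 0] the only class sits in degree w and counts (-1)^|w|, which the extra sign cancels. *)
exists (fun x => (-1) ^+ absz (0 + w) * f x); split.
  move=> x y z u v h d; rewrite -mulrDr; congr (_ * _).
  exact: good_uniq (fP y) (good_dist _ _ _ _ _ _ _ _ d (fP x) (fP z)).
rewrite (good_uniq _ _ _ (fP (S 0)) (good_sph 0)) -exprD addnn -mul2n exprM.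
by rewrite sqrrN !expr1n.
Qed.

End Rank.

(** * Co-slicings *)

Section Coslicings.
Variables (R : realType) (k : fieldType) (T : triangulated_category k).
Variables (w : int) (S : int -> T).
Hypotheses (w_le0 : w <= 0) (sphS : spherical_family w S).
Hypotheses (genS : classically_generated (S 0)) (idemT : idempotent_complete T).
Implicit Types (x y z : T) (Q : R -> set T).

Local Notation Wle := (Wle S).
Local Notation Wge := (Wge S).

Lemma bottom_exists x : ~ is_zero x -> exists a, Wge a x /\ ~ orth (S a) x.
Proof.
move=> x0; apply: contrapT => no.
have [a xa] := Wge_exists w_le0 sphS genS x.
have [b xb] := Wle_exists w_le0 sphS genS x.
have xge (n : nat) : Wge (a + n%:Z) x.
  elim: n => [|n IH]; first by rewrite addr0.
  move=> i ian; have [e|ni] := eqVneq i (a + n%:Z); last by apply: IH; lia.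
  by apply: contrapT => no'; apply: no; exists i; rewrite {1}e.
apply: x0; apply: (Wle_Wge_zero w_le0 sphS genS _ xb (xge (absz (b - a)).+1)).
by lia.
Qed.

Lemma top_exists x : ~ is_zero x -> exists b, Wle b x /\ ~ orth x (S b).
Proof.
move=> x0; apply: contrapT => no.
have [a xa] := Wge_exists w_le0 sphS genS x.
have [b xb] := Wle_exists w_le0 sphS genS x.
have xle (n : nat) : Wle (b - n%:Z) x.
  elim: n => [|n IH]; first by rewrite subr0.
  move=> i ibn; have [e|ni] := eqVneq i (b - n%:Z); last by apply: IH; lia.
  by apply: contrapT => no'; apply: no; exists i; rewrite {1}e.
apply: x0; apply: (Wle_Wge_zero w_le0 sphS genS _ (xle (absz (b - a)).+1) xa).
by lia.
Qed.

Lemma coslicing_sph_susp Q r (i : int) : coslicing Q ->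
  Q r (S i) <-> Q (r + 1) (S (i + 1)).
Proof.
move=> [cl sQ _ _]; have isoQ r' : iso_closed (Q r') by case: (cl r').
have hS := sph_susp sphS i; split=> [ri|/sQ[y [ry yS]]].
  by apply/sQ; exists (S i).
have [f [g [gf fg]]] := isomorphic_trans yS (isomorphic_sym hS).
have [u uE] := susp_surj f.
apply: isoQ ry; exists u; apply: susp_iso_reflect; rewrite uE.
by exists g.
Qed.

Lemma coslicing_sph_shift Q r (i j : int) : coslicing Q ->
  Q r (S i) -> Q (r + j%:~R) (S (i + j)).
Proof.
move=> cQ ri; have up (l : int) := coslicing_sph_susp (r + l%:~R) (i + l) cQ.
case: j => n; elim: n => [|n IH]; [by rewrite !addr0| | |].
- by rewrite -addn1 PoszD !intrD !addrA; apply/up.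
- apply/up; rewrite -addrA -[i + _ + _]addrA.
  have -> : (Negz 0)%:~R + 1 = 0 :> R by rewrite NegzE addNr.
  by rewrite -addNegz0_1 !addr0.
- apply/up; rewrite -addrA -[i + _ + _]addrA -addNegz1.
  by have -> : (Negz n.+1)%:~R + 1 = (Negz n)%:~R :> R by rewrite -[1]/(1%:~R) -intrD -addNegz1.
Qed.

Lemma coslicing_phase Q : coslicing Q -> exists r, Q r (S 0).
Proof.
move=> cQ; have [cl sQ oQ fQ] := cQ.
have [n [c [a [q [ph [n0 c0 cn cq inc]]]]]] := fQ _ (@sph_neq0 _ _ _ _ sphS 0).
have [j [jn qj0]] : exists j, (j < n)%N /\ ~ is_zero (q j).
  apply: contrapT => no; apply: (@sph_neq0 _ _ _ _ sphS 0).
  apply: zero_iso cn _; apply/zero_idm.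
  apply: (filtration_orthl (n := n) (a := a) (q := q) c0) => // j jn.
    by have [_] := cq j jn.
  by apply: orth_zerol; apply: contrapT => h; apply: no; exists j.
have [Qq _] := cq j jn; move: (ph j) (q j) Qq qj0 => r x rx x0.
have [i [xi nxi]] := bottom_exists x0; have [b [xb nxb]] := top_exists x0.
have [ib|bi|e] := ltgtP i b.
- have rot m : exists y, [/\ Q (r + m%:R) y, Wge (i + m%:Z) y & ~ orth (S (i + m%:Z)) y].
    elim: m => [|m [y [ry yi nyi]]]; first by exists x; rewrite !addr0.
    exists (susp y); rewrite -natr1 -addn1 PoszD !addrA; split.
    + by apply/sQ; exists y; split=> //; exact: isomorphic_refl.
    + by apply/(Wge_susp w_le0 sphS).
    + move=> o; apply: nyi; apply: susp_orth; apply: orth_isol o.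
      exact/isomorphic_sym/(sph_susp sphS).
  have [y [ry yi nyi]] := rot (absz (b - i)).
  have ibE : i + (absz (b - i))%:Z = b by lia.
  rewrite ibE in yi nyi; case: (nonzero_maps w_le0 sphS genS xb yi nxb nyi).
  move=> f; apply: (oQ _ _ _ _ _ rx ry).
  by rewrite ltrDl ltr0n; lia.
- by case: x0; exact: (Wle_Wge_zero w_le0 sphS genS bi xb xi).
- have xi' : Wle i x by rewrite e.
  have [f [g gf]] := heart_retract_sph w_le0 sphS genS xi' xi x0.
  have [z bz] := retract_summand idemT gf.
  exists (r + (- i)%:~R); rewrite -(subrr i).
  apply: coslicing_sph_shift => //.
  by have [_ _ smQ] := cl r; apply: smQ rx; exists z.
Qed.

(** [S i] has phase r + i. The slice is defined by the orthogonality that every co-slicing with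
    [S 0] in phase r imposes, so one inclusion in [coslicing_weight] is automatic. It is nonzero
    only for p in r + Z, where it consists of the objects of a single weight. *)
Definition weight_coslice (r : R) : R -> set T := fun p => [set x | forall i : int,
  (p < r + i%:~R -> orth x (S i)) /\ (r + i%:~R < p -> orth (S i) x)].

Lemma weight_coslice_int r (i : int) x :
  weight_coslice r (r + i%:~R) x <-> Wle i x /\ Wge i x.
Proof.
split=> [h|[xi xi'] j].
  by split=> j ij; have [h1 h2] := h j; [apply: h1|apply: h2]; rewrite ltrD2l ltr_int.
by split; rewrite ltrD2l ltr_int; [exact: xi|exact: xi'].
Qed.

Lemma weight_coslice_weights r p x : weight_coslice r p x ->
  let i := Num.floor (p - r) in
  Wle i x /\ (forall j : int, r + j%:~R < p -> Wge (j + 1) x).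
Proof.
move=> h i; split.
  move=> j ij; have [h1 _] := h j; apply: h1; rewrite -ltrBlDl.
  by rewrite -floor_lt_int.
move=> j jp l lj; have [_ h2] := h l; apply: h2; apply: le_lt_trans jp.
by rewrite lerD2l ler_int; lia.
Qed.

(** The weights are at most the floor of p - r and, as p - r is not an integer, also at least one
    more than it. *)
Lemma weight_coslice_zero r p x : (forall i : int, p <> r + i%:~R) ->
  weight_coslice r p x -> is_zero x.
Proof.
move=> np h; have [xle xge] := weight_coslice_weights h.
set i := Num.floor (p - r) in xle.
apply: (Wle_Wge_zero w_le0 sphS genS _ xle (xge i _)); first by lia.
have le_ip : i%:~R <= p - r by case/andP: (floor_itv (p - r)).
rewrite lt_neqAle; apply/andP; split; first by apply/eqP => e; apply: (np i).
by rewrite -lerBrDl.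
Qed.

Lemma weight_coslice_nonzero r p x : weight_coslice r p x -> ~ is_zero x ->
  exists i : int, [/\ p = r + i%:~R, Wle i x & Wge i x].
Proof.
move=> h x0; have [[i pE]|no] := pselect (exists i : int, p = r + i%:~R).
  by exists i; split=> //; rewrite pE in h; case: (weight_coslice_int r i x).1.
case: x0; apply: weight_coslice_zero h => i pE.
by apply: no; exists i.
Qed.

Lemma coslicing_weight Q r : coslicing Q -> Q r (S 0) -> Q = weight_coslice r.
Proof.
move=> cQ r0; have [cl sQ oQ fQ] := cQ.
have rS (i : int) : Q (r + i%:~R) (S i).
  by have := coslicing_sph_shift i cQ r0; rewrite add0r.
apply/funext => p; apply/seteqP; split=> [x px i|x h].
  by split=> lt_p f; [exact: oQ lt_p px (rS i) f|exact: oQ lt_p (rS i) px f].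
have [x0|x0] := pselect (is_zero x); first by have [_ [zQ _] _] := cl p; exact: zQ.
have [i [-> xi xi']] := weight_coslice_nonzero h x0.
have [_ [zQ sumQ] _] := cl (r + i%:~R).
apply: (heart_induction w_le0 sphS genS idemT _ _ xi xi') => //.
by move=> y z bz yQ; exact: sumQ bz (rS i) yQ.
Qed.

(** Layers are taken off from the top, each fibre being the next lower term. The weights a, ..., a +
    n give n + 1 factors, some of which may be zero. *)
Lemma weight_filtration n (a : int) x : Wge a x -> Wle (a + n%:Z) x ->
  exists (c q : nat -> T), [/\ is_zero (c 0%N), isomorphic (c n.+1) x &
    forall i, (i < n.+1)%N -> [/\ Wle (a + i%:Z) (q i), Wge (a + i%:Z) (q i) &
      exists (f : Hom (c i) (c i.+1)) (b : Hom (c i.+1) (q i))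
        (d : Hom (q i) (susp (c i))), dist f b d]].
Proof.
elim: n x => [|n IH] x xa xn.
  have [z0 z0P] := zero_exists T.
  exists (fun i => if i is 0%N then z0 else x), (fun=> x); split=> //.
    exact: isomorphic_refl.
  case=> // _; rewrite !addr0 in xn *; split=> //.
  have [x' [f [h d]]] := fiber_exists (idm x).
  have z' : is_zero x'.
    apply/zero_idm; apply: susp_inj; rewrite fmap0 fmap1.
    have h0 : h = 0 by rewrite -[h]compm1 (dist_comp0' d).
    have [|v ->] := dist_lift' (dist_rot d) (u := idm (susp x')).
      by have := dist_comp0 d; rewrite comp1m => ->; rewrite fmap0 oppr0 comp0m.
    by rewrite h0 comp0m.
  have [f' [h' d']] := dist_iso1 d (zero_isomorphic z0P z').
  by exists f', (idm x), h'.
have [m [p [i [q [t [f [g [h [pw d tb _ _]]]]]]]]] :=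
  left_approximation w_le0 sphS genS xn.
have ta : Wge a t.
  by apply: (left_approximation_Wge w_le0 sphS pw d _ xa); lia.
have [|c [q' [c0 cn cq]]] := IH t ta.
  by move: tb; have -> : a + n.+1%:Z - 1 = a + n%:Z by lia.
exists (fun i => if (i <= n.+1)%N then c i else x).
exists (fun i => if (i <= n)%N then q' i else p).
rewrite ltnn; split=> //; first exact: isomorphic_refl.
move=> j jn2; have [->|jn] : j = n.+1 \/ (j < n.+1)%N by lia.
  rewrite leqnn !ltnn; split.
  - by move=> l lb; apply: power_orthl pw _; exact: (Wle_S w_le0 sphS).
  - by move=> l lb; apply: power_orthr pw _; exact: (Wge_S w_le0 sphS).
  - have [f' [h' d']] := dist_iso1 d cn.
    by exists f', g, h'.
have [q1 q2 tri] := cq j jn.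
by rewrite (ltnW jn) jn -ltnS jn.
Qed.

Lemma weight_coslice_coslicing r : coslicing (weight_coslice r).
Proof.
split.
- move=> p; split.
  + move=> x y xy h i; have [h1 h2] := h i; split=> pi.
      by apply: orth_isol xy _; exact: h1.
    by apply: orth_isor xy _; exact: h2.
  + split=> [x x0 i|x y s b hx hy i].
      by split=> _; [exact: orth_zerol|exact: orth_zeror].
    have [i1 [i2 [p1 [p2 [e1 e2 _ e4 e5]]]]] := b.
    have d := biproduct_dist e1 e2 e4 e5.
    have [h1 h2] := hx i; have [h3 h4] := hy i; split=> pi.
      by apply: orth_extl d _ _; [exact: h1|exact: h3].
    by apply: orth_extr d _ _; [exact: h2|exact: h4].
  + move=> x s /summand_retract[i1 [p1 pi]] h i; have [h1 h2] := h i; split=> lt_p.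
      by apply: orth_retractl pi _; exact: h1.
    by apply: orth_retractr pi _; exact: h2.
- move=> p x; split=> [h|[y [h yx]] i].
    have dx := desuspK_isomorphic x; have xd := isomorphic_sym dx.
    exists (desusp x); split=> // i; have [h1 h2] := h (i + 1).
    rewrite intrD in h1 h2; have hS := isomorphic_sym (sph_susp sphS i).
    split=> lt_p; apply: susp_orth.
      by apply: orth_isol xd _; apply: orth_isor hS _; apply: h1; lra.
    by apply: orth_isor xd _; apply: orth_isol hS _; apply: h2; lra.
  have [h1 h2] := h (i - 1); rewrite intrB in h1 h2; have hS := sph_susp_pred sphS i.
  split=> lt_p.
    by apply: orth_isol yx _; apply: orth_isor hS _; apply/orth_susp/h1; lra.
  by apply: orth_isor yx _; apply: orth_isol hS _; apply/orth_susp/h2; lra.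
- move=> p1 p2 x y p12 hx hy.
  have [xle _] := weight_coslice_weights hx.
  have [_ yge] := weight_coslice_weights hy.
  set i := Num.floor (p1 - r) in xle.
  apply: (Wle_orth_Wge w_le0 sphS genS _ xle (yge i _)); first by lia.
  apply: le_lt_trans p12; rewrite -lerBrDl; by case/andP: (floor_itv (p1 - r)).
- move=> t t0.
  have [a ta] := Wge_exists w_le0 sphS genS t.
  have [b tb] := Wle_exists w_le0 sphS genS t.
  have [ba|ab] := ltP b a.
    by case: t0; exact: (Wle_Wge_zero w_le0 sphS genS ba tb ta).
  have abE : a + (absz (b - a))%:Z = b by lia.
  rewrite -abE in tb; have [c [q [c0 cn cq]]] := weight_filtration ta tb.
  set n := absz (b - a) in cn cq.
  (* A filtration carries a morphism at every index; beyond its length the zero map is used. *)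
  have aE i : exists f : Hom (c i) (c i.+1), (i < n.+1)%N ->
      exists (b : Hom (c i.+1) (q i)) (d : Hom (q i) (susp (c i))), dist f b d.
    have [i_n|_] := boolP (i < n.+1)%N; last by exists 0.
    by have [_ _ [f h]] := cq i i_n; exists f.
  pose aP i := cid (aE i).
  exists n.+1, c, (fun i => sval (aP i)), q, (fun i => r + (a + i%:Z)%:~R).
  split=> //.
    move=> i i_n; have [q1 q2 _] := cq i i_n; split.
      exact/weight_coslice_int.
    exact: (svalP (aP i)) i_n.
  by move=> i j /andP[ij _]; rewrite ltrD2l ltr_int; lia.
Qed.

Lemma indecomposable_heart x (i : int) : Wle i x -> Wge i x -> indecomposable x ->
  isomorphic x (S i).
Proof.
move=> xi xi' [x0 ind].
have [f [g gf]] := heart_retract_sph w_le0 sphS genS xi xi' x0.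
have [z bz] := retract_summand idemT gf.
have [i1 [i2 [p1 [p2 [h1 h2 h3 h4 h5]]]]] := bz.
have [/(sph_neq0 sphS)//|z0] := ind _ _ bz.
exists p1, i1; split=> //; rewrite -h5.
by have -> : i2 = 0 by [exact: orth_zerol]; rewrite comp0m addr0.
Qed.

Lemma weight_coslice_S r : condition_S (weight_coslice r).
Proof.
move=> p x y hx hy ix iy nxy.
have [i [pE xi xi']] := weight_coslice_nonzero hx ix.1.
have [j [pE' yj yj']] := weight_coslice_nonzero hy iy.1.
have ij : i = j by move: pE; rewrite pE' => /addrI /eqP; rewrite eqr_int => /eqP.
subst j; case: nxy; apply: isomorphic_trans (indecomposable_heart xi xi' ix) _.
exact/isomorphic_sym/indecomposable_heart.
Qed.

Lemma weight_coslice_sph r : weight_coslice r r (S 0).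
Proof.
have := (weight_coslice_int r 0 (S 0)).2; rewrite mulr0z addr0; apply.
by split; [exact: (Wle_S w_le0 sphS)|exact: (Wge_S w_le0 sphS)].
Qed.

Lemma weight_coslice_inj r r' : weight_coslice r r' (S 0) -> r = r'.
Proof.
move=> h; apply/eqP; rewrite eq_le !leNgt; apply/andP; split; apply/negP => lt_r;
  apply: (@sph_neq0 _ _ _ _ sphS 0); apply/zero_idm; have [h1 h2] := h 0.
- by apply: h1; rewrite addr0.
- by apply: h2; rewrite addr0.
Qed.

End Coslicings.

(** * The co-stability manifold *)

Section ComplexPlane.
Variable R : realType.
Implicit Types (z : R[i]) (a b : R).

Lemma norm_Complex a b : `|Complex a b| = (Num.sqrt (a ^+ 2 + b ^+ 2))%:C%C.
Proof. by rewrite normc_def. Qed.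

Lemma norm_exp_ipi a : `|exp_ipi a| = 1.
Proof. by rewrite norm_Complex cos2Dsin2 sqrtr1. Qed.

Lemma exp_ipiD1 a : exp_ipi (a + 1) = - exp_ipi a.
Proof.
rewrite /exp_ipi mulrDr mulr1; apply/eqP.
by rewrite eq_complex /= cosDpi sinDpi !eqxx.
Qed.

Lemma exp_ipi_int a (i : int) : exp_ipi (a + i%:~R) = (-1) ^+ absz i * exp_ipi a.
Proof.
have nat_case (n : nat) b : exp_ipi (b + n%:R) = (-1) ^+ n * exp_ipi b.
  elim: n => [|n IH]; first by rewrite addr0 mul1r.
  by rewrite -natr1 addrA exp_ipiD1 IH exprS mulN1r mulNr.
case: i => n; first exact: nat_case.
rewrite NegzE abszN intrN.
have := nat_case n.+1 (a - n.+1%:R); rewrite subrK => ->.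
by rewrite mulrA -exprD addnn -mul2n exprM sqrrN !expr1n mul1r.
Qed.

Lemma Re_cvg (I : Type) (F : set_system I) {FF : Filter F} (u : I -> R[i]) z :
  u x @[x --> F] --> z -> complex.Re (u x) @[x --> F] --> complex.Re z.
Proof.
move=> /(@cvgrPdist_lt _ R[i]^o) uz; apply/cvgrPdist_lt => e e0.
have e0' : 0 < e%:C%C :> R[i] by rewrite ltcR.
apply: filterS (uz _ e0') => x; rewrite -ltcR; apply: le_lt_trans.
by apply: le_trans (normc_ge_Re _); rewrite raddfB.
Qed.

Lemma Im_cvg (I : Type) (F : set_system I) {FF : Filter F} (u : I -> R[i]) z :
  u x @[x --> F] --> z -> complex.Im (u x) @[x --> F] --> complex.Im z.
Proof.
move=> /(@cvgrPdist_lt _ R[i]^o) uz; apply/cvgrPdist_lt => e e0.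
have e0' : 0 < e%:C%C :> R[i] by rewrite ltcR.
apply: filterS (uz _ e0') => x; rewrite -ltcR; apply: le_lt_trans.
rewrite normc_def lecR raddfB -sqrtr_sqr ler_wsqrtr //=.
by rewrite raddfB lerDr sqr_ge0.
Qed.

Lemma Complex_cvg (I : Type) (F : set_system I) {FF : Filter F} (u v : I -> R) a b :
  u x @[x --> F] --> a -> v x @[x --> F] --> b ->
  Complex (u x) (v x) @[x --> F] --> (Complex a b : R[i]).
Proof.
move=> /cvgrPdist_lt ua /cvgrPdist_lt vb; apply/(@cvgrPdist_lt _ R[i]^o) => e.
(* In the order of R[i] a positive number has zero imaginary part, so [e] may be treated as real. *)
rewrite ltcE => /andP[/eqP ei e0]; rewrite /= in ei e0.
have e2 : 0 < complex.Re e / 2 by rewrite divr_gt0.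
apply: filterS2 (ua _ e2) (vb _ e2) => x ux vx.
have -> : e = (complex.Re e)%:C%C by apply/eqP; rewrite eq_complex /= ei !eqxx.
have -> : (Complex a b : R[i]) - Complex (u x) (v x) = Complex (a - u x) (b - v x) by [].
rewrite norm_Complex ltcR -[ltRHS]gtr0_norm // -sqrtr_sqr ltr_sqrt ?exprn_gt0 //.
rewrite -[(a - _) ^+ 2]real_normK ?num_real // -[(b - _) ^+ 2]real_normK ?num_real //.
have := normr_ge0 (a - u x); have := normr_ge0 (b - v x).
set A := `|a - u x| in ux *; set B := `|b - v x| in vx *; set E := complex.Re e in e0 e2 ux vx *.
by nra.
Qed.

Lemma modulus_cvg (I : Type) (F : set_system I) {FF : Filter F} (u : I -> R[i]) z :
  u x @[x --> F] --> z -> complex.Re `|u x| @[x --> F] --> complex.Re `|z|.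
Proof.
move=> uz; apply: Re_cvg; exact: (@cvg_norm _ R[i]^o).
Qed.

End ComplexPlane.

(** * Charges, phases and the homeomorphism *)

Section Charges.
Variables (R : realType) (k : fieldType) (T : triangulated_category k).
Variables (w : int) (S : int -> T).
Hypotheses (w_le0 : w <= 0) (sphS : spherical_family w S).
Hypotheses (genS : classically_generated (S 0)) (idemT : idempotent_complete T).

(** The positive multiplicity n multiplies the mass of [S i], which gives positivity of the mass on
    the whole slice. *)
Lemma heart_class x (i : int) : Wle S i x -> Wge S i x ->
  exists n, K0_class x = K0_class (S i) *+ n /\ (~ is_zero x -> (0 < n)%N).
Proof.
move: x; apply: (heart_induction w_le0 sphS genS idemT) => [y y0|y z b [n [yn _]]].
  by exists 0%N; split=> //; rewrite K0_zero.
by exists n.+1; split=> //; rewrite (K0_biproduct b) yn mulrS.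
Qed.

Lemma charge_sph (Z : {additive K0 T -> R[i]}) (i : int) :
  Z (K0_class (S i)) = (-1) ^+ absz i * Z (K0_class (S 0)).
Proof.
have step j : Z (K0_class (S (j + 1))) = - Z (K0_class (S j)).
  by rewrite -(K0_iso (sph_susp sphS j)) K0_susp raddfN.
case: i => n; elim: n => [|n IH]; [by rewrite mul1r| | |].
- by rewrite [in LHS]addPosz1 step IH /= exprS mulN1r mulNr.
- have := step (Negz 0); rewrite -addNegz0_1 => ->.
  by rewrite expr1 mulN1r opprK.
- have := step (Negz n.+1); rewrite -addNegz1 IH => /eqP.
  by rewrite -eqr_oppLR => /eqP <-; rewrite [in RHS]exprS mulN1r mulNr.
Qed.

Lemma charge_ext (Z Z' : {additive K0 T -> R[i]}) :
  Z (K0_class (S 0)) = Z' (K0_class (S 0)) -> Z =1 Z'.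
Proof.
move=> e; apply: K0_ext.
apply: (finite_extension_induction w_le0 sphS genS idemT).
- by move=> x /K0_zero ->; rewrite !raddf0.
- by move=> x y z f g h /K0_dist -> xe ze; rewrite !raddfD xe ze.
- by move=> j; rewrite (charge_sph Z) (charge_sph Z') e.
Qed.

Lemma charge_weight_coslice (Z : {additive K0 T -> R[i]}) m r : 0 < m ->
  Z (K0_class (S 0)) = m%:C%C * exp_ipi r -> charge_compatible Z (weight_coslice S r).
Proof.
move=> m0 ZE p x h x0.
have [i [-> xi xi']] := weight_coslice_nonzero w_le0 sphS genS h x0.
have [n [xn n0]] := heart_class xi xi'.
exists (m *+ n); split; first by rewrite pmulrn_lgt0 // n0.
rewrite xn raddfMn /= charge_sph ZE exp_ipi_int.
by rewrite rmorphMn /= mulrnAl mulrCA.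
Qed.

Lemma charge_exists : exists F : {additive K0 T -> int}, F (K0_class (S 0)) = 1.
Proof.
have [f [fadd f1]] := rank_exists w_le0 sphS genS idemT.
by have [F FE] := K0_lift fadd; exists F; rewrite FE.
Qed.

Lemma Coslice_eq (Q Q' : Coslice R T) : coslice_parts Q = coslice_parts Q' -> Q = Q'.
Proof.
case: Q Q' => [Q c s] [Q' c' s'] /= e; subst Q'.
by rewrite (Prop_irrelevance c c') (Prop_irrelevance s s').
Qed.

Lemma additive_eq (U V : zmodType) (F G : {additive U -> V}) : F =1 G -> F = G.
Proof.
move=> /funext; case: F G => [F [[cF]]] [G [[cG]]] /= e; subst G.
by rewrite (Prop_irrelevance cF cG).
Qed.

Lemma Costab_eq (s s' : Costab R T) :
  costab_charge s = costab_charge s' -> costab_coslice s = costab_coslice s' -> s = s'.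
Proof.
case: s s' => [Z Q h] [Z' Q' h'] /= e e'; subst Z' Q'.
by rewrite (Prop_irrelevance h h').
Qed.

Definition weight_Coslice r : Coslice R T :=
  MkCoslice (weight_coslice_coslicing w_le0 sphS genS r)
    (weight_coslice_S w_le0 sphS genS idemT (r := r)).

Lemma Coslice_weight (Q : Coslice R T) : exists r, Q = weight_Coslice r.
Proof.
have cQ := coslice_coslicing Q.
have [r r0] := coslicing_phase w_le0 sphS genS idemT cQ.
exists r; apply: Coslice_eq; exact: (coslicing_weight w_le0 sphS genS idemT cQ r0).
Qed.

Definition phase (Q : Coslice R T) : R := sval (cid (Coslice_weight Q)).

Lemma phaseK : cancel phase weight_Coslice.
Proof. by move=> Q; rewrite /phase; case: cid. Qed.

Lemma weight_CosliceK : cancel weight_Coslice phase.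
Proof.
move=> r; have := phaseK (weight_Coslice r) => /(congr1 (@coslice_parts _ _ _)) /= e.
by apply: (weight_coslice_inj sphS); rewrite e; exact: (weight_coslice_sph w_le0 sphS).
Qed.

Lemma coslice_interval_orth (Q : R -> set T) (I : set R) y :
  (forall r, I r -> forall x, Q r x -> orth x y) ->
  forall x, coslice_interval Q I x -> orth x y.
Proof.
move=> h x /(_ (fun z => orth z y)); apply.
- by move=> z [r /h]; exact.
- by move=> x1 x2; exact: orth_isol.
- by move=> x1 x2 x3 f g hh d; exact: orth_extl d.
- by move=> x1 x2 /summand_retract[i1 [p1 pi]]; exact: orth_retractl pi.
Qed.

Lemma coslice_interval_orth' (Q : R -> set T) (I : set R) y :
  (forall r, I r -> forall x, Q r x -> orth y x) ->
  forall x, coslice_interval Q I x -> orth y x.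
Proof.
move=> h x /(_ (fun z => orth y z)); apply.
- by move=> z [r /h]; exact.
- by move=> x1 x2; exact: orth_isor.
- by move=> x1 x2 x3 f g hh d; exact: orth_extr d.
- by move=> x1 x2 /summand_retract[i1 [p1 pi]]; exact: orth_retractr pi.
Qed.

(** [S 0] has phase r in the first co-slicing and r' in the second. If r' lay outside
    [r - d, r + d], the second co-slicing would make [S 0] orthogonal to itself. Together with
    [weight_Coslice_dist], this makes the parametrisation by the phase isometric. *)
Lemma dist_weight_Coslice r r' e :
  (coslicing_dist (weight_Coslice r) (weight_Coslice r') < e%:E)%E -> `|r - r'| < e.
Proof.
move=> /ereal_inf_lt[_ [d [d0 dP] <-]]; rewrite lte_fin => de.
apply: le_lt_trans de; have s0 := dP r _ (weight_coslice_sph w_le0 sphS r).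
have [_ _ oQ _] := weight_coslice_coslicing w_le0 sphS genS r'.
have s1 := weight_coslice_sph w_le0 sphS r'.
rewrite ler_norml; apply/andP; split; rewrite leNgt; apply/negP => lt_d;
  apply: (@sph_neq0 _ _ _ _ sphS 0); apply/zero_idm.
- apply: (coslice_interval_orth (I := `[r - d, r + d]%classic) _ s0) => p pI x px.
  move=> f; apply: (oQ p r' x (S 0) _ px s1 f).
  by move: pI; rewrite /= in_itv /= => /andP[_ pI]; lra.
- apply: (coslice_interval_orth' (I := `[r - d, r + d]%classic) _ s0) => p pI x px.
  move=> f; apply: (oQ r' p (S 0) x _ s1 px f).
  by move: pI; rewrite /= in_itv /= => /andP[pI _]; lra.
Qed.

Lemma weight_coslice_shift (r p d : R) x :
  weight_coslice S r p x -> weight_coslice S (r + d) (p + d) x.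
Proof. by move=> h i; have [h1 h2] := h i; split=> lt_p; [apply: h1|apply: h2]; lra. Qed.

Lemma weight_Coslice_dist r r' e : `|r - r'| < e ->
  (coslicing_dist (weight_Coslice r) (weight_Coslice r') < e%:E)%E.
Proof.
(* [d] must be positive even when r = r', and smaller than [e]; each slice then lies in the slice of
   the other co-slicing whose phase is shifted by r' - r. *)
move=> re; have [d rd de] : exists2 d, `|r - r'| < d & d < e.
  by exists ((`|r - r'| + e) / 2); lra.
apply: le_lt_trans (_ : (d%:E < e%:E)%E); last by rewrite lte_fin.
apply: ereal_inf_lbound; exists d => //; split.
  by apply: le_lt_trans rd.
move=> p x px P XP _ _ _; apply: XP; exists (p + (r' - r)).
  by rewrite /= in_itv /=; move: rd; rewrite ltr_norml => /andP[]; lra.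
have := weight_coslice_shift (r' - r) px.
by have -> : r + (r' - r) = r' by lra.
Qed.

Lemma weight_Coslice_continuous : continuous weight_Coslice.
Proof.
apply/continuousP => A oA; rewrite openE => r /= Ar.
have [e e0 eA] := oA _ Ar.
rewrite /interior -nbhs_ballE; exists e => //= r' rr'.
by apply: eA; exact: weight_Coslice_dist.
Qed.

Lemma phase_continuous : continuous phase.
Proof.
move=> Q; apply/(@cvgrPdist_lt _ _ _ _ (nbhs_filter Q)) => e e0.
pose B : set (Coslice R T) := [set Q' | `|phase Q - phase Q'| < e].
have oB : open B.
  rewrite -[open B]/(coslice_open B) => Q' BQ'.
  exists (e - `|phase Q - phase Q'|); first by rewrite subr_gt0.
  move=> Q''; rewrite -{1}(phaseK Q') -{1}(phaseK Q'') => /dist_weight_Coslice lt_d.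
  rewrite /B /=; apply: le_lt_trans (ler_distD (phase Q') _ _) _.
  by rewrite -ltrBrDl.
apply: (open_nbhs_nbhs (A := B)); split=> //.
by rewrite /B /= subrr normr0.
Qed.

Definition costab_point (s : Costab R T) : R[i] :=
  Complex (ln (complex.Re `|costab_charge s (K0_class (S 0))|)) (phase (costab_coslice s)).

Lemma costab_charge_sph (s : Costab R T) : exists m : R, 0 < m /\
  costab_charge s (K0_class (S 0)) = m%:C%C * exp_ipi (phase (costab_coslice s)).
Proof.
have s0 : coslice_parts (costab_coslice s) (phase (costab_coslice s)) (S 0).
  rewrite -{1}(phaseK (costab_coslice s)); exact: (weight_coslice_sph w_le0 sphS).
exact: (costab_compatible s0 (@sph_neq0 _ _ _ _ sphS 0)).
Qed.

Lemma norm_charge (m r : R) : 0 < m -> complex.Re `|m%:C%C * exp_ipi r| = m.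
Proof.
by move=> m0; rewrite normrM norm_exp_ipi mulr1 ger0_norm // ler0c ltW.
Qed.

Lemma costab_point_continuous : continuous costab_point.
Proof.
move=> s; have inc := @initial_continuous _ _ (@costab_incl R k T) s.
have Fs : Filter (nbhs s) := nbhs_filter s.
pose c0 (s : Costab R T) := costab_charge s (K0_class (S 0)).
pose ev (p : {ptws K0 T -> R[i]} * Coslice R T) := p.1 (K0_class (S 0)).
have evC : continuous ev.
  move=> p; apply: (@cvg_comp _ _ _ fst (fun f : {ptws K0 T -> R[i]} => f (K0_class (S 0)))).
    exact: cvg_fst.
  exact: (@proj_continuous _ (fun=> R[i]) (K0_class (S 0))).
pose ph (p : {ptws K0 T -> R[i]} * Coslice R T) := phase p.2.
have phC : continuous ph.
  by move=> p; apply: (@cvg_comp _ _ _ snd phase); [exact: cvg_snd|exact: phase_continuous].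
have c0C : c0 x @[x --> s] --> c0 s.
  exact: (@cvg_comp _ _ _ (@costab_incl R k T) ev _ _ _ inc (evC _)).
have psC : phase (costab_coslice x) @[x --> s] --> phase (costab_coslice s).
  exact: (@cvg_comp _ _ _ (@costab_incl R k T) ph _ _ _ inc (phC _)).
apply: Complex_cvg psC.
apply: (@cvg_comp _ _ _ (fun x => complex.Re `|c0 x|) (@ln R) _ _ _ (modulus_cvg c0C)).
have [m [m0 sE]] := costab_charge_sph s.
by apply: continuous_ln; rewrite /c0 sE norm_charge.
Qed.

Variable rk : {additive K0 T -> int}.
Hypothesis rk1 : rk (K0_class (S 0)) = 1.

Definition point_value (z : R[i]) : R[i] :=
  (expR (complex.Re z))%:C%C * exp_ipi (complex.Im z).

Definition point_charge_fun (z : R[i]) (u : K0 T) : R[i] := point_value z *~ rk u.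

Fact point_charge_is_zmod_morphism z : zmod_morphism (point_charge_fun z).
Proof. by move=> u v; rewrite /point_charge_fun raddfB mulrzBr. Qed.

HB.instance Definition _ z := GRing.isZmodMorphism.Build (K0 T) R[i]
  (point_charge_fun z) (point_charge_is_zmod_morphism z).

Lemma point_charge_sph z : point_charge_fun z (K0_class (S 0)) = point_value z.
Proof. by rewrite /point_charge_fun rk1 mulr1z. Qed.

Fact point_compatible z : charge_compatible
  (point_charge_fun z : {additive K0 T -> R[i]}) (weight_Coslice (complex.Im z)).
Proof.
apply: charge_weight_coslice (expR_gt0 (complex.Re z)) _.
exact: point_charge_sph.
Qed.

Definition point_costab z : Costab R T := MkCostab (@point_compatible z).

Lemma costab_pointK : cancel costab_point point_costab.
Proof.
move=> s; apply: Costab_eq; last exact: phaseK.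
apply/additive_eq/charge_ext.
have [m [m0 sE]] := costab_charge_sph s.
transitivity ((expR (ln (complex.Re `|costab_charge s (K0_class (S 0))|)))%:C%C *
  exp_ipi (phase (costab_coslice s))); first exact: point_charge_sph.
by rewrite sE norm_charge // lnK.
Qed.

Lemma point_costabK : cancel point_costab costab_point.
Proof.
move=> z; transitivity (Complex (ln (complex.Re `|point_value z|)) (complex.Im z)).
  rewrite -point_charge_sph -[in RHS](weight_CosliceK (complex.Im z)).
  by [].
by rewrite norm_charge ?expR_gt0 // expRK; case: z.
Qed.

Lemma point_value_cvg z : point_value x @[x --> z] --> point_value z.
Proof.
have pE x : point_value x = Complex (expR (complex.Re x) * cos (pi * complex.Im x))
    (expR (complex.Re x) * sin (pi * complex.Im x)).
  by apply/eqP; rewrite eq_complex /= !mul0r subr0 addr0 !eqxx.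
have ReC : complex.Re x @[x --> z] --> complex.Re z.
  exact: (@Re_cvg _ _ _ (nbhs_filter z) id z (@cvg_id _ _)).
have ImC : complex.Im x @[x --> z] --> complex.Im z.
  exact: (@Im_cvg _ _ _ (nbhs_filter z) id z (@cvg_id _ _)).
have piC : pi * complex.Im x @[x --> z] --> pi * complex.Im z.
  exact: (cvgM (cvg_cst pi) ImC).
have eC := @cvg_comp _ _ _ (@complex.Re R) expR _ _ _ ReC (@continuous_expR R _).
have cC := @cvg_comp _ _ _ (fun x => pi * complex.Im x) cos _ _ _ piC (@continuous_cos R _).
have sC := @cvg_comp _ _ _ (fun x => pi * complex.Im x) sin _ _ _ piC (@continuous_sin R _).
rewrite pE; under eq_fun do rewrite pE.
exact: (@Complex_cvg _ _ _ (nbhs_filter z) _ _ _ _ (cvgM eC cC) (cvgM eC sC)).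
Qed.

Lemma point_costab_continuous : continuous point_costab.
Proof.
apply: (@continuous_comp_initial _ _ _ (@costab_incl R k T)) => z.
have wC : weight_Coslice (complex.Im x) @[x --> z] --> weight_Coslice (complex.Im z).
  have ImC := @Im_cvg _ _ _ (nbhs_filter z) id z (@cvg_id _ _).
  exact: (@cvg_comp _ _ _ (@complex.Im R) weight_Coslice _ _ _ ImC
    (@weight_Coslice_continuous _)).
pose pc x : {ptws K0 T -> R[i]} := point_charge_fun x.
have pcC : continuous pc.
  move=> {z wC} z; have FF : Filter (pc x @[x --> z]).
    exact: (@fmap_filter _ _ _ _ (nbhs_filter z)).
  (* Pointwise convergence is tested on one class [u] at a time, where the charge is the fixed
     integer [rk u] times the continuous [point_value]. *)
  apply/cvg_sup => u.
  move: {FF} z; apply: continuous_comp_initial => z.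
  have pE x : point_charge_fun x u = Complex ((rk u)%:~R * complex.Re (point_value x))
      ((rk u)%:~R * complex.Im (point_value x)).
    by apply/eqP; rewrite eq_complex !raddfMz !mulrzl !eqxx.
  have cE : point_charge_fun x u @[x --> z] --> point_charge_fun z u.
    have FF := nbhs_filter z; have vC := @point_value_cvg z.
    rewrite pE; under eq_fun do rewrite pE.
    exact: (Complex_cvg (cvgM (cvg_cst _) (Re_cvg vC)) (cvgM (cvg_cst _) (Im_cvg vC))).
  exact: cE.
exact: (cvg_pair (pcC z) wC).
Qed.

End Charges.

Theorem theorem10p1 (R : realType) (k : closedFieldType) (w : int)
    (w_le0 : w <= 0) (U : triangulated_category k)
    (U_algebraic : algebraic U) (U_idem : idempotent_complete U)
    (s : U) (s_spherical : spherical w s)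
    (s_generates : classically_generated s) :
  stability_manifold R U = set0 /\ homeomorphic (Costab R U) R[i].
Proof.
have sphS := spherical_family_spow w_le0 s_spherical.
split.
  apply/seteqP; split=> // p _.
  exact: (slicing_false w_le0 sphS s_generates (stab_slicing p)).
have [rk rk1] := charge_exists w_le0 sphS s_generates U_idem.
exists (@costab_point R k U w _ w_le0 sphS s_generates U_idem).
exists (@point_costab R k U w _ w_le0 sphS s_generates U_idem rk rk1).
split.
- exact: costab_pointK.
- exact: point_costabK.
- exact: costab_point_continuous.
- exact: point_costab_continuous.
Qed.
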